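(* Let $P\subset\mathbb{R}^2$ be a regular $n$-gon ($n\ge 3$) with center $O$, let $G$ be a symmetry group of $P$ containing the rotation group of $P$, and let $\mathcal{S}=\{S_1,\dots,S_m\}$ be a contractible $G$-symmetric $P$-polygonal system with attractor $K$. Then: 1. If $n\ge 6$, then every ramification point of $K$ is an image $S_{\mathbf{j}}(O)$ of the center $O$ and has order $n$ in $K$. 2. If $n=4$ or $n=5$, then there is a finite (possibly empty) set of ramification points $x_1,\dots,x_r$ of $K$ of order $3$, such that each $x_k$ is a common vertex of three polygons $S_{k1}(P),S_{k2}(P),S_{k3}(P)$ with $S_{k1},S_{k2},S_{k3}$ distinct elements of $\mathcal{S}$, and each ramification point of $K$ either is of the form $S_{\mathbf{j}}(O)$ and has order $n$, or is of the form $S_{\mathbf{j}}(x_k)$ for some $k$ and has order $3$. 3. If $n=3$, then $O$ is a ramification point of $K$ of order $3$, and the ramification points of $K$ which are not images $S_{\mathbf{j}}(O)$ of $O$ have order at most $5$. Here $\mathbf{j}$ ranges over all finite words in $I=\{1,\dots,m\}$, including the empty word.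
   Context: Let $P$ be a convex polygon in $\mathbb{R}^2$ with vertex set $V_P=\{A_1,\dots,A_{n_P}\}$. A finite system $\mathcal{S}=\{S_1,\dots,S_m\}$ of contracting similarities of $\mathbb{R}^2$ (put $I=\{1,\dots,m\}$) is a contractible $P$-polygonal system if: (D1) for every $k\in I$, $P_k=S_k(P)\subset P$; (D2) for $i\ne j$ in $I$, $P_i\cap P_j$ is either empty or a single point that is a common vertex of $P_i$ and $P_j$; (D3) for every $A_k\in V_P$ there are $S_i\in\mathcal{S}$ and $A_l\in V_P$ with $S_i(A_l)=A_k$; (D4) $\widetilde P=\bigcup_{i=1}^m P_i$ is contractible. Let $G$ be a non-trivial group of isometries of the plane mapping $P$ onto itself. A contractible $P$-polygonal system $\mathcal{S}$ is called $G$-symmetric if for every $g\in G$ and $S_i\in\mathcal{S}$ there are $g'\in G$ and $S_j\in\mathcal{S}$ with $g\circ S_i=S_j\circ g'$. The attractor of $\mathcal{S}$ is the unique nonempty compact set $K$ with $K=\bigcup_{i=1}^m S_i(K)$. It is known that for a contractible $P$-polygonal system $K$ is a dendrite (a locally connected continuum containing no simple closed curve). For a dendrite $X$ and $p\in X$, the order $Ord(p,X)$ is the number of components of $X\setminus\{p\}$; $p$ is a ramification point of $X$ if $Ord(p,X)\ge 3$. For a word $\mathbf{j}=j_1\dots j_k$, $S_{\mathbf{j}}=S_{j_1}\circ\cdots\circ S_{j_k}$, and $S_{\emptyset}$ is the identity. *)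

(* Defs.v *)
From HB Require Import structures.
From mathcomp Require Import all_boot all_order all_algebra.
From mathcomp Require Import all_classical all_reals all_analysis.

Set Implicit Arguments.
Unset Strict Implicit.
Unset Printing Implicit Defensive.

Import Order.TTheory GRing.Theory Num.Theory.
Import numFieldNormedType.Exports.

Local Open Scope classical_set_scope.
Local Open Scope ring_scope.

(* The library norm on row vectors is the sup norm, so it provides the topology
   of the plane but not its metric, which is [edist] below. *)
Notation plane R := 'rV[R]_2.

Section PlaneGeometry.
Context {R : realType}.

Definition edist (x y : plane R) : R :=
  Num.sqrt (\sum_(i < 2) (x 0 i - y 0 i) ^+ 2).

Definition isometry (g : plane R -> plane R) :=
  forall x y, edist (g x) (g y) = edist x y.

Definition contracting_similarity (f : plane R -> plane R) :=
  exists2 r : R, 0 < r < 1 & forall x y, edist (f x) (f y) = r * edist x y.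

Definition rotation (c : plane R) (t : R) (x : plane R) : plane R :=
  let u := x - c in
  c + \row_(i < 2) (if i == 0 then cos t * u 0 0 - sin t * u 0 1
                    else sin t * u 0 0 + cos t * u 0 1).

Definition convex_hull (V : set (plane R)) : set (plane R) :=
  smallest (@convex_set R (plane R)) V.

(* A polygon is the solid figure [P]; [V] is its set of vertices. *)
Record convex_polygon (P V : set (plane R)) : Prop := ConvexPolygon {
  polygon_finite : finite_set V;
  polygon_card : (`I_3 #<= V)%card;
  polygon_extreme : forall a, V a -> ~ convex_hull (V `\ a) a;
  polygon_hull : P = convex_hull V }.

Definition regular_polygon (n : nat) (O : plane R) (P V : set (plane R)) :=
  exists A : plane R, [/\ A <> O,
    V = [set rotation O (k%:R * (2 * pi) / n%:R) A | k in `I_n] &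
    P = convex_hull V].

Definition contractible (A : set (plane R)) :=
  exists (a : plane R) (H : R * plane R -> plane R),
    [/\ A a,
        {within `[0, 1]%classic `*` A, continuous H},
        forall (t : R) x, 0 <= t <= 1 -> A x -> A (H (t, x)) &
        forall x, A x -> H (0, x) = x /\ H (1, x) = a].

Record polygonal_system (P V : set (plane R)) (m : nat)
    (S : 'I_m -> plane R -> plane R) : Prop := PolygonalSystem {
  system_polygon : convex_polygon P V;
  system_similarity : forall i, contracting_similarity (S i);
  system_sub : forall i, S i @` P `<=` P;
  system_meet : forall i j, i <> j ->
    S i @` P `&` S j @` P = set0 \/
    exists a, [/\ S i @` P `&` S j @` P = [set a],
                  (S i @` V) a & (S j @` V) a];
  system_vertex : forall a, V a -> exists i, (S i @` V) a;
  system_contractible : contractible (\bigcup_i (S i @` P)) }.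

Record symmetry_group (P : set (plane R)) (G : set (plane R -> plane R)) :
    Prop := SymmetryGroup {
  group_id : G id;
  group_comp : forall g h, G g -> G h -> G (g \o h);
  group_inv : forall g, G g -> exists2 h, G h & cancel g h /\ cancel h g;
  group_isometry : forall g, G g -> isometry g;
  group_stable : forall g, G g -> g @` P = P;
  group_nontrivial : exists2 g, G g & g <> id }.

Definition rotation_group (P : set (plane R)) : set (plane R -> plane R) :=
  [set g | (exists c t, g = rotation c t) /\ g @` P = P].

Definition symmetric_system (G : set (plane R -> plane R)) (m : nat)
    (S : 'I_m -> plane R -> plane R) :=
  forall g i, G g -> exists2 g', G g' & exists j, g \o S i = S j \o g'.

Definition attractor (m : nat) (S : 'I_m -> plane R -> plane R)
    (K : set (plane R)) :=
  [/\ K !=set0, compact K & K = \bigcup_i (S i @` K)].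

Definition word_map (m : nat) (S : 'I_m -> plane R -> plane R)
    (j : seq 'I_m) : plane R -> plane R :=
  foldr (fun i f => S i \o f) id j.

(* [Ord(p,X)] is the cardinality of [branches X p]; it may be infinite, so it
   is only ever compared with the finite cardinals [`I_n]. *)
Definition branches (X : set (plane R)) (p : plane R) : set (set (plane R)) :=
  [set connected_component (X `\ p) x | x in X `\ p].

Definition has_order (X : set (plane R)) (p : plane R) (n : nat) : Prop :=
  (branches X p #= `I_n)%card.

Definition ramification_point (X : set (plane R)) (p : plane R) :=
  X p /\ (`I_3 #<= branches X p)%card.

End PlaneGeometry.

(* Main.v *)
Require Import Defs.
From HB Require Import structures.
From mathcomp Require Import all_boot all_order all_algebra.
From mathcomp Require Import all_classical all_reals all_analysis.
From mathcomp Require Import ring lra.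

(* Every piece [S i P] carries a continuous projection of the union of the pieces onto
   it that sends each other piece to a vertex of [S i P]: contractibility lets maps to
   the circle be lifted to the line, so the pieces are glued like the nodes of a tree.
   These projections restrict to the attractor [K], compose along words, have connected
   fibers, and are unique, hence equivariant under the rotations of [P]. They reduce the
   count of the components of [K] minus a point to combinatorics.

   - A vertex [v] of [P] is an end point of [K]. By symmetry the other vertices stay in
     one component of [K] minus [v], because the center [O] lies in a piece centered at
     [O], or else is a common vertex of pieces permuted by the rotations; this climbs
     down along the address of [v], since by comparing angles only one piece contains
     [v].
   - Hence a point that is a vertex of every piece containing it has as many branches as
     there are such pieces. Pieces meeting at a point have disjoint corners of angle
     [pi - 2 pi / n], so there are at most 5, 3, 2 of them for [n = 3], [n = 4, 5],
     [n >= 6].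
   - If a point is never a vertex along its address, each of its branches leaves a small
     piece through a vertex, so there are at most [n]. When there is a central piece,
     which holds for [n >= 4], all vertices but one are joined outside any point away
     from it; so there are at most 2 branches unless the address is eventually central,
     that is, the point is an image of [O], which has exactly [n] branches. *)

(* MathComp-Analysis has an [edist] of its own; this restores the Euclidean one. *)
Import Defs.

Set Implicit Arguments.
Unset Strict Implicit.
Unset Printing Implicit Defensive.

Import Order.TTheory GRing.Theory Num.Theory.
Import numFieldNormedType.Exports.

Local Open Scope classical_set_scope.
Local Open Scope ring_scope.

(** * Connected components and retractions onto pieces *)

(** The assumption on the union of the pieces is a homotopy, while the conclusion counts components.
    What could spoil the count is a closed chain of pieces; it would carry a map to the circle with
    nonzero winding, whereas contractibility makes every such map lift. Numbering the vertices of a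
    piece turns the statement that something hangs at its vertex [l] into a value [2 * pi * l] of a
    lifted angle, up to a constant.

    The numbers 5, 3, 2 come from strict inequalities. For [n = 3, 4, 6] the corners measure
    [pi / 3], [pi / 2], [2 * pi / 3], and 6, 4, 3 of them fill a full turn exactly; but then
    neighbours share more than one point.

    A vertex of [P] can acquire branches under a map of the system, since other pieces may meet at
    its image. Hence branches are compared along a word only for points that are not vertices of
    [P], and a word leading to a terminal point is first shortened until its end is no vertex or the
    word is empty. *)

Lemma within_continuousP {T U : topologicalType} (A : set T) (f : T -> U) :
  {within A, continuous f} <->
  forall x, A x -> forall N, nbhs (f x) N -> \forall y \near x, A y -> N (f y).
Proof.
split => [/subspace_continuousP cf x Ax N Nx|cf].
  exact: (cf x Ax N Nx).
by apply/subspace_continuousP => x Ax N /(cf x Ax N).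
Qed.

Lemma within_comp {T U W : topologicalType} (A : set T) (B : set U) (f : T -> U) (g : U -> W) :
  {within A, continuous f} -> {within B, continuous g} ->
  (forall x, A x -> B (f x)) -> {within A, continuous (g \o f)}.
Proof.
move=> cf cg AB; apply/within_continuousP => x Ax N Ng.
have [cf' cg'] := (iffLR (within_continuousP _ _) cf, iffLR (within_continuousP _ _) cg).
have := cf' x Ax _ (cg' _ (AB _ Ax) _ Ng); apply: filterS => y h Ay.
by apply: h => //; exact: AB.
Qed.

Lemma near_forall {T : topologicalType} {I : finType} (x : T) (B : I -> T -> Prop) :
  (forall i, \forall y \near x, B i y) -> \forall y \near x, forall i, B i y.
Proof. by move=> h; exact: filter_forall. Qed.

Lemma near_closed_family {T : topologicalType} {I : finType} (A : I -> set T) (x : T) :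
  (forall i, closed (A i)) -> \forall y \near x, forall i, A i y -> A i x.
Proof.
move=> clA; apply: near_forall => i.
have [Aix|nAix] := pselect (A i x); first exact: filterE.
have : nbhs x (~` A i) by apply: open_nbhs_nbhs; split => //; exact: closed_openC.
by apply: filterS => y.
Qed.

Lemma near_neq {T : topologicalType} (x a : T) : hausdorff_space T -> x <> a ->
  \forall y \near x, y <> a.
Proof.
move=> hT xa; have : nbhs x (~` [set a]).
  apply: open_nbhs_nbhs; split; last exact: xa.
  by apply: closed_openC; apply: accessible_closed_set1; exact: hausdorff_accessible.
exact.
Qed.

Lemma within_bigcup_continuous {T U : topologicalType} (I : finType)
    (A : I -> set T) (f : T -> U) :
  (forall i, closed (A i)) -> (forall i, {within A i, continuous f}) ->
  {within \bigcup_i A i, continuous f}.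
Proof.
move=> clA cf; apply/within_continuousP => x _ N Nfx.
have : \forall y \near x, forall i, A i x -> A i y -> N (f y).
  apply: near_forall => i; have [Aix|nAix] := pselect (A i x); last exact: filterE.
  by have := iffLR (within_continuousP _ _) (cf i) x Aix N Nfx; apply: filterS => y h _.
apply: filterS2 (near_closed_family x clA) => y h1 h2 [i _ Aiy].
by apply: (h2 i) => //; exact: h1.
Qed.

Section Connectedness.
Context {T : topologicalType}.
Implicit Types A B C : set T.

Definition locally_constant_on {Y : Type} A (f : T -> Y) :=
  forall x, A x -> \forall y \near x, A y -> f y = f x.

Lemma open_rel A B : B `<=` A ->
  (forall x, B x -> \forall y \near x, A y -> B y) ->
  exists2 C, open C & B = A `&` C.
Proof.
move=> BA nB; exists (interior [set y | A y -> B y]); first exact: open_interior.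
apply/seteqP; split=> [x Bx|x [Ax /interior_subset]]; last exact.
by split; [exact: BA|exact: nB].
Qed.

(** A locally constant predicate and its negation are both relatively open. In this form
    connectedness is an induction principle: a property that neither appears nor disappears locally
    spreads over [A]. *)
Lemma connectedP_pred A : connected A <->
  forall B : T -> Prop, locally_constant_on A B ->
  forall x y, A x -> A y -> B x -> B y.
Proof.
split=> [cA B lB x y Ax Ay Bx|h].
  suff AB : A `&` B = A by move: Ay; rewrite -{1}AB => -[].
  apply: cA; first by exists x.
    apply: open_rel; first by move=> z [].
    move=> z [Az Bz]; have := lB z Az; apply: filterS => t e At; split => //.
    by rewrite e.
  have [C oC CE] : exists2 C, open C & A `\` B = A `&` C.
    apply: open_rel; first by move=> z [].
    move=> z [Az Bz]; have := lB z Az; apply: filterS => t e At; split => //.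
    by rewrite e.
  exists (~` C); first exact: open_closedC.
  apply/seteqP; split=> z [Az Bz]; split => //.
    by move=> Cz; have [_ /(_ Bz)] : (A `\` B) z by rewrite CE.
  apply: contrapT => nBz; apply: Bz.
  by have : (A `\` B) z by []; rewrite CE => -[].
move=> B [x0 Bx0] [C oC BC] [D cD BD].
have BA : B `<=` A by rewrite BC => z [].
apply/seteqP; split => // y Ay.
apply: (h B _ x0 y) => //; last exact: BA.
move=> x Ax; have [Bx|nBx] := pselect (B x).
  have : nbhs x C by apply: open_nbhs_nbhs; split => //; move: Bx; rewrite BC => -[].
  apply: filterS => z Cz Az; apply/propext; split => // _.
  by rewrite BC.
have : nbhs x (~` D).
  apply: open_nbhs_nbhs; split; first exact: closed_openC.
  by move=> Dx; apply: nBx; rewrite BD.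
apply: filterS => z nDz Az; apply/propext; split => //.
by rewrite BD => -[].
Qed.

Lemma locally_constant_connected A (Y : Type) (f : T -> Y) : connected A ->
  locally_constant_on A f -> forall x y, A x -> A y -> f x = f y.
Proof.
move=> /connectedP_pred cA lf x y Ax Ay.
apply: (cA (fun z => f x = f z) _ x y) => //.
by move=> z Az; have := lf z Az; apply: filterS => t e At; rewrite e.
Qed.

Lemma connected_pairwise A :
  (forall x y, A x -> A y -> exists C, [/\ connected C, C `<=` A, C x & C y]) ->
  connected A.
Proof.
move=> h; apply/connectedP_pred => B lB x y Ax Ay Bx.
have [C [cC CA Cx Cy]] := h x y Ax Ay.
apply: (iffLR (connectedP_pred _) cC B _ x y) => //.
by move=> z Cz; have := lB z (CA _ Cz); apply: filterS => t e /CA.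
Qed.

Definition joined A x y := connected_component A x y.

Lemma joined_intro A C x y : connected C -> C `<=` A -> C x -> C y -> joined A x y.
Proof. by move=> cC CA Cx Cy; exists C. Qed.

Lemma joinedP A x y : joined A x y <->
  exists C, [/\ connected C, C `<=` A, C x & C y].
Proof.
by split=> [[C [Cx CA cC] Cy]|[C [*]]]; exists C.
Qed.

Lemma joined_eq A x y : A x -> A y ->
  joined A x y <-> connected_component A x = connected_component A y.
Proof.
move=> Ax Ay; split; first exact: same_connected_component.
by rewrite /joined => ->; exact: connected_component_refl.
Qed.

Lemma connected_joined A : (forall x y, A x -> A y -> joined A x y) -> connected A.
Proof. by move=> h; apply: connected_pairwise => x y Ax Ay; apply/joinedP; exact: h. Qed.

Lemma joined_locally_constant A (Y : Type) (f : T -> Y) x y :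
  locally_constant_on A f -> joined A x y -> f x = f y.
Proof.
move=> lf /joinedP[C [cC CA Cx Cy]].
apply: (locally_constant_connected cC) => // z Cz.
by have := lf z (CA _ Cz); apply: filterS => t e /CA.
Qed.

End Connectedness.

Lemma joined_image {T U : topologicalType} (A : set T) (B : set U) (f : T -> U) x y :
  {within A, continuous f} -> (forall z, A z -> B (f z)) ->
  joined A x y -> joined B (f x) (f y).
Proof.
move=> cf AB /joinedP[C [cC CA Cx Cy]].
apply: (@joined_intro _ _ (f @` C)).
- by apply: connected_continuous_connected => //; exact: continuous_subspaceW cf.
- by move=> _ [z Cz <-]; apply/AB/CA.
- by exists x.
- by exists y.
Qed.

(** * Counting connected components *)

Section Components.
Context {T : topologicalType}.

Definition components (X : set T) : set (set T) := connected_component X @` X.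

(** This yields the exact orders: the label is the piece, or the vertex of [P], through which a
    point leaves the deleted point. *)
Lemma card_components_label (X : set T) (I : finType) (J : {set I}) (l : T -> I) :
  (forall x, X x -> l x \in J) -> locally_constant_on X l ->
  (forall i, i \in J -> exists2 x, X x & l x = i) ->
  (forall x y, X x -> X y -> l x = l y -> joined X x y) ->
  (components X #= `I_#|J|)%card.
Proof.
move=> lJ lX Jl conn.
pose F (C : set T) : nat := if pselect (exists x, X x /\ C = connected_component X x)
  is left e then index (l (projT1 (cid e))) (enum J) else 0%N.
have FE x : X x -> F (connected_component X x) = index (l x) (enum J).
  move=> Xx; rewrite /F; case: pselect => [e|]; last by case; exists x.
  case: cid => y /= [Xy] e'; congr index; apply/esym/joined_locally_constant; first exact: lX.
  exact/joined_eq.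
suff bF : set_bij (components X) `I_#|J| F.
  by apply/pcard_eqP/bijPex; exists F.
split.
- by move=> _ [x Xx <-] /=; rewrite FE // cardE index_mem mem_enum lJ.
- move=> _ _ /[!inE] -[x Xx <-] [y Xy <-]; rewrite !FE // => e.
  apply/joined_eq => //; apply: conn => //.
  have lx : l x \in enum J by rewrite mem_enum lJ.
  have ly : l y \in enum J by rewrite mem_enum lJ.
  by rewrite -(nth_index (l x) lx) e nth_index.
- move=> k /= kJ.
  have [x0 Xx0 _] : exists2 x, X x & true.
    have /card_gt0P[j jJ] : (0 < #|J|)%N by exact: leq_ltn_trans kJ.
    by have [x Xx _] := Jl j jJ; exists x.
  have kin : nth (l x0) (enum J) k \in J by rewrite -mem_enum mem_nth // -cardE.
  have [x Xx lx] := Jl _ kin.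
  exists (connected_component X x); first by exists x.
  by rewrite FE // lx index_uniq -?cardE // enum_uniq.
Qed.

Lemma card_ge_components (X : set T) (k : nat) : (`I_k #<= components X)%card ->
  exists2 x : 'I_k -> T, (forall i, X (x i)) &
    forall i j, joined X (x i) (x j) -> i = j.
Proof.
move=> /pcard_leP/injfunPex[f fX fI].
have /choice[x xP] : forall i : 'I_k, exists x, X x /\ connected_component X x = f i.
  by move=> i; have [x Xx e] := fX i (ltn_ord i); exists x.
exists x => [i|i j]; first exact: (xP i).1.
move/joined_eq => /(_ (xP i).1 (xP j).1); rewrite (xP i).2 (xP j).2 => e.
by apply/val_inj/fI; rewrite ?inE //=.
Qed.

(** This yields the upper bounds: as only finitely many points are tested at once, one piece around
    the deleted point can be chosen small enough to miss them all. *)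
Lemma card_components_le (X : set T) (k : nat) :
  (forall x : 'I_k.+1 -> T, (forall i, X (x i)) ->
     exists i j, i <> j /\ joined X (x i) (x j)) ->
  (components X #<= `I_k)%card.
Proof.
move=> h; apply: contrapT => nle.
have /card_ge_components[x xX xI] : (`I_k.+1 #<= components X)%card.
  have [[n Xn]|/infiniteP inf] := pselect (finite_set (components X)).
    by move/negP: nle; rewrite (card_le_eqr Xn) (card_le_eql Xn) !card_le_II -ltnNge.
  by apply: card_le_trans inf; exact: subset_card_le.
by have [i [j [ij /xI]]] := h x xX.
Qed.

End Components.

(** A representative is chosen in each component to define the induced map; that [f] reflects
    [joined] makes this map injective. *)
Lemma card_le_components_map {T U : topologicalType} (X : set T) (Y : set U) (f : T -> U) :
  (forall x, X x -> Y (f x)) ->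
  (forall x x', X x -> X x' -> joined Y (f x) (f x') -> joined X x x') ->
  (components X #<= components Y)%card.
Proof.
move=> XY inj.
pose F (C : set T) : set U :=
  if pselect (exists x, X x /\ C = connected_component X x)
  is left e then connected_component Y (f (projT1 (cid e))) else set0.
have FE x : X x -> exists2 y, X y & joined X x y /\
    F (connected_component X x) = connected_component Y (f y).
  move=> Xx; rewrite /F; case: pselect => [e|]; last by case; exists x.
  case: cid => y /= [Xy] e'; exists y => //; split => //.
  exact/joined_eq.
apply/pcard_leP/injfunPex; exists F.
  move=> _ [x Xx <-]; have [y Xy [_ ->]] := FE x Xx.
  by exists (f y) => //; exact: XY.
move=> _ _ /[!inE] -[x Xx <-] [x' Xx' <-].
have [y Xy [xy ->]] := FE x Xx; have [y' Xy' [xy' ->]] := FE x' Xx'.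
move=> /joined_eq => /(_ (XY _ Xy) (XY _ Xy')) /inj => /(_ Xy Xy') yy'.
apply/joined_eq => //; apply: connected_component_trans xy _.
apply: connected_component_trans yy' _; exact: connected_component_sym.
Qed.

(* A retraction of [K] onto a closed piece [L] that sends the rest of [K] to a
   finite set of points: the projection of a tree-like [K] onto [L]. *)
Record tree_retraction {T : topologicalType} (K L W : set T) (r : T -> T) : Prop :=
  TreeRetraction {
  retraction_continuous : {within K, continuous r};
  retraction_sub : L `<=` K;
  retraction_closed : closed L;
  retraction_finite : finite_set W;
  retraction_to : forall x, K x -> L (r x);
  retraction_id : forall x, L x -> r x = x;
  retraction_out : forall x, K x -> ~ L x -> W (r x) }.

Section TreeRetraction.
Context {T : topologicalType}.
Hypothesis hT : hausdorff_space T.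
Variables (K L W : set T) (r : T -> T).
Hypotheses (cK : connected K) (tr : tree_retraction K L W r).

Lemma finite_isolated (F : set T) x : finite_set F ->
  \forall y \near x, F y -> y = x.
Proof.
move=> finF.
have cl : closed (F `\ x).
  have -> : F `\ x = \bigcup_(z in F `\ x) [set z].
    by apply/seteqP; split=> [z Fz|z [y Fy ->//]]; exists z.
  apply: closed_bigcup; first exact: finite_setD.
  by move=> i _; apply: accessible_closed_set1; exact: hausdorff_accessible.
have : nbhs x (~` (F `\ x)).
  by apply: open_nbhs_nbhs; split; [exact: closed_openC|move=> [_ []]].
by apply: filterS => y nFy Fy; apply: contrapT => nyx; apply: nFy.
Qed.

(** Off [L] a continuous map with values in the finite set [W] cannot vary locally. *)
Lemma retraction_locally_constant x : K x -> ~ L x ->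
  \forall y \near x, K y -> ~ L y /\ r y = r x.
Proof.
move=> Kx nLx.
have nL : nbhs x (~` L).
  by apply: open_nbhs_nbhs; split => //; apply: closed_openC; exact: retraction_closed tr.
have := iffLR (within_continuousP _ _) (retraction_continuous tr) x Kx _
  (@finite_isolated W (r x) (retraction_finite tr)).
apply: filterS2 nL => y nLy h Ky; split => //; apply: (h Ky).
exact: (retraction_out tr).
Qed.

(** A clopen part of the fiber that misses [a] is clopen in all of [K]: its points lie off [L],
    where [r] is locally constant, so they have a neighborhood in [K] inside the fiber.
    Connectedness of [K] rules it out. *)
Lemma retraction_fiber_connected a : L a -> connected (K `&` [set x | r x = a]).
Proof.
move=> La; pose F := K `&` [set x | r x = a].
have Fa : F a by split; [exact: (retraction_sub tr)|exact: (retraction_id tr)].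
suff h (B : T -> Prop) : locally_constant_on F B -> forall x, F x -> B x = B a.
  apply/connectedP_pred => B lB x y Fx Fy.
  by rewrite (h B lB x Fx) (h B lB y Fy).
move=> lB x0 Fx0.
pose V y := F y /\ B y <> B a.
have lV : locally_constant_on K V.
  move=> x Kx; have [Fx|nFx] := pselect (F x); last first.
    have nrx : r x <> a by move=> e; apply: nFx.
    have := iffLR (within_continuousP _ _) (retraction_continuous tr) x Kx _ (near_neq hT nrx).
    apply: filterS => y h Ky; apply/propext; split; first by move=> [[_ /= ya]]; case: (h Ky).
    by move=> [].
  have [xa|xa] := pselect (x = a).
    have := lB x Fx; apply: filterS => y h Ky; apply/propext; split.
      by move=> [Fy]; rewrite h // xa.
    by move=> [_]; rewrite xa.
  have nLx : ~ L x by move=> /(retraction_id tr) e; apply: xa; rewrite -e; case: Fx.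
  apply: filterS2 (lB x Fx) (retraction_locally_constant Kx nLx) => y h1 h2 Ky.
  have Fy : F y by split => //=; have [_ ->] := h2 Ky; case: Fx.
  by rewrite /V h1 //; apply/propext; split => -[].
have := locally_constant_connected cK lV Fx0.1 Fa.1.
by move=> e; apply: contrapT => ne; have [_ []] : V a by rewrite -e; split.
Qed.

Lemma retraction_joined (X : set T) x : K x ->
  (forall y, K y -> r y = r x -> X y) -> joined X x (r x).
Proof.
move=> Kx h; apply: (@joined_intro _ _ (K `&` [set y | r y = r x])).
- by apply: retraction_fiber_connected; exact: (retraction_to tr).
- by move=> y [Ky /= e]; exact: h.
- by split.
- have Lr := retraction_to tr Kx; split; first exact: (retraction_sub tr).
  by rewrite /= (retraction_id tr).
Qed.

(** Agreement is clopen in [K]. At a point of [L], nearby values in the finite set [W] must equal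
    the limit value, for both maps; off [L] both maps are locally constant. *)
Lemma retraction_unique r' : tree_retraction K L W r' -> L !=set0 ->
  forall x, K x -> r x = r' x.
Proof.
move=> tr' [z Lz] x Kx.
suff lE : locally_constant_on K (fun y => r y = r' y).
  have := locally_constant_connected cK lE Kx (retraction_sub tr Lz).
  by rewrite (retraction_id tr Lz) (retraction_id tr' Lz) => ->.
move=> y Ky; have [Ly|nLy] := pselect (L y).
  have h1 := iffLR (within_continuousP _ _) (retraction_continuous tr) y Ky _
    (@finite_isolated W (r y) (retraction_finite tr)).
  have h2 := iffLR (within_continuousP _ _) (retraction_continuous tr') y Ky _
    (@finite_isolated W (r' y) (retraction_finite tr)).
  apply: filterS2 h1 h2 => t h1 h2 Kt; apply/propext; split => _.
    by rewrite (retraction_id tr Ly) (retraction_id tr' Ly).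
  have [Lt|nLt] := pselect (L t).
    by rewrite (retraction_id tr Lt) (retraction_id tr' Lt).
  rewrite (h1 Kt (retraction_out tr Kt nLt)) (h2 Kt (retraction_out tr' Kt nLt)).
  by rewrite (retraction_id tr Ly) (retraction_id tr' Ly).
have h1 := iffLR (within_continuousP _ _) (retraction_continuous tr) y Ky _
    (@finite_isolated W (r y) (retraction_finite tr)).
have h2 := iffLR (within_continuousP _ _) (retraction_continuous tr') y Ky _
    (@finite_isolated W (r' y) (retraction_finite tr)).
have h3 := retraction_locally_constant Ky nLy.
apply: filterS3 h1 h2 h3 => t {}h1 {}h2 {}h3 Kt.
have [nLt _] := h3 Kt.
by rewrite (h1 Kt (retraction_out tr Kt nLt)) (h2 Kt (retraction_out tr' Kt nLt)).
Qed.

End TreeRetraction.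

(** * Lifting maps into the circle *)

Lemma within_real_continuousP {R : realType} {T : topologicalType} (A : set T) (f : T -> R) :
  {within A, continuous f} <->
  forall x, A x -> forall e, 0 < e -> \forall y \near x, A y -> `|f x - f y| < e.
Proof.
split=> [cf x Ax e e0|h].
  exact: (iffLR (within_continuousP _ _) cf x Ax (ball (f x) e) (nbhsx_ballx _ _ e0)).
apply/within_continuousP => x Ax N /nbhs_ballP[e /= e0 eN].
by apply: filterS (h x Ax e e0) => y hy /hy fy; exact: eN.
Qed.

Section Lifting.
Context {R : realType} {T : topologicalType}.

(** The quotient is the tangent of the angle from [(c, s)] to [(c', s')]; a positive dot product
    puts that angle between [- pi / 2] and [pi / 2], where [atan] recovers it continuously. *)
Lemma angle_step (c s c' s' F : R) : c ^+ 2 + s ^+ 2 = 1 -> c' ^+ 2 + s' ^+ 2 = 1 ->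
  0 < c * c' + s * s' -> c = cos F -> s = sin F ->
  let a := atan ((c * s' - s * c') / (c * c' + s * s')) in
  c' = cos (F + a) /\ s' = sin (F + a).
Proof.
move=> h h' d0 cF sF; set d := c * c' + s * s' in d0 *; set k := c * s' - s * c'.
move=> a.
have dk : d ^+ 2 + k ^+ 2 = 1.
  have -> : d ^+ 2 + k ^+ 2 = (c ^+ 2 + s ^+ 2) * (c' ^+ 2 + s' ^+ 2) by rewrite /d /k; ring.
  by rewrite h h' mulr1.
have d_neq0 : d != 0 by rewrite gt_eqF.
have ca : cos a = d.
  rewrite cos_atan.
  have -> : 1 + (k / d) ^+ 2 = (d^-1) ^+ 2.
    have -> : 1 + (k / d) ^+ 2 = (d ^+ 2 + k ^+ 2) / d ^+ 2 by field.
    by rewrite dk mul1r exprVn.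
  by rewrite sqrtr_sqr ger0_norm ?invrK // invr_ge0 ltW.
have sa : sin a = k.
  have : tan a = k / d by rewrite atanK.
  by rewrite /tan ca => /(congr1 (fun z => z * d)); rewrite !divfK.
rewrite cosD sinD ca sa -cF -sF; split.
  have -> : c * d - s * k = c' * (c ^+ 2 + s ^+ 2) by rewrite /d /k; ring.
  by rewrite h mulr1.
have -> : s * d + c * k = s' * (c ^+ 2 + s ^+ 2) by rewrite /d /k; ring.
by rewrite h mulr1.
Qed.

Lemma within_cvg (A : set T) (f : T -> R) : {within A, continuous f} <->
  forall x, A x -> f @ within A (nbhs x) --> f x.
Proof. exact: subspace_continuousP. Qed.

Lemma lift_step (X : set T) (c s c' s' F : T -> R) :
  {within X, continuous c} -> {within X, continuous s} ->
  {within X, continuous c'} -> {within X, continuous s'} ->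
  {within X, continuous F} ->
  (forall x, X x -> c x ^+ 2 + s x ^+ 2 = 1) ->
  (forall x, X x -> c' x ^+ 2 + s' x ^+ 2 = 1) ->
  (forall x, X x -> 0 < c x * c' x + s x * s' x) ->
  (forall x, X x -> c x = cos (F x) /\ s x = sin (F x)) ->
  exists2 F' : T -> R, {within X, continuous F'} &
    forall x, X x -> c' x = cos (F' x) /\ s' x = sin (F' x).
Proof.
move=> /within_cvg cc /within_cvg cs /within_cvg cc' /within_cvg cs' /within_cvg cF.
move=> h h' d0 hF.
exists (fun x => F x + atan ((c x * s' x - s x * c' x) / (c x * c' x + s x * s' x))).
  apply/within_cvg => x Xx; apply: cvgD; first exact: cF.
  apply: (@cvg_comp _ _ _
    (fun x => (c x * s' x - s x * c' x) / (c x * c' x + s x * s' x)) (@atan R)); last first.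
    exact: continuous_atan.
  apply: cvgM; first by apply: cvgB; apply: cvgM; [exact: cc|exact: cs'|exact: cs|exact: cc'].
  apply: cvgV; first by rewrite gt_eqF // d0.
  by apply: cvgD; apply: cvgM; [exact: cc|exact: cc'|exact: cs|exact: cs'].
move=> x Xx; have [e1 e2] := hF x Xx.
by apply: angle_step => //; [exact: h|exact: h'|exact: d0].
Qed.

(* Homotopy lifting for the covering [t |-> (cos t, sin t)] of the circle: along
   the contraction, the maps [f o H t] at nearby times [t] are never antipodal,
   so being liftable is a locally constant property of [t]. *)
Lemma contractible_lifting (X : set T) (a : T) (H : R * T -> T) (c s : T -> R) :
  compact X -> X a ->
  {within `[0, 1]%classic `*` X, continuous H} ->
  (forall (t : R) x, 0 <= t <= 1 -> X x -> X (H (t, x))) ->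
  (forall x, X x -> H (0, x) = x /\ H (1, x) = a) ->
  {within X, continuous c} -> {within X, continuous s} ->
  (forall x, X x -> c x ^+ 2 + s x ^+ 2 = 1) ->
  exists2 F : T -> R, {within X, continuous F} &
    forall x, X x -> c x = cos (F x) /\ s x = sin (F x).
Proof.
move=> cptX Xa cH XH H01 cc cs cs1.
pose I : set R := `[0, 1]%classic.
have cG (g : T -> R) : {within X, continuous g} -> {within I `*` X, continuous (g \o H)}.
  move=> cg; apply: within_comp cg _ => // -[t x] [/= It Xx].
  by apply: XH => //; move: It; rewrite /I /= in_itv.
have slice (g : T -> R) t : I t -> {within X, continuous g} ->
    {within X, continuous (fun x => g (H (t, x)))}.
  move=> It cg; apply: (@within_comp _ _ _ X (I `*` X) (fun x => (t, x)) (g \o H)) => //; last exact: cG.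
  apply: continuous_subspaceT => x N [[U V] /= [Ut Vx] UV].
  by apply: filterS Vx => y Vy; apply: UV; split => //=; exact: nbhs_singleton.
pose L (t : R) := exists2 F : T -> R, {within X, continuous F} &
    forall x, X x -> c (H (t, x)) = cos (F x) /\ s (H (t, x)) = sin (F x).
have I0 : I 0 by rewrite /I /= in_itv /= lexx ler01.
have I1 : I 1 by rewrite /I /= in_itv /= lexx ler01.
have IP t : I t -> 0 <= t <= 1 by rewrite /I /= in_itv.
suff [F cF FP] : L 0.
  by exists F => // x Xx; have [e _] := H01 x Xx; have := FP x Xx; rewrite e.
have HH t x : I t -> X x -> c (H (t, x)) ^+ 2 + s (H (t, x)) ^+ 2 = 1.
  by move=> It Xx; apply/cs1/XH => //; exact: IP.
suff [lL L1] : locally_constant_on I L /\ L 1.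
  exact: (iffLR (connectedP_pred I) (@segment_connected R 0 1) L lL 1 0 I1 I0 L1).
split; last first.
  have a1 : c a ^+ 2 + s a ^+ 2 = 1 by exact: cs1.
  have [th [e1 e2]] : exists th, c a = cos th /\ s a = sin th.
    have ca : c a \in `[-1, 1].
      have := sqr_ge0 (s a); rewrite in_itv /= -ler_norml -(@expr_le1 _ 2) //.
      by rewrite real_normK ?num_real // -a1 => ?; lra.
    have ca' : -1 <= c a <= 1 by move: ca; rewrite in_itv.
    have sq : Num.sqrt (1 - c a ^+ 2) = `|s a|.
      by rewrite -sqrtr_sqr; congr Num.sqrt; rewrite -a1; ring.
    have [s0|s0] := leP 0 (s a).
      by exists (acos (c a)); rewrite acosK // sin_acos // sq ger0_norm.
    by exists (- acos (c a)); rewrite cosN sinN acosK // sin_acos // sq ltr0_norm // opprK.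
  exists (fun=> th); first by apply: continuous_subspaceT => x; exact: cvg_cst.
  by move=> x Xx; have [_ ->] := H01 x Xx.
move=> t It.
have near_dot : \forall t' \near t, I t' -> forall x, X x ->
    0 < c (H (t, x)) * c (H (t', x)) + s (H (t, x)) * s (H (t', x)).
  (* Tube argument: compactness of [X] provides one neighborhood of [t] that serves all [x]. *)
  have cov := iffLR (compact_near_coveringP X) cptX.
  have /near_covering_withinP := cov.
  move=> /(_ R (nbhs t) (fun t' x => I t' ->
    0 < c (H (t, x)) * c (H (t', x)) + s (H (t, x)) * s (H (t', x)))).
  have ff : Filter (nbhs t) by exact: nbhs_filter.
  move=> /(_ ff) h.
  have : \forall t' \near t, X `<=` (fun x => I t' ->
      0 < c (H (t, x)) * c (H (t', x)) + s (H (t, x)) * s (H (t', x))).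
    apply: h => x Xx.
    have IXtx : (I `*` X) (t, x) by [].
    (* Coordinates within [1 / 4] of those at [(t, x)] differ by less than [1 / 2] from each other,
       so the two unit vectors have squared distance below [1 / 2] and dot product above [3 / 4]. *)
    have q0 : (0 : R) < 1 / 4 by lra.
    have [[U1 V1] /= [U1x V1t] h1] :=
      iffLR (within_real_continuousP _ _) (cG _ cc) _ IXtx _ q0.
    have [[U2 V2] /= [U2x V2t] h2] :=
      iffLR (within_real_continuousP _ _) (cG _ cs) _ IXtx _ q0.
    exists (V1 `&` V2, U1 `&` U2); first by split; exact: filterI.
    move=> [x' t'] /= [[V1x V2x] [U1t U2t]] Xx' It'.
    have U1tt : U1 t by exact: nbhs_singleton.
    have U2tt : U2 t by exact: nbhs_singleton.
    have A1 := h1 (t', x') (conj U1t V1x) (conj It' Xx').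
    have A2 := h1 (t, x') (conj U1tt V1x) (conj It Xx').
    have A3 := h2 (t', x') (conj U2t V2x) (conj It' Xx').
    have A4 := h2 (t, x') (conj U2tt V2x) (conj It Xx').
    have B1 := HH t x' It Xx'; have B2 := HH t' x' It' Xx'.
    move: A1 A2 A3 A4 B1 B2; rewrite /= !ltr_norml.
    move: (c (H (t, x))) (c (H (t', x'))) (c (H (t, x'))) => c0 c1 c2.
    move: (s (H (t, x))) (s (H (t', x'))) (s (H (t, x'))) => s0 s1 s2.
    move=> /andP[a1 a2] /andP[a3 a4] /andP[b1 b2] /andP[b3 b4] B1 B2.
    have C1 : (c2 - c1) ^+ 2 < 1 / 4.
      have -> : (1 / 4 : R) = (1 / 2) ^+ 2 by field.
      by rewrite -[X in X < _]real_normK ?num_real // ltr_sqr ?nnegrE // ?ltr_norml; try lra.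
    have C2 : (s2 - s1) ^+ 2 < 1 / 4.
      have -> : (1 / 4 : R) = (1 / 2) ^+ 2 by field.
      by rewrite -[X in X < _]real_normK ?num_real // ltr_sqr ?nnegrE // ?ltr_norml; try lra.
    by nra.
  by apply: filterS => t' h' It' x Xx; exact: h'.
apply: filterS near_dot => t' dot It'; apply/propext; split => -[F cF FP].
  apply: (@lift_step X (fun x => c (H (t', x))) (fun x => s (H (t', x)))
    (fun x => c (H (t, x))) (fun x => s (H (t, x))) F); try exact: slice.
  - by [].
  - by move=> x Xx; exact: HH.
  - by move=> x Xx; exact: HH.
  - by move=> x Xx; have := dot It' x Xx; rewrite mulrC [X in _ + X]mulrC.
  - by [].
apply: (@lift_step X (fun x => c (H (t, x))) (fun x => s (H (t, x)))
    (fun x => c (H (t', x))) (fun x => s (H (t', x))) F); try exact: slice.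
- by [].
- by move=> x Xx; exact: HH.
- by move=> x Xx; exact: HH.
- exact: (dot It').
- by [].
Qed.

End Lifting.

(** * Similarities of the plane *)

Section Plane.
Context {R : realType}.
Implicit Types (u v w x y z : plane R) (f g : plane R -> plane R) (r t : R).

Definition dot u v : R := u 0 0 * v 0 0 + u 0 1 * v 0 1.

Definition pt (a b : R) : plane R := \row_(i < 2) (if i == 0 then a else b).

Lemma pt0 a b : pt a b 0 0 = a. Proof. by rewrite mxE. Qed.
Lemma pt1 a b : pt a b 0 1 = b. Proof. by rewrite mxE. Qed.

Lemma ord2P (i : 'I_2) : i = 0 \/ i = 1.
Proof. by case: i => -[|[|//]] hi; [left|right]; apply/val_inj. Qed.

Lemma plane_eq x y : x 0 0 = y 0 0 -> x 0 1 = y 0 1 -> x = y.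
Proof.
by move=> e0 e1; apply/rowP => i; have [->|->] := ord2P i; [exact: e0|exact: e1].
Qed.

Lemma edistE x y : edist x y = Num.sqrt (dot (x - y) (x - y)).
Proof.
have e : lift ord0 ord0 = 1 :> 'I_2 by exact: val_inj.
by rewrite /edist big_ord_recl big_ord1 e /dot !mxE !expr2.
Qed.

Lemma dot_ge0 u : 0 <= dot u u.
Proof. by rewrite /dot -!expr2 addr_ge0 // sqr_ge0. Qed.

Lemma dot_eq0 u : dot u u = 0 -> u = 0.
Proof.
rewrite /dot -!expr2 => /eqP; rewrite paddr_eq0 ?sqr_ge0 // !sqrf_eq0.
by move=> /andP[/eqP e0 /eqP e1]; apply: plane_eq; rewrite mxE.
Qed.

Lemma dot_gt0 u : u <> 0 -> 0 < dot u u.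
Proof. by move=> u0; rewrite lt_neqAle dot_ge0 andbT eq_sym; apply/eqP => /dot_eq0. Qed.

Lemma edist_ge0 x y : 0 <= edist x y.
Proof. by rewrite edistE sqrtr_ge0. Qed.

Lemma edist_sq x y : edist x y ^+ 2 = dot (x - y) (x - y).
Proof. by rewrite edistE sqr_sqrtr // dot_ge0. Qed.

Lemma edist_eq0 x y : edist x y = 0 -> x = y.
Proof.
move=> e; apply/eqP; rewrite -subr_eq0; apply/eqP/dot_eq0.
by rewrite -edist_sq e expr0n.
Qed.

Lemma edistxx x : edist x x = 0.
Proof. by rewrite edistE subrr /dot !mxE !mul0r addr0 sqrtr0. Qed.

Lemma edistC x y : edist x y = edist y x.
Proof. by rewrite !edistE; congr Num.sqrt; rewrite /dot !mxE; ring. Qed.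

Lemma edist_gt0 x y : x <> y -> 0 < edist x y.
Proof.
move=> xy; rewrite lt_neqAle edist_ge0 andbT eq_sym.
by apply/eqP => /edist_eq0.
Qed.

Lemma cauchy_schwarz u v : dot u v ^+ 2 <= dot u u * dot v v.
Proof.
rewrite -subr_ge0.
have -> : dot u u * dot v v - dot u v ^+ 2 = (u 0 0 * v 0 1 - u 0 1 * v 0 0) ^+ 2.
  by rewrite /dot; ring.
exact: sqr_ge0.
Qed.

Lemma dot_le_norms u v : dot u v <= Num.sqrt (dot u u) * Num.sqrt (dot v v).
Proof.
apply: le_trans (ler_norm _) _.
by rewrite -sqrtrM ?dot_ge0 // -sqrtr_sqr ler_wsqrtr // cauchy_schwarz.
Qed.

Lemma norm_triangle u v :
  Num.sqrt (dot (u + v) (u + v)) <= Num.sqrt (dot u u) + Num.sqrt (dot v v).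
Proof.
rewrite -[leRHS]ger0_norm ?addr_ge0 ?sqrtr_ge0 // -sqrtr_sqr ler_wsqrtr //.
rewrite sqrrD !sqr_sqrtr ?dot_ge0 //.
have -> : dot (u + v) (u + v) = dot u u + dot u v *+ 2 + dot v v.
  by rewrite /dot !mxE; ring.
by rewrite lerD2r lerD2l ler_wMn2r // dot_le_norms.
Qed.

Lemma edist_triangle y x z : edist x z <= edist x y + edist y z.
Proof.
rewrite !edistE; have -> : x - z = (x - y) + (y - z) by rewrite addrA subrK.
exact: norm_triangle.
Qed.

Lemma sup_norm_le u (e : R) : 0 <= e -> `|u 0 0| <= e -> `|u 0 1| <= e -> `|u| <= e.
Proof.
move=> e0 u0 u1; rewrite [leLHS]/Num.norm /= mx_normrE.
apply/bigmax_leP; split => // -[i j] _ /=; rewrite (ord1 i).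
by have [->|->] := ord2P j.
Qed.

Lemma coord_le_sup_norm u i : `|u 0 i| <= `|u|.
Proof.
rewrite [leRHS]/Num.norm /= mx_normrE; apply/bigmax_geP; right.
by exists (0, i).
Qed.

Lemma sup_norm_le_edist x y : `|x - y| <= edist x y.
Proof.
have h i : `|(x - y) 0 i| <= edist x y.
  rewrite -sqrtr_sqr edistE ler_wsqrtr //.
  have [->|->] := ord2P i.
  - by rewrite /dot -!expr2 lerDl sqr_ge0.
  - by rewrite /dot -!expr2 lerDr sqr_ge0.
by apply: sup_norm_le; rewrite ?edist_ge0.
Qed.

Lemma edist_le_sup_norm x y : edist x y <= 2 * `|x - y|.
Proof.
rewrite edistE -[leRHS]ger0_norm ?mulr_ge0 // -sqrtr_sqr ler_wsqrtr //.
have := coord_le_sup_norm (x - y) 0; have := coord_le_sup_norm (x - y) 1.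
rewrite /dot !ler_norml; have := normr_ge0 (x - y).
move: ((x - y) 0 0) ((x - y) 0 1) `|x - y| => a b c c0 /andP[h1 h2] /andP[h3 h4].
by nra.
Qed.

Lemma edist_near x (e : R) : 0 < e -> \forall y \near x, edist x y < e.
Proof.
move=> e0; have d0 : 0 < e / 2 by rewrite divr_gt0.
apply: filterS (nbhsx_ballx x (e / 2) d0) => y; rewrite -ball_normE /= => yd.
by apply: le_lt_trans (edist_le_sup_norm _ _) _; rewrite mulrC -ltr_pdivlMr.
Qed.

Lemma near_edist x (N : set (plane R)) :
  nbhs x N <-> exists2 e : R, 0 < e & forall y, edist x y < e -> N y.
Proof.
split=> [/nbhs_ballP[e /= e0 eN]|[e e0 eN]].
  exists e => // y xy; apply: eN; rewrite -ball_normE /=.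
  exact: le_lt_trans (sup_norm_le_edist _ _) xy.
by apply: filterS (edist_near x e0).
Qed.

Lemma lipschitz_continuous f (C : R) :
  (forall x y, edist (f x) (f y) <= C * edist x y) -> continuous f.
Proof.
move=> lf x N /near_edist[e e0 eN].
have C1 : 0 < `|C| + 1 by rewrite ltr_wpDl.
apply/near_edist; exists (e / (`|C| + 1)); first by rewrite divr_gt0.
move=> y; rewrite ltr_pdivlMr // => xy; apply: eN.
apply: le_lt_trans (lf _ _) (le_lt_trans _ xy); rewrite mulrC ler_wpM2l ?edist_ge0 //.
by rewrite (le_trans (ler_norm C)) // lerDl.
Qed.

Lemma continuous_edist x : continuous (edist x).
Proof.
move=> y N /nbhs_ballP[e /= e0 eN]; apply/near_edist; exists e => // z yz.
apply: eN; rewrite -ball_normE /=; apply: le_lt_trans yz.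
rewrite ler_distl; have := edist_triangle y x z; have := edist_triangle z x y.
rewrite (edistC z y) => h1 h2; apply/andP; split; lra.
Qed.

Definition similarity r f := 0 < r /\ forall x y, edist (f x) (f y) = r * edist x y.

Lemma similarity_continuous r f : similarity r f -> continuous f.
Proof.
move=> [r0 fr]; apply: (@lipschitz_continuous f r) => x y.
by rewrite fr.
Qed.

Lemma similarity_inj r f : similarity r f -> injective f.
Proof.
move=> [r0 fr] x y e; apply: edist_eq0; apply: (mulfI (lt0r_neq0 r0)).
by rewrite -fr e edistxx mulr0.
Qed.

Lemma similarity_comp r r' f g : similarity r f -> similarity r' g ->
  similarity (r * r') (f \o g).
Proof.
move=> [r0 fr] [r'0 gr]; split; first exact: mulr_gt0.
by move=> x y /=; rewrite fr gr mulrA.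
Qed.

Lemma similarity_id : similarity 1 (id : plane R -> plane R).
Proof. by split => // x y; rewrite mul1r. Qed.

Lemma similarity_dot r f x y z : similarity r f ->
  dot (f x - f z) (f y - f z) = r ^+ 2 * dot (x - z) (y - z).
Proof.
move=> [_ fr].
have sq a b : dot (f a - f b) (f a - f b) = r ^+ 2 * dot (a - b) (a - b).
  by rewrite -edist_sq fr exprMn edist_sq.
have pol a b c : dot (a - c) (b - c) =
    (dot (a - c) (a - c) + dot (b - c) (b - c) - dot (a - b) (a - b)) / 2.
  by rewrite /dot !mxE; field.
by rewrite pol !sq (pol x y z); field.
Qed.

(** Similarities are given by distances alone, so their linear form has to be derived: dot products
    scale by [r ^+ 2], which fixes the coordinates of [f x - f 0] in the orthogonal frame [v0],
    [v1], and the remainder has norm zero. *)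
Lemma similarity_form r f : similarity r f -> exists c v0 v1,
  [/\ forall x, f x = c + x 0 0 *: v0 + x 0 1 *: v1,
      dot v0 v0 = r ^+ 2, dot v1 v1 = r ^+ 2 & dot v0 v1 = 0].
Proof.
move=> fr; pose v0 := f (pt 1 0) - f 0; pose v1 := f (pt 0 1) - f 0.
have dE x y := similarity_dot x y 0 fr.
exists (f 0), v0, v1.
have d00 : dot v0 v0 = r ^+ 2 by rewrite dE /dot !mxE /=; ring.
have d11 : dot v1 v1 = r ^+ 2 by rewrite dE /dot !mxE /=; ring.
have d01 : dot v0 v1 = 0 by rewrite dE /dot !mxE /=; ring.
split => // x; apply/eqP; rewrite -subr_eq0; apply/eqP/dot_eq0.
have d0 : dot (f x - f 0) v0 = r ^+ 2 * x 0 0 by rewrite dE /dot !mxE /=; ring.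
have d1 : dot (f x - f 0) v1 = r ^+ 2 * x 0 1 by rewrite dE /dot !mxE /=; ring.
have dx : dot (f x - f 0) (f x - f 0) = r ^+ 2 * dot x x by rewrite dE /dot !mxE; ring.
set u := f x - f 0 in d0 d1 dx.
have -> : f x - (f 0 + x 0 0 *: v0 + x 0 1 *: v1) = u - x 0 0 *: v0 - x 0 1 *: v1.
  by rewrite /u; apply/rowP => i; rewrite !mxE; ring.
have -> : dot (u - x 0 0 *: v0 - x 0 1 *: v1) (u - x 0 0 *: v0 - x 0 1 *: v1) =
    dot u u + x 0 0 ^+ 2 * dot v0 v0 + x 0 1 ^+ 2 * dot v1 v1
    - 2 * x 0 0 * dot u v0 - 2 * x 0 1 * dot u v1 + 2 * x 0 0 * x 0 1 * dot v0 v1.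
  by rewrite /dot !mxE; ring.
by rewrite dx d00 d11 d01 d0 d1 /dot; ring.
Qed.

Lemma similarity_affine r f x y t : similarity r f ->
  f (t *: x + (1 - t) *: y) = t *: f x + (1 - t) *: f y.
Proof.
move=> /similarity_form[c [v0 [v1 [fE _ _ _]]]]; rewrite !fE.
by apply/rowP => i; rewrite !mxE; ring.
Qed.

Lemma similarity_bij r f : similarity r f ->
  exists2 g, similarity r^-1 g & cancel f g /\ cancel g f.
Proof.
move=> fr; have [r0 fd] := fr.
have [c [v0 [v1 [fE d00 d11 d01]]]] := similarity_form fr.
pose g y := pt (dot (y - c) v0 / r ^+ 2) (dot (y - c) v1 / r ^+ 2).
have r2 : r ^+ 2 != 0 by rewrite expf_neq0 // gt_eqF.
have gf : cancel f g.
  move=> x; apply: plane_eq; rewrite ?pt0 ?pt1 fE.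
    have -> : dot (c + x 0 0 *: v0 + x 0 1 *: v1 - c) v0 =
      x 0 0 * dot v0 v0 + x 0 1 * dot v0 v1 by rewrite /dot !mxE; ring.
    by rewrite d00 d01 mulr0 addr0 mulfK.
  have -> : dot (c + x 0 0 *: v0 + x 0 1 *: v1 - c) v1 =
      x 0 0 * dot v0 v1 + x 0 1 * dot v1 v1 by rewrite /dot !mxE; ring.
  by rewrite d11 d01 mulr0 add0r mulfK.
have fg : cancel g f.
  move=> y; rewrite fE !pt0 !pt1.
  move: d00 d11 d01; rewrite /dot.
  set a := v0 0 0; set b := v0 0 1; set p := v1 0 0; set q := v1 0 1 => d00 d11 d01.
  (* The next three identities say that the rows of the matrix with columns [v0], [v1] are, like the
     columns, orthogonal of length [r]; this gives surjectivity. *)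
  have c0 : a ^+ 2 + p ^+ 2 = r ^+ 2.
    apply: (mulfI r2).
    have : (a * p) ^+ 2 = (b * q) ^+ 2.
      by rewrite (_ : a * p = - (b * q)) ?sqrrN //; lra.
    rewrite !exprMn.
    have -> : b ^+ 2 = r ^+ 2 - a ^+ 2 by rewrite -d00; ring.
    have -> : q ^+ 2 = r ^+ 2 - p ^+ 2 by rewrite -d11; ring.
    by move: (r ^+ 2) (a ^+ 2) (p ^+ 2) => A B D; nra.
  have c1 : b ^+ 2 + q ^+ 2 = r ^+ 2.
    by have : a * a + b * b + (p * p + q * q) = r ^+ 2 + r ^+ 2; [rewrite d00 d11|]; nra.
  have c01 : a * b + p * q = 0.
    apply/eqP; rewrite -sqrf_eq0; apply/eqP.
    have -> : (a * b + p * q) ^+ 2 = (a ^+ 2 + p ^+ 2) * (b ^+ 2 + q ^+ 2)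
       - ((a * a + b * b) * (p * p + q * q) - (a * p + b * q) ^+ 2) by ring.
    by rewrite c0 c1 d00 d11 d01; ring.
  apply: plane_eq; rewrite !mxE -/a -/b -/p -/q; apply: (mulfI r2).
    have -> : r ^+ 2 * (c 0 0 + ((y 0 0 - c 0 0) * a + (y 0 1 - c 0 1) * b) / r ^+ 2 * a
       + ((y 0 0 - c 0 0) * p + (y 0 1 - c 0 1) * q) / r ^+ 2 * p) =
       r ^+ 2 * c 0 0 + (y 0 0 - c 0 0) * (a ^+ 2 + p ^+ 2) + (y 0 1 - c 0 1) * (a * b + p * q).
      by field; rewrite gt_eqF.
    by rewrite c0 c01; ring.
  have -> : r ^+ 2 * (c 0 1 + ((y 0 0 - c 0 0) * a + (y 0 1 - c 0 1) * b) / r ^+ 2 * b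
       + ((y 0 0 - c 0 0) * p + (y 0 1 - c 0 1) * q) / r ^+ 2 * q) =
       r ^+ 2 * c 0 1 + (y 0 1 - c 0 1) * (b ^+ 2 + q ^+ 2) + (y 0 0 - c 0 0) * (a * b + p * q).
    by field; rewrite gt_eqF.
  by rewrite c1 c01; ring.
exists g => //; split; first by rewrite invr_gt0.
move=> x y; rewrite -[in RHS](fg x) -[in RHS](fg y) fd mulrA mulVf ?mul1r //.
by rewrite gt_eqF.
Qed.

Lemma stewart_identity x y w t :
  edist w (t *: x + (1 - t) *: y) ^+ 2 =
  t * edist w x ^+ 2 + (1 - t) * edist w y ^+ 2 - t * (1 - t) * edist x y ^+ 2.
Proof. by rewrite !edist_sq /dot !mxE; ring. Qed.

Lemma rotationD c s t x : rotation c s (rotation c t x) = rotation c (s + t) x.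
Proof.
by rewrite /rotation; apply: plane_eq; rewrite !mxE /= cosD sinD; ring.
Qed.

Lemma rotation0 c x : rotation c 0 x = x.
Proof. by rewrite /rotation; apply: plane_eq; rewrite !mxE /= cos0 sin0; ring. Qed.

Lemma edist_rotation c t x y : edist (rotation c t x) (rotation c t y) = edist x y.
Proof.
rewrite !edistE; congr Num.sqrt; rewrite /dot !mxE /= -[RHS]mul1r -(cos2Dsin2 t); ring.
Qed.

Lemma similarity_rotation c t : similarity 1 (rotation c t).
Proof. by split => // x y; rewrite mul1r edist_rotation. Qed.

Lemma rotation_center c t : rotation c t c = c.
Proof. by apply: plane_eq; rewrite !mxE /=; ring. Qed.

Lemma edist_rotation_self c t x :
  edist (rotation c t x) x ^+ 2 = 2 * (1 - cos t) * edist x c ^+ 2.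
Proof.
rewrite !edist_sq /dot !mxE /=.
have := cos2Dsin2 t; set C := cos t; set S := sin t => e.
move: (x 0 0) (x 0 1) (c 0 0) (c 0 1) => a b p q.
have -> : 2 * (1 - C) * ((a - p) * (a - p) + (b - q) * (b - q)) =
  ((1 + (C ^+ 2 + S ^+ 2)) - 2 * C) * ((a - p) * (a - p) + (b - q) * (b - q)).
  by rewrite e; ring.
by ring.
Qed.

End Plane.

(** * Convex hulls *)

Lemma continuous_sum {R : realType} {T : topologicalType} {V : normedModType R}
    (n : nat) (f : 'I_n -> T -> V) :
  (forall i, continuous (f i)) -> continuous (fun x => \sum_(i < n) f i x).
Proof.
by move=> cf; apply: continuous_big => //; exact: add_continuous.
Qed.

Section Convexity.
Context {R : realType}.
Implicit Types (C V : set (plane R)) (x y : plane R) (t : R).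

Lemma convexP C : @convex_set R (plane R) C <->
  forall x y t, C x -> C y -> 0 <= t <= 1 -> C (t *: x + (1 - t) *: y).
Proof.
split=> [cC x y t Cx Cy t01|h x y l].
  have := cC x y (Itv01 (proj1 (andP t01)) (proj2 (andP t01))).
  by rewrite !inE; exact.
rewrite !inE => Cx Cy; apply: h => //; apply/andP; split; [exact: ge0|exact: le1].
Qed.

Lemma sub_convex_hull V : V `<=` convex_hull V.
Proof. exact: sub_gen_smallest. Qed.

Lemma convex_hull_min V C : @convex_set R (plane R) C -> V `<=` C -> convex_hull V `<=` C.
Proof. exact: smallest_sub. Qed.

Lemma convex_convex_hull V : @convex_set R (plane R) (convex_hull V).
Proof.
apply/convexP => x y t Vx Vy t01 C [cC VC].
by apply: (iffLR (convexP C) cC) => //; [exact: Vx|exact: Vy].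
Qed.

Lemma convex_connected C : @convex_set R (plane R) C -> connected C.
Proof.
move=> /convexP cC; apply: connected_pairwise => x y Cx Cy.
exists ((fun t : R => t *: x + (1 - t) *: y) @` `[0, 1]%classic); split.
- apply: connected_continuous_connected; first exact: segment_connected.
  apply: continuous_subspaceT => t.
  apply: cvgD; first by apply: cvgZr_tmp; exact: cvg_id.
  by apply: cvgZr_tmp; apply: cvgB; [exact: cvg_cst|exact: cvg_id].
- by move=> _ [t /= t01 <-]; apply: cC => //; move: t01; rewrite in_itv.
- by exists 1; rewrite /= ?in_itv /= ?lexx ?ler01 // scale1r subrr scale0r addr0.
- by exists 0; rewrite /= ?in_itv /= ?lexx ?ler01 // scale0r subr0 scale1r add0r.
Qed.

Definition simplex n : set 'rV[R]_n :=
  [set l | (forall i, 0 <= l 0 i) /\ \sum_(i < n) l 0 i = 1].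

Lemma simplex_compact n : compact (@simplex n).
Proof.
have coordc i : continuous (fun l : 'rV[R]_n => l 0 i) by exact: coord_continuous.
apply: bounded_closed_compact.
  exists 1; split; first by rewrite num_real.
  move=> M M1 l [l0 l1]; apply: le_trans (ltW M1).
  rewrite [leLHS]/Num.norm /= mx_normrE; apply/bigmax_leP; split => // -[i j] _ /=.
  rewrite (ord1 i) ger0_norm // -l1 (bigD1 j) //= lerDl.
  exact: sumr_ge0.
have -> : @simplex n = \bigcap_(i in setT) ((fun l : 'rV[R]_n => l 0 i) @^-1` [set x | 0 <= x])
    `&` (fun l : 'rV[R]_n => \sum_(i < n) l 0 i) @^-1` [set 1].
  apply/seteqP; split=> [l [l0 l1]|l [l0 l1]]; split => //.
    by move=> i _; exact: l0.
  by move=> i; exact: l0.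
apply: closedI.
  apply: closed_bigI => i _; apply: closed_comp => [l _|]; first exact: coordc.
  exact: closed_ge.
apply: closed_comp => [l _|]; last exact: closed_eq.
exact: (@continuous_sum R _ R^o).
Qed.

(** The hull is the image of the standard simplex under the barycentric map. *)
Lemma compact_convex_hull n (A : 'I_n -> plane R) : (0 < n)%N ->
  compact (convex_hull (range A)).
Proof.
move=> n0; pose F (l : 'rV[R]_n) := \sum_(i < n) l 0 i *: A i.
suff -> : convex_hull (range A) = F @` @simplex n.
  apply: continuous_compact; last exact: simplex_compact.
  have cA i : continuous (fun l : 'rV[R]_n => l 0 i *: A i).
    move=> l; have cl : continuous (fun l : 'rV[R]_n => l 0 i) by exact: coord_continuous.
    exact: (cvgZr_tmp (cl l)).
  by apply: continuous_subspaceT; exact: continuous_sum.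
apply/seteqP; split.
  apply: convex_hull_min.
    apply/convexP => _ _ t [l [l0 l1] <-] [k [k0 k1] <-] /andP[t0 t1].
    exists (t *: l + (1 - t) *: k).
      split=> [i|]; first by rewrite !mxE addr_ge0 // mulr_ge0 // subr_ge0.
      under eq_bigr do rewrite !mxE.
      by rewrite big_split /= -!mulr_sumr l1 k1; ring.
    rewrite /F !scaler_sumr -big_split /=; apply: eq_bigr => i _.
    by rewrite !mxE !scalerA -scalerDl.
  move=> _ [i _ <-]; exists (delta_mx 0 i).
    split=> [j|]; first by rewrite mxE; case: eqP.
    rewrite (bigD1 i) //= big1 ?addr0 ?mxE ?eqxx // => j ji.
    by rewrite mxE (negbTE ji) andbF.
  rewrite /F (bigD1 i) //= big1 ?addr0 ?mxE ?eqxx ?scale1r // => j ji.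
  by rewrite mxE (negbTE ji) andbF scale0r.
pose C := convex_hull (range A).
have cC := iffLR (convexP C) (@convex_convex_hull (range A)).
(* Binary convexity is iterated over a list of points by normalizing the partial sums; a tail of
   total weight zero is set apart because the normalization divides by that weight. *)
have key (s : seq 'I_n) (l : 'I_n -> R) : (forall i, 0 <= l i) ->
    0 < \sum_(i <- s) l i -> C ((\sum_(i <- s) l i)^-1 *: \sum_(i <- s) l i *: A i).
  move=> l0; elim: s => [|j s IH]; first by rewrite big_nil ltxx.
  rewrite !big_cons; set u := \sum_(i <- s) l i; set v := \sum_(i <- s) _.
  move=> lu; have u0 : 0 <= u by exact: sumr_ge0.
  have CA i : C (A i) by apply: sub_convex_hull; exists i.
  have [u_eq0|u_gt0] := eqVneq u 0.
    have -> : v = 0.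
      apply: big1_seq => i /andP[_ si]; suff -> : l i = 0 by rewrite scale0r.
      apply/eqP; rewrite eq_le l0 andbT -u_eq0 /u (big_rem i) //= lerDl.
      exact: sumr_ge0.
    rewrite u_eq0 !addr0 scalerA mulVf ?scale1r //.
    by move: lu; rewrite u_eq0 addr0 => /lt0r_neq0.
  have {}u_gt0 : 0 < u by rewrite lt_neqAle eq_sym u_gt0.
  have := cC (A j) (u^-1 *: v) (l j / (l j + u)) (CA j) (IH u_gt0).
  have d0 := lt0r_neq0 lu; have u0' := lt0r_neq0 u_gt0.
  have -> : l j / (l j + u) *: A j + (1 - l j / (l j + u)) *: (u^-1 *: v) =
      (l j + u)^-1 *: (l j *: A j + v).
    rewrite scalerDr !scalerA [_^-1 * l j]mulrC; congr (_ + _ *: _).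
    by field; rewrite d0 u0'.
  apply; apply/andP; split; first by rewrite divr_ge0 // ltW.
  by rewrite ler_pdivrMr // mul1r lerDl.
move=> _ [l [l0 l1] <-].
have := key (index_enum 'I_n) (fun i => l 0 i) l0.
by rewrite l1 invr1 scale1r; apply.
Qed.

End Convexity.

(** * Regular polygons *)

Lemma le_cos {R : realType} (x y : R) : 0 <= x -> x <= y -> y <= pi -> cos y <= cos x.
Proof.
move=> x0 xy ypi; rewrite leNgt; apply/negP.
rewrite ltr_cos ?in_itv /=; first by rewrite ltNge xy.
  by rewrite ypi (le_trans x0).
by rewrite x0 (le_trans xy).
Qed.

Section RegularPolygon.
Context {R : realType}.
Variables (n : nat) (O A : plane R) (P V : set (plane R)).
Hypotheses (n_ge3 : (3 <= n)%N) (AO : A <> O).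
Hypothesis VE : V = [set rotation O (k%:R * (2 * pi) / n%:R) A | k in `I_n].
Hypothesis PE : P = convex_hull V.

Definition turn (m : nat) (c : plane R) (k : nat) (x : plane R) : plane R :=
  rotation c (k%:R * (2 * pi) / m%:R) x.

Local Notation rot := (turn n O).
Local Notation alpha := ((2 * pi) / n%:R : R).

Let n_gt0 : 0 < n%:R :> R. Proof. by rewrite ltr0n; case: n n_ge3. Qed.

Let rotE k : rot k = rotation O (k%:R * alpha).
Proof. by apply/funext => x; rewrite /turn -mulrA. Qed.

Lemma turnD k l x : rot k (rot l x) = rot (k + l) x.
Proof. by rewrite !rotE rotationD -mulrDl natrD. Qed.

Lemma turn0 x : rot 0 x = x.
Proof. by rewrite rotE mul0r rotation0. Qed.

Lemma turn_full x : rot n x = x.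
Proof.
rewrite rotE mulrCA mulfV ?gt_eqF // mulr1.
apply: plane_eq; rewrite !mxE /=; have -> : 2 * pi = pi *+ 2 :> R by ring.
  by rewrite cos2pi sin2pi; ring.
by rewrite cos2pi sin2pi; ring.
Qed.

Lemma turn_mod k x : rot k x = rot (k %% n) x.
Proof.
rewrite [in LHS](divn_eq k n); elim: (k %/ n)%N => [|q IH]; first by rewrite mul0n.
by rewrite mulSn -addnA -turnD turn_full.
Qed.

Lemma turn_center k : rot k O = O.
Proof. by rewrite rotE rotation_center. Qed.

Lemma similarity_turn k : similarity 1 (rot k).
Proof. exact: similarity_rotation. Qed.

Lemma edist_turn k x y : edist (rot k x) (rot k y) = edist x y.
Proof. exact: edist_rotation. Qed.

Let n2 : 2%:R < n%:R :> R. Proof. by rewrite ltr_nat. Qed.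

Let alpha_pi : 0 < alpha < pi.
Proof.
have := pi_gt0 R; move: n2 n_gt0; set N : R := n%:R => h2 h0 hp.
by rewrite divr_gt0 ?mulr_gt0 //= ltr_pdivrMr // mulrC ltr_pM2l.
Qed.

Lemma cos_alpha_lt1 : cos alpha < 1.
Proof.
have /andP[a0 api] := alpha_pi.
by rewrite -[X in _ < X](cos0 R) ltr_cos ?in_itv /= ?lexx ?ltW // pi_gt0.
Qed.

(** Neighbouring vertices are the closest ones. Passing from [k] to [n - k] brings the angle below
    [pi], where the cosine decreases. *)
Lemma cos_multiple_le k : (0 < k < n)%N -> cos (k%:R * alpha) <= cos alpha.
Proof.
have /andP[a0 api] := alpha_pi.
have small j : (0 < j)%N -> j%:R * alpha <= pi -> cos (j%:R * alpha) <= cos alpha.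
  move=> j0 jpi; apply: le_cos jpi; first exact: ltW.
  by rewrite -[X in X <= _]mul1r ler_wpM2r ?ler1n // ltW.
move=> /andP[k0 kn]; have [kpi|pik] := leP (k%:R * alpha) pi; first exact: small.
have nk : (n - k)%:R * alpha = 2 * pi - k%:R * alpha.
  rewrite natrB; last exact: ltnW.
  have na : n%:R * alpha = 2 * pi by field; rewrite gt_eqF.
  by rewrite mulrBl na.
have -> : cos (k%:R * alpha) = cos ((n - k)%:R * alpha).
  rewrite nk -cosN -(cosD2pi (- (k%:R * alpha))); congr cos; ring.
by apply: small; [rewrite subn_gt0|rewrite nk; lra].
Qed.

Lemma turn_fixed k x : (0 < k < n)%N -> rot k x = x -> x = O.
Proof.
move=> kn e; have := edist_rotation_self O (k%:R * alpha) x.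
rewrite -rotE e edistxx expr0n /= => /esym/eqP.
rewrite mulf_eq0 mulf_eq0 (pnatr_eq0 R 2) /= sqrf_eq0 => /orP[|/eqP/edist_eq0 //].
by rewrite subr_eq0 gt_eqF // (le_lt_trans (cos_multiple_le kn)) // cos_alpha_lt1.
Qed.

Lemma turn_inj x k l : x <> O -> (k < n)%N -> (l < n)%N -> rot k x = rot l x -> k = l.
Proof.
wlog kl : k l / (k <= l)%N.
  move=> h xO kn ln e; have [kl|/ltnW lk] := leqP k l; first exact: h.
  by apply/esym; exact: (h l k).
move=> xO kn ln e; apply/eqP; rewrite eqn_leq kl /= leqNgt; apply/negP => klt.
apply: xO; apply: (@turn_fixed (l - k)); first by rewrite subn_gt0 klt (leq_ltn_trans _ ln) ?leq_subr.
apply: (similarity_inj (similarity_turn k)).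
by rewrite turnD subnKC // e.
Qed.

Local Notation vtx k := (rot k A).

Lemma vertex_turn k : V (vtx k).
Proof.
rewrite turn_mod VE; exists (k %% n)%N => //=.
by rewrite ltn_pmod //; case: n n_ge3.
Qed.

Lemma vertexP v : V v -> exists2 k, (k < n)%N & v = vtx k.
Proof. by rewrite VE => -[k kn <-]; exists k. Qed.

Lemma vertex_finite : finite_set V.
Proof. by rewrite VE; apply: finite_image; exact: finite_II. Qed.

Lemma vertex_neq_center v : V v -> v <> O.
Proof.
move=> /vertexP[k kn ->] e; apply: AO.
by apply: (similarity_inj (similarity_turn k)); rewrite turn_center.
Qed.

Lemma turn_vertex k v : V v -> V (rot k v).
Proof. by move=> /vertexP[l _ ->]; rewrite turnD; exact: vertex_turn. Qed.

Lemma vertex_in_polygon : V `<=` P.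
Proof. by rewrite PE; exact: sub_convex_hull. Qed.

Lemma polygon_convex x y t : P x -> P y -> 0 <= t <= 1 -> P (t *: x + (1 - t) *: y).
Proof. by rewrite PE; apply: (iffLR (convexP _)); exact: convex_convex_hull. Qed.

Lemma polygon_min (C : set (plane R)) : V `<=` C ->
  (forall x y t, C x -> C y -> 0 <= t <= 1 -> C (t *: x + (1 - t) *: y)) -> P `<=` C.
Proof. by move=> VC cC; rewrite PE; apply: convex_hull_min => //; exact/convexP. Qed.

Lemma polygon_compact : compact P.
Proof.
have -> : P = convex_hull (range (fun k : 'I_n => vtx k)).
  rewrite PE VE; congr convex_hull; apply/seteqP; split=> [_ [k kn <-]|_ [k _ <-]].
    by exists (Ordinal kn).
  by exists (val k) => //=; exact: ltn_ord.
by apply: compact_convex_hull; case: n n_ge3.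
Qed.

Lemma polygon_closed : closed P.
Proof. by apply: compact_closed polygon_compact; exact: norm_hausdorff. Qed.

Lemma polygon_connected : connected P.
Proof. by apply: convex_connected; rewrite PE; exact: convex_convex_hull. Qed.

Lemma turn_polygon k x : P x -> P (rot k x).
Proof.
apply: (@polygon_min [set x | P (rot k x)]) => [v Vv|y z t Py Pz t01] /=.
  by apply: vertex_in_polygon; exact: turn_vertex.
by rewrite (similarity_affine _ _ _ (similarity_turn k)); exact: polygon_convex.
Qed.

Lemma turn_rotation_group k : rotation_group P (rot k).
Proof.
split; first by exists O, (k%:R * (2 * pi) / n%:R); apply/funext.
apply/seteqP; split=> [_ [x Px <-]|x Px]; first exact: turn_polygon.
exists (rot (n - k %% n) x); first exact: turn_polygon.
rewrite [rot k _]turn_mod turnD addnC subnK ?turn_full //.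
by apply/ltnW/ltn_pmod; case: n n_ge3.
Qed.

Lemma edist_vertex v : V v -> edist v O = edist A O.
Proof. by move=> /vertexP[k _ ->]; have := edist_turn k A O; rewrite turn_center. Qed.

Let ball_convex c (r : R) x y t : edist x c <= r -> edist y c <= r -> 0 <= t <= 1 ->
  edist (t *: x + (1 - t) *: y) c <= r.
Proof.
move=> xr yr /andP[t0 t1]; have r0 : 0 <= r by exact: le_trans (edist_ge0 _ _) xr.
rewrite -(@ler_sqr R) ?nnegrE ?edist_ge0 // edistC stewart_identity.
rewrite !(edistC c).
have h1 : edist x c ^+ 2 <= r ^+ 2 by rewrite ler_sqr ?nnegrE ?edist_ge0.
have h2 : edist y c ^+ 2 <= r ^+ 2 by rewrite ler_sqr ?nnegrE ?edist_ge0.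
have := sqr_ge0 (edist x y); move: h1 h2.
move: (edist x c ^+ 2) (edist y c ^+ 2) (edist x y ^+ 2) (r ^+ 2) => a b d q h1 h2 d0.
have : 0 <= t * (1 - t) * d by rewrite !mulr_ge0 // subr_ge0.
have : t * a <= t * q by rewrite ler_wpM2l.
have : (1 - t) * b <= (1 - t) * q by rewrite ler_wpM2l ?subr_ge0.
by lra.
Qed.

Lemma edist_polygon x : P x -> edist x O <= edist A O.
Proof.
apply: (@polygon_min [set x | edist x O <= edist A O]) => [v /edist_vertex /= ->//|y z t hy hz t01].
exact: ball_convex.
Qed.

(* Strict convexity of the circumscribed disk: only the vertices of [P] reach the
   circle. *)
Lemma similarity_vertex r f y : similarity r f -> (forall x, P x -> P (f x)) ->
  P y -> V (f y) -> V y.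
Proof.
move=> fr fP Py Vfy.
(* The distance is measured after applying [f], so that convexity of this set can be shown. Strictly
   between two distinct points the identity of Stewart makes the distance to [O] smaller than the
   circumradius. *)
pose C : set (plane R) :=
  [set x | edist (f x) O <= edist A O /\ (edist (f x) O = edist A O -> V x)].
have [_ h] : C y; last by apply: h; exact: edist_vertex.
have r0 : 0 < edist A O by exact: edist_gt0.
move: y Py {Vfy}; apply: (@polygon_min C) => [v Vv|y z t [hy1 hy2] [hz1 hz2] t01].
  by split => // ; apply/edist_polygon/fP/vertex_in_polygon.
split; first by rewrite (similarity_affine _ _ _ fr); exact: ball_convex.
rewrite (similarity_affine _ _ _ fr) => e.
have [t_eq0|t0] := eqVneq t 0.
  by move: e; rewrite t_eq0 !scale0r subr0 !scale1r !add0r.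
have [t_eq1|t1] := eqVneq t 1.
  by move: e; rewrite t_eq1 subrr !scale0r !scale1r !addr0.
have := stewart_identity (f y) (f z) O t; rewrite edistC e !(edistC O) => E.
have [yz|/eqP yz] := eqVneq y z.
  move: e; rewrite yz -!scalerDl addrCA subrr addr0 !scale1r; exact: hz2.
have fyz : 0 < edist (f y) (f z) by rewrite fr.2 mulr_gt0 ?fr.1 ?edist_gt0.
have h1 : edist (f y) O ^+ 2 <= edist A O ^+ 2 by rewrite ler_sqr ?nnegrE ?edist_ge0.
have h2 : edist (f z) O ^+ 2 <= edist A O ^+ 2 by rewrite ler_sqr ?nnegrE ?edist_ge0.
have h3 : 0 < edist (f y) (f z) ^+ 2 by rewrite exprn_gt0.
have /andP[t_ge0 t_le1] := t01.
have t_gt0 : 0 < t by rewrite lt_neqAle eq_sym t0.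
have t_lt1 : 0 < 1 - t by rewrite subr_gt0 lt_neqAle t1.
have : 0 < t * (1 - t) * edist (f y) (f z) ^+ 2 by rewrite !mulr_gt0.
have : t * edist (f y) O ^+ 2 <= t * edist A O ^+ 2 by rewrite ler_wpM2l.
have : (1 - t) * edist (f z) O ^+ 2 <= (1 - t) * edist A O ^+ 2 by rewrite ler_wpM2l // ltW.
by lra.
Qed.

(** Rotation by [alpha] about the origin only permutes the summands cyclically, and it fixes no
    nonzero vector. *)
Lemma sum_vertices_eq0 : \sum_(k < n) (vtx k - O) = 0.
Proof.
set W := \sum_(k < n) _.
have rW : rotation 0 alpha W = W.
  have lin (u v : plane R) : rotation 0 alpha (u + v) = rotation 0 alpha u + rotation 0 alpha v.
    by apply: plane_eq; rewrite !mxE /=; ring.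
  have rk k : rotation 0 alpha (vtx k - O) = vtx k.+1 - O.
    rewrite -(addn1 k) addnC -turnD [rot 1]rotE mul1r.
    by apply: plane_eq; rewrite !mxE /=; ring.
  have {1}-> : W = \sum_(0 <= k < n) (vtx k - O) by rewrite big_mkord.
  rewrite (big_morph _ lin (rotation_center 0 alpha)).
  under eq_bigr do rewrite rk.
  have [m nm] : exists m, n = m.+1 by case: n n_ge3 => // m _; exists m.
  rewrite /W; move: turn_full turn0; rewrite nm => tf t0.
  rewrite big_nat_recr //= tf -[in RHS](big_mkord xpredT (fun k => turn m.+1 O k A - O)).
  by rewrite [RHS]big_nat_recl //= t0 addrC.
have := edist_rotation_self 0 alpha W; rewrite rW edistxx expr0n /= => /esym/eqP.
rewrite mulf_eq0 mulf_eq0 (pnatr_eq0 R 2) /= sqrf_eq0 => /orP[|/eqP/edist_eq0 //].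
by rewrite subr_eq0 gt_eqF // cos_alpha_lt1.
Qed.

(* The sum of the squared distances from the vertices to [c] exceeds the one for [O]
   by [n * edist c O ^+ 2]. *)
Lemma circumcenter_unique c :
  (forall v, V v -> edist v c <= edist A O) -> c = O.
Proof.
move=> h.
have S : \sum_(k < n) edist (vtx k) c ^+ 2 = n%:R * (edist A O ^+ 2 + edist c O ^+ 2).
  have E k : edist (vtx k) c ^+ 2 = edist A O ^+ 2 + edist c O ^+ 2
      - 2 * ((vtx k - O) 0 0 * (c - O) 0 0 + (vtx k - O) 0 1 * (c - O) 0 1).
    rewrite -(edist_vertex (vertex_turn k)) !edist_sq /dot !mxE; ring.
  under eq_bigr do rewrite E.
  rewrite sumrB sumr_const card_ord -mulr_natl -mulr_sumr big_split /= -!mulr_suml.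
  have c0 i : \sum_(k < n) (vtx k - O) 0 i = 0.
    have := congr1 (fun M : plane R => M 0 i) sum_vertices_eq0.
    by rewrite summxE [in RHS]mxE.
  by rewrite !c0; ring.
have : \sum_(k < n) edist (vtx k) c ^+ 2 <= n%:R * edist A O ^+ 2.
  rewrite mulr_natl -[X in _ <= _ *+ X]card_ord -sumr_const; apply: ler_sum => k _.
  by rewrite ler_sqr ?nnegrE ?edist_ge0 // h //; exact: vertex_turn.
rewrite S ler_pM2l // gerDl => h0; apply: edist_eq0; apply/eqP; rewrite -sqrf_eq0 eq_le h0 /=.
exact: sqr_ge0.
Qed.

(** Every vertex is the image of a point of [P], hence lies within the circumradius of [g O]. *)
Lemma isometry_center g : similarity 1 g -> (forall y, P y -> exists2 x, P x & g x = y) ->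
  g O = O.
Proof.
move=> [_ g1] gP; apply: circumcenter_unique => v /vertex_in_polygon/gP[x Px <-].
by rewrite g1 mul1r; exact: edist_polygon.
Qed.

End RegularPolygon.

(** * Angles at a common vertex *)

Lemma cos_pithird {R : realType} : cos (pi / 3) = 1 / 2 :> R.
Proof.
have p3 : (pi / 3) *+ 2 + pi / 3 = pi :> R by field.
have cp : 0 < cos (pi / 3) :> R.
  by apply: cos_gt0_pihalf; have := pi_gt0 R => ?; apply/andP; split; lra.
have := cospi R; rewrite -[in LHS]p3 cosD cos_mulr2n sin_mulr2n.
have := cos2Dsin2 (pi / 3 : R).
move: (cos _) (sin _) cp => c s cp cs h.
have s2 : s ^+ 2 = 1 - c ^+ 2 by lra.
(* The triple angle formula at [cos pi = -1]; the cubic factors as [(c + 1) * (2 * c - 1) ^+ 2]. *)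
have h2 : 4 * c ^+ 3 - 3 * c + 1 = 0.
  transitivity ((c ^+ 2 *+ 2 - 1) * c - c * s *+ 2 * s + 1); last by rewrite h; ring.
  transitivity ((c ^+ 2 *+ 2 - 1) * c - 2 * c * s ^+ 2 + 1); last by ring.
  by rewrite s2; ring.
have : (c + 1) * (2 * c - 1) ^+ 2 = 0 by rewrite -h2; ring.
move/eqP; rewrite mulf_eq0 sqrf_eq0 gt_eqF /=; last lra.
by move/eqP => ?; lra.
Qed.

(** * How many unit vectors can be pairwise far apart *)

Section UnitVectors.
Context {R : realType}.
Implicit Types u v w : plane R.

Definition cross u v : R := u 0 0 * v 0 1 - u 0 1 * v 0 0.

Lemma dot_frame e u v : dot e e = 1 ->
  dot u v = dot e u * dot e v + cross e u * cross e v.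
Proof.
move=> e1; have -> : dot u v = dot e e * dot u v by rewrite e1 mul1r.
by rewrite /dot /cross; ring.
Qed.

(** The sum of the three vectors would have a squared norm below [3 - 3]. *)
Lemma three_unit_vectors u v w : dot u u = 1 -> dot v v = 1 -> dot w w = 1 ->
  dot u v < - (1 / 2) -> dot u w < - (1 / 2) -> dot v w < - (1 / 2) -> False.
Proof.
move=> uu vv ww uv uw vw; have := dot_ge0 (u + v + w).
have -> : dot (u + v + w) (u + v + w) =
  dot u u + dot v v + dot w w + 2 * dot u v + 2 * dot u w + 2 * dot v w.
  by rewrite /dot !mxE; ring.
by rewrite uu vv ww; lra.
Qed.

(** Two of [u], [v], [w] lie on the same side of the line through [e]; as both also point away from
    [e], their dot product is positive. *)
Lemma four_unit_vectors e u v w : dot e e = 1 ->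
  dot e u < 0 -> dot e v < 0 -> dot e w < 0 ->
  dot u v < 0 -> dot u w < 0 -> dot v w < 0 -> False.
Proof.
move=> e1 eu ev ew; rewrite (dot_frame u v e1) (dot_frame u w e1) (dot_frame v w e1).
have same (x y x' y' : R) : x < 0 -> y < 0 -> (0 <= x') = (0 <= y') ->
    x * y + x' * y' < 0 -> False.
  move=> x0 y0 e' h; have xy : 0 < x * y by rewrite nmulr_rgt0.
  have : 0 <= x' * y'.
    have [x'0|x'0] := leP 0 x'; first by rewrite mulr_ge0 // -e'.
    by rewrite nmulr_rge0 // ltW // ltNge -e' -ltNge.
  by lra.
have [p1|p1] := boolP (0 <= cross e u); have [p2|p2] := boolP (0 <= cross e v);
  have [p3|p3] := boolP (0 <= cross e w) => h1 h2 h3.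
all: try by apply: (same _ _ _ _ eu ev _ h1); rewrite ?p1 ?p2 ?(negbTE p1) ?(negbTE p2).
all: try by apply: (same _ _ _ _ eu ew _ h2); rewrite ?p1 ?p3 ?(negbTE p1) ?(negbTE p3).
all: by apply: (same _ _ _ _ ev ew _ h3); rewrite ?p2 ?p3 ?(negbTE p2) ?(negbTE p3).
Qed.

(* [l e + m f] are the coordinates in a basis of unit vectors at angle [pi / 3]. *)
Lemma hexagonal_sector (l m l' m' : R) : 0 <= l -> 0 <= m -> 0 <= l' -> 0 <= m' ->
  l ^+ 2 + l * m + m ^+ 2 = 1 -> l' ^+ 2 + l' * m' + m' ^+ 2 = 1 ->
  1 / 2 <= l * l' + m * m' + (l * m' + l' * m) / 2.
Proof.
move=> l0 m0 l0' m0' h h'.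
have lm : 1 <= l + m by rewrite -(@ler_sqr R) ?nnegrE ?addr_ge0 // expr1n; nra.
have lm' : 1 <= l' + m' by rewrite -(@ler_sqr R) ?nnegrE ?addr_ge0 // expr1n; nra.
have : 1 <= (l + m) * (l' + m') by rewrite -[X in X <= _]mulr1 ler_pM.
have : 0 <= l * l' by exact: mulr_ge0.
have : 0 <= m * m' by exact: mulr_ge0.
by nra.
Qed.

(** Here [X] is the component of a unit vector along a fixed axis and [Z] the component across it
    divided by the square root of 3, which makes the boundary lines rational. The four values cut
    the arc of 240 degrees at angle more than [pi / 3] from the axis into arcs of 60 degrees. *)
Definition sector (X Z : R) : nat :=
  if 0 <= Z then (if 0 <= X + Z then 0%N else 1%N)
  else (if X < Z then 2%N else 3%N).

(** The linear forms passed to [hexagonal_sector] are the coordinates in the basis of the two unit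
    vectors bounding the sector. The condition [X < 1 / 2] excludes the two arcs adjacent to the
    axis. *)
Lemma same_sector (X Z X' Z' : R) : X ^+ 2 + 3 * Z ^+ 2 = 1 -> X' ^+ 2 + 3 * Z' ^+ 2 = 1 ->
  X < 1 / 2 -> X' < 1 / 2 -> sector X Z = sector X' Z' -> 1 / 2 <= X * X' + 3 * (Z * Z').
Proof.
move=> h h' x x'; rewrite /sector.
have [Z0|Z0] := leP 0 Z; have [Z0'|Z0'] := leP 0 Z';
  try by case: ifP => _; case: ifP.
- have [XZ|XZ] := leP 0 (X + Z); have [XZ'|XZ'] := leP 0 (X' + Z') => // _.
  + have a : X <= Z by rewrite leNgt; apply/negP => ?; nra.
    have a' : X' <= Z' by rewrite leNgt; apply/negP => ?; nra.
    have := @hexagonal_sector (Z + X) (Z - X) (Z' + X') (Z' - X').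
    have -> : (Z + X) * (Z' + X') + (Z - X) * (Z' - X') +
      ((Z + X) * (Z' - X') + (Z' + X') * (Z - X)) / 2 = X * X' + 3 * (Z * Z') by field.
    by apply; lra.
  + have := @hexagonal_sector (- X - Z) (2 * Z) (- X' - Z') (2 * Z').
    have -> : (- X - Z) * (- X' - Z') + 2 * Z * (2 * Z') +
      ((- X - Z) * (2 * Z') + (- X' - Z') * (2 * Z)) / 2 = X * X' + 3 * (Z * Z') by field.
    by apply; lra.
- have [XZ|XZ] := ltP X Z; have [XZ'|XZ'] := ltP X' Z' => // _.
  + have := @hexagonal_sector (Z - X) (- (2 * Z)) (Z' - X') (- (2 * Z')).
    have -> : (Z - X) * (Z' - X') + (- (2 * Z)) * (- (2 * Z')) +
      ((Z - X) * (- (2 * Z')) + (Z' - X') * (- (2 * Z))) / 2 = X * X' + 3 * (Z * Z') by field.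
    by apply; lra.
  + have a : X + Z <= 0 by rewrite leNgt; apply/negP => ?; nra.
    have a' : X' + Z' <= 0 by rewrite leNgt; apply/negP => ?; nra.
    have := @hexagonal_sector (- Z - X) (X - Z) (- Z' - X') (X' - Z').
    have -> : (- Z - X) * (- Z' - X') + (X - Z) * (X' - Z') +
      ((- Z - X) * (X' - Z') + (- Z' - X') * (X - Z)) / 2 = X * X' + 3 * (Z * Z') by field.
    by apply; lra.
Qed.

(** One vector serves as the axis; the others fall into four sectors, each holding at most one of
    them. *)
Lemma six_unit_vectors (I : eqType) (s : seq I) (u : I -> plane R) :
  uniq s -> (forall i, i \in s -> dot (u i) (u i) = 1) ->
  {in s &, forall i j, i != j -> dot (u i) (u j) < 1 / 2} -> (size s < 6)%N.
Proof.
case: s => [//|i0 s] /= /andP[i0s us] u1 far; rewrite ltnS leqNgt; apply/negP => s5.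
have e1 : dot (u i0) (u i0) = 1 by apply: u1; rewrite mem_head.
pose h : R := Num.sqrt 3.
have h2 : h ^+ 2 = 3 by rewrite sqr_sqrtr // ler0n.
have h0 : h != 0 by rewrite gt_eqF // sqrtr_gt0 ltr0n.
pose X i := dot (u i0) (u i); pose Z i := cross (u i0) (u i) / h.
have dotE i j : dot (u i) (u j) = X i * X j + 3 * (Z i * Z j).
  by rewrite (dot_frame _ _ e1) -h2 /X /Z; field.
pose sg i := sector (X i) (Z i).
have inj : {in s &, injective sg}.
  move=> i j si sj sij; apply: contrapT => /eqP ij.
  have si' : i \in i0 :: s by rewrite in_cons si orbT.
  have sj' : j \in i0 :: s by rewrite in_cons sj orbT.
  have := far i j si' sj' ij; rewrite dotE; apply/negP; rewrite -leNgt.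
  apply: same_sector sij.
  - by have := u1 i si'; rewrite dotE -!expr2.
  - by have := u1 j sj'; rewrite dotE -!expr2.
  - by apply: far => //; [exact: mem_head|apply: contraNneq i0s => ->].
  - by apply: far => //; [exact: mem_head|apply: contraNneq i0s => ->].
have : (size (map sg s) <= size (iota 0 4))%N.
  apply: uniq_leq_size; first by rewrite map_inj_in_uniq.
  move=> _ /mapP[i _ ->]; rewrite mem_iota /= /sg /sector.
  by case: ifP => _; case: ifP.
by rewrite size_map size_iota leqNgt -ltnS s5.
Qed.

End UnitVectors.

(** * Corners of the polygon and of its images *)

Section Corners.
Context {R : realType}.
Variables (n : nat) (O A : plane R) (P V : set (plane R)).
Hypotheses (n_ge3 : (3 <= n)%N) (AO : A <> O).
Hypothesis VE : V = [set rotation O (k%:R * (2 * pi) / n%:R) A | k in `I_n].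
Hypothesis PE : P = convex_hull V.

Local Notation alpha := ((2 * pi) / n%:R : R).
Local Notation C := (cos alpha).
(* [kappa] is the squared cosine of half the interior angle of [P]. *)
Local Notation kappa := ((1 - C) / 2).

(* [Q] contains, near [x], the cone with axis [u] and the aperture of [P]. *)
Definition cone_at (Q : set (plane R)) (x u : plane R) :=
  dot u u = 1 /\ exists2 e : R, 0 < e & forall w, dot w w <= e -> 0 <= dot w u ->
    kappa * dot w w <= dot w u ^+ 2 -> Q (x + w).

Let C_lt1 : C < 1. Proof. exact: cos_alpha_lt1. Qed.

Let C_gtN1 : -1 < C.
Proof.
have n0 : 0 < n%:R :> R by rewrite ltr0n; case: n n_ge3.
have h : alpha < pi.
  by rewrite ltr_pdivrMr // mulrC ltr_pM2l ?pi_gt0 // ltr_nat.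
have h0 : 0 < alpha by rewrite divr_gt0 // mulr_gt0 // pi_gt0.
by rewrite -(cospi R) ltr_cos ?in_itv /= ?lexx ?ltW ?pi_gt0.
Qed.

(** In the orthogonal frame [s = a + b], [e = a - b] the cone condition reads [|q| <= p], so the
    coordinates [p + q] and [p - q] along the edges are nonnegative; the bound on the length of [w]
    keeps their sum [2 * p] below 1. *)
Lemma cone_decomposition (a b w : plane R) (l : R) : 0 < l -> dot a a = l -> dot b b = l ->
  dot a b = - C * l -> 0 <= dot w (a + b) ->
  kappa * dot w w * dot (a + b) (a + b) <= dot w (a + b) ^+ 2 ->
  dot w w <= l * kappa ->
  exists p q : R, [/\ 0 <= p, 0 <= q, p + q <= 1 & w = p *: a + q *: b].
Proof.
move=> l0 aa bb ab ws wk wl.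
set s := a + b in ws wk *; pose e := a - b.
have ss : dot s s = 4 * l * kappa.
  have -> : dot s s = dot a a + dot b b + 2 * dot a b by rewrite /dot !mxE; ring.
  by rewrite aa bb ab; field.
have ee : dot e e = 4 * l * (1 - kappa).
  have -> : dot e e = dot a a + dot b b - 2 * dot a b by rewrite /dot !mxE; ring.
  by rewrite aa bb ab; field.
have se : dot s e = 0.
  have -> : dot s e = dot a a - dot b b by rewrite /dot !mxE; ring.
  by rewrite aa bb subrr.
have k0 : 0 < kappa by rewrite divr_gt0 // subr_gt0.
have k1 : 0 < 1 - kappa by have -> : 1 - kappa = (1 + C) / 2 by [field]; rewrite divr_gt0 //; have := C_gtN1; lra.
have ss0 : 0 < dot s s by rewrite ss; apply: mulr_gt0 => //; exact: mulr_gt0.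
have ee0 : 0 < dot e e by rewrite ee; apply: mulr_gt0 => //; exact: mulr_gt0.
pose p := dot w s / dot s s; pose q := dot w e / dot e e.
have wE : w = p *: s + q *: e.
  apply/eqP; rewrite -subr_eq0; apply/eqP/dot_eq0; set z := w - _.
  have zs : dot z s = 0.
    have -> : dot z s = dot w s - p * dot s s - q * dot s e by rewrite /z /dot !mxE; ring.
    by rewrite se /p mulr0 subr0 divfK ?subrr // gt_eqF.
  have ze : dot z e = 0.
    have -> : dot z e = dot w e - p * dot s e - q * dot e e by rewrite /z /dot !mxE; ring.
    by rewrite se /q mulr0 subr0 divfK ?subrr // gt_eqF.
  have : dot z z * (dot s s * dot e e - dot s e ^+ 2) =
    dot z s ^+ 2 * dot e e + dot z e ^+ 2 * dot s s - 2 * dot z s * dot z e * dot s e.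
    by rewrite /dot; ring.
  rewrite zs ze se expr0n /= !(mul0r, mulr0, subr0, addr0) => /eqP.
  by rewrite !mulf_eq0 (gt_eqF ss0) (gt_eqF ee0) /= !orbF => /eqP.
have ww : dot w w = p ^+ 2 * dot s s + q ^+ 2 * dot e e.
  rewrite {1 2}wE.
  have -> : dot (p *: s + q *: e) (p *: s + q *: e) =
    p ^+ 2 * dot s s + q ^+ 2 * dot e e + 2 * p * q * dot s e by rewrite /dot !mxE; ring.
  by rewrite se; ring.
have p0 : 0 <= p by rewrite divr_ge0 // ltW.
have wsE : dot w s = p * dot s s by rewrite /p divfK // gt_eqF.
have q2 : q ^+ 2 <= p ^+ 2.
  move: wk; rewrite wsE ww ss ee => h.
  have : 0 <= ((4 * l * kappa) ^+ 2 * (1 - kappa)) * (p ^+ 2 - q ^+ 2) by lra.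
  rewrite pmulr_rge0 ?subr_ge0 //; apply: mulr_gt0 => //; apply: exprn_gt0.
  by rewrite -ss.
have qp : `|q| <= p by rewrite -(@ler_sqr R) ?nnegrE // real_normK ?num_real.
have p2 : p <= 1 / 2.
  rewrite -(@ler_sqr R) ?nnegrE ?p0 ?ler01 ?divr_ge0 ?ler01 ?ler0n //.
  have h : p ^+ 2 * dot s s <= dot w w by rewrite ww lerDl mulr_ge0 ?sqr_ge0 // ltW.
  have : 0 <= (l * kappa) * (1 - 4 * p ^+ 2) by move: h; rewrite ss; lra.
  by rewrite pmulr_rge0; [move=> ?; lra|exact: mulr_gt0].
move: qp; rewrite ler_norml => /andP[q3 q4].
exists (p + q), (p - q); split; [lra|lra|lra|].
by rewrite {1}wE /s /e; apply/rowP => i; rewrite !mxE; ring.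
Qed.

Lemma corner_edges v : V v -> exists a b, [/\ V (v + a), V (v + b),
  0 < dot a a, dot b b = dot a a & dot a b = - C * dot a a].
Proof.
move=> Vv; have vO := vertex_neq_center AO VE Vv.
have n0 : n%:R != 0 :> R by rewrite pnatr_eq0; case: n n_ge3.
exists (turn n O 1 v - v), (turn n O (n - 1) v - v).
have -> : v + (turn n O 1 v - v) = turn n O 1 v by rewrite addrC subrK.
have -> : v + (turn n O (n - 1) v - v) = turn n O (n - 1) v by rewrite addrC subrK.
split; try exact: (turn_vertex n_ge3 VE).
- apply: dot_gt0 => e; apply: vO; apply: (turn_fixed n_ge3 (k := 1)).
    by rewrite /= (leq_trans _ n_ge3).
  by apply/eqP; rewrite -subr_eq0 e.
- rewrite /turn mul1r natrB ?(leq_trans _ n_ge3) //.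
  have -> : (n%:R - 1) * (2 * pi) / n%:R = - alpha + pi *+ 2 :> R by field.
  by rewrite /dot !mxE /= cosD2pi sinD2pi cosN sinN; ring.
rewrite /turn mul1r natrB ?(leq_trans _ n_ge3) //.
have -> : (n%:R - 1) * (2 * pi) / n%:R = - alpha + pi *+ 2 :> R by field.
rewrite /dot !mxE /= cosD2pi sinD2pi cosN sinN.
have := cos2Dsin2 alpha; set c := cos alpha; set s := sin alpha => cs.
have s2 : s ^+ 2 = 1 - c ^+ 2 by rewrite -cs; ring.
move: (v 0 0) (v 0 1) (O 0 0) (O 0 1) => x y o o'.
transitivity ((s ^+ 2 + c ^+ 2 - 2 * c + 1 - 2 * s ^+ 2) * ((x - o) ^+ 2 + (y - o') ^+ 2)).
  by ring.
transitivity (- c * ((c ^+ 2 + s ^+ 2 - 2 * c + 1) * ((x - o) ^+ 2 + (y - o') ^+ 2))).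
  by rewrite s2; ring.
by ring.
Qed.

Lemma similarity_cone r f v : similarity r f -> V v -> exists u, cone_at (f @` P) (f v) u.
Proof.
move=> fr Vv; have [a [b [Va Vb aa bb ab]]] := corner_edges Vv.
pose a' := f (v + a) - f v; pose b' := f (v + b) - f v.
have dE x y : dot (f (v + x) - f v) (f (v + y) - f v) = r ^+ 2 * dot x y.
  by rewrite (similarity_dot _ _ _ fr) ![v + _]addrC !addrK.
pose l := r ^+ 2 * dot a a.
have l0 : 0 < l by rewrite mulr_gt0 // exprn_gt0 // fr.1.
have aa' : dot a' a' = l by rewrite dE.
have bb' : dot b' b' = l by rewrite dE bb.
have ab' : dot a' b' = - C * l by rewrite dE ab /l; ring.
have k0 : 0 < kappa by rewrite divr_gt0 // subr_gt0.
pose s := a' + b'.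
have ss : dot s s = 4 * l * kappa.
  have -> : dot s s = dot a' a' + dot b' b' + 2 * dot a' b' by rewrite /dot !mxE; ring.
  by rewrite aa' bb' ab'; field.
have ss0 : 0 < dot s s by rewrite ss; apply: mulr_gt0 => //; exact: mulr_gt0.
pose k := Num.sqrt (dot s s).
have k_gt0 : 0 < k by rewrite sqrtr_gt0.
have k2 : k ^+ 2 = dot s s by rewrite sqr_sqrtr // ltW.
have dws w : dot w (k^-1 *: s) = dot w s / k by rewrite /dot !mxE; field; rewrite gt_eqF.
exists (k^-1 *: s); split.
  rewrite dws; have -> : dot (k^-1 *: s) s = dot s s / k by rewrite /dot !mxE; field; rewrite gt_eqF.
  by rewrite -k2; field; rewrite gt_eqF.
(* The squared length of [s / 2], that is, the squared height of the triangle spanned by the two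
   edges. *)
exists (l * kappa); first exact: mulr_gt0.
move=> w wl; rewrite dws pmulr_lge0 ?invr_gt0 // => ws.
rewrite exprMn exprVn k2 ler_pdivlMr // => wk.
have [p [q [p0 q0 pq ->]]] := cone_decomposition l0 aa' bb' ab' ws wk wl.
exists (v + p *: a + q *: b).
  have [pq0|pq0] := eqVneq (p + q) 0.
    have [-> ->] : p = 0 /\ q = 0 by split; lra.
    by rewrite !scale0r !addr0; apply: (vertex_in_polygon PE).
  have pq1 : 0 < p + q by rewrite lt_neqAle eq_sym pq0 addr_ge0.
  have -> : v + p *: a + q *: b = (1 - (p + q)) *: v +
      (1 - (1 - (p + q))) *: ((p / (p + q)) *: (v + a) + (1 - p / (p + q)) *: (v + b)).
    by apply/rowP => i; rewrite !mxE; field.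
  apply: (polygon_convex PE); first exact: (vertex_in_polygon PE).
    apply: (polygon_convex PE); try exact: (vertex_in_polygon PE).
    by rewrite divr_ge0 //= ?ler_pdivrMr ?mul1r ?lerDl // ltW.
  by apply/andP; split; lra.
have [c [v0 [v1 [fE _ _ _]]]] := similarity_form fr.
by rewrite /a' /b' !fE; apply/rowP => i; rewrite !mxE; ring.
Qed.

(** If the angle between the axes were at most the aperture, the bisecting direction [u + u'] would
    lie in both cones. The cones being closed, the inequality obtained is strict. *)
Lemma cones_far Q Q' x u u' : cone_at Q x u -> cone_at Q' x u' ->
  (forall y, Q y -> Q' y -> y = x) -> dot u u' < - C.
Proof.
move=> [u1 [e e0 h]] [u1' [e' e0' h']] QQ; rewrite ltNge; apply/negP => d.
set D := dot u u' in d.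
have D1 : D <= 1.
  have := dot_ge0 (u - u').
  have -> : dot (u - u') (u - u') = dot u u + dot u' u' - 2 * D by rewrite /D /dot !mxE; ring.
  by rewrite u1 u1'; lra.
have D0 : 0 < 1 + D by have := C_lt1; lra.
have [t [t0 te te']] : exists t : R, [/\ 0 < t, 4 * t ^+ 2 <= e & 4 * t ^+ 2 <= e'].
  (* With [t] a quarter of a number [d <= 1], [4 * t ^+ 2] is [d ^+ 2 / 4], hence at most [d]; and
     the squared length of [w] is at most [4 * t ^+ 2]. *)
  exists (Num.min 1 (Num.min e e') / 4).
  have m0 : 0 < Num.min 1 (Num.min e e') by rewrite !lt_min ltr01 e0 e0'.
  have m1 : Num.min 1 (Num.min e e') <= 1 by rewrite ge_min lexx.
  have me : Num.min 1 (Num.min e e') <= e by rewrite !ge_min lexx orbT.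
  have me' : Num.min 1 (Num.min e e') <= e' by rewrite !ge_min lexx !orbT.
  move: (Num.min 1 _) m0 m1 me me' => t t0 t1 te te'.
  by split; [lra|nra|nra].
pose w := t *: (u + u').
have ww : dot w w = t ^+ 2 * (2 * (1 + D)).
  have -> : dot w w = t ^+ 2 * (dot u u + dot u' u' + 2 * D) by rewrite /w /D /dot !mxE; ring.
  by rewrite u1 u1'; ring.
have wu : dot w u = t * (1 + D).
  have -> : dot w u = t * (dot u u + D) by rewrite /w /D /dot !mxE; ring.
  by rewrite u1.
have wu' : dot w u' = t * (1 + D).
  have -> : dot w u' = t * (D + dot u' u') by rewrite /w /D /dot !mxE; ring.
  by rewrite u1' addrC.
have w4 : dot w w <= 4 * t ^+ 2 by rewrite ww; have := sqr_ge0 t; nra.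
have wk : kappa * dot w w <= (t * (1 + D)) ^+ 2.
  have : 0 <= (t ^+ 2 * (1 + D)) * (D + C) 
    by apply: mulr_ge0; [apply: mulr_ge0; [exact: sqr_ge0|exact: ltW]|lra].
  by rewrite ww exprMn; lra.
have Qw : Q (x + w).
  by apply: h; rewrite ?wu //; [exact: le_trans te|rewrite mulr_ge0 ?ltW].
have Qw' : Q' (x + w).
  by apply: h'; rewrite ?wu' //; [exact: le_trans te'|rewrite mulr_ge0 ?ltW].
have := QQ _ Qw Qw' => /eqP; rewrite -subr_eq0 addrAC subrr add0r => /eqP w0.
have : 0 < dot w w by rewrite ww !mulr_gt0 // exprn_gt0.
by rewrite w0 /dot !mxE !mul0r addr0 ltxx.
Qed.

(** The cone is convex, so it suffices to test vertices; for the vertex at angle [k * alpha] the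
    claim reduces to [(1 - ct) * (C - ct) >= 0], with equality at the neighbours of [v]. *)
Lemma polygon_in_cone v y : V v -> P y ->
  Num.sqrt kappa * edist y v * edist v O <= dot (y - v) (O - v).
Proof.
move=> Vv; pose K : set (plane R) :=
  [set y | Num.sqrt kappa * edist y v * edist v O <= dot (y - v) (O - v)].
apply: (@polygon_min _ _ _ PE K) => [_ /(vertexP VE)[k0 _ ->]|x z t hx hz /andP[t0 t1]];
  rewrite /K /=; last first.
  move: hx hz; rewrite /K /= => hx hz.
  have -> : dot (t *: x + (1 - t) *: z - v) (O - v) =
    t * dot (x - v) (O - v) + (1 - t) * dot (z - v) (O - v) by rewrite /dot !mxE; ring.
  apply: (@le_trans _ _ (t * (Num.sqrt kappa * edist x v * edist v O) +
     (1 - t) * (Num.sqrt kappa * edist z v * edist v O))); last first.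
    by apply: lerD; apply: ler_wpM2l => //; rewrite subr_ge0.
  have tri : edist (t *: x + (1 - t) *: z) v <= t * edist x v + (1 - t) * edist z v.
    rewrite !edistE.
    have -> : t *: x + (1 - t) *: z - v = t *: (x - v) + (1 - t) *: (z - v).
      by apply/rowP => i; rewrite !mxE; ring.
    apply: le_trans (norm_triangle _ _) _.
    have sc (k : R) (w : plane R) : 0 <= k ->
        Num.sqrt (dot (k *: w) (k *: w)) = k * Num.sqrt (dot w w).
      move=> k_ge0; have -> : dot (k *: w) (k *: w) = k ^+ 2 * dot w w by rewrite /dot !mxE; ring.
      by rewrite sqrtrM ?sqr_ge0 // sqrtr_sqr ger0_norm.
    by rewrite !sc // subr_ge0.
  have : 0 <= Num.sqrt kappa * edist v O by rewrite mulr_ge0 ?sqrtr_ge0 ?edist_ge0.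
  move: tri; move: (edist (t *: x + (1 - t) *: z) v) (edist x v) (edist z v) => E1 E2 E3.
  move: (Num.sqrt kappa) (edist v O) => sk d tri sd.
  have := ler_wpM2l sd tri; lra.
have [k kn kE] : exists2 k, (k < n)%N & turn n O k0 A = turn n O k v.
  have [l ln ->] := vertexP VE Vv.
  exists ((k0 + (n - l)) %% n)%N; first by rewrite ltn_mod (leq_trans _ n_ge3).
  by rewrite -(turn_mod O n_ge3) (turnD n O) -addnA subnK ?(ltnW ln) // -(turnD n O) (turn_full O n_ge3).
rewrite kE; have [k_eq0|k_gt0] := posnP k.
  by rewrite k_eq0 (turn0 n O) edistxx subrr mulr0 mul0r /dot !mxE !mul0r addr0.
set y' := turn n O k v; have yE : y' = rotation O (k%:R * alpha) v.
  by rewrite /y' /turn -mulrA.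
have kb : (0 < k < n)%N by rewrite k_gt0.
have ck : cos (k%:R * alpha) <= C by exact: cos_multiple_le.
set ct := cos (k%:R * alpha) in ck.
have c1 : 0 <= 1 - ct by rewrite subr_ge0 cos_le1.
have kp : 0 <= kappa by rewrite divr_ge0 // subr_ge0 ltW.
have dE : dot (y' - v) (O - v) = (1 - ct) * edist v O ^+ 2.
  by rewrite edist_sq /ct yE /dot !mxE /=; ring.
have eE : edist y' v ^+ 2 = 2 * (1 - ct) * edist v O ^+ 2.
  by rewrite yE edist_rotation_self.
have d0 := edist_ge0 v O.
rewrite dE -(@ler_sqr R) ?nnegrE ?mulr_ge0 ?sqrtr_ge0 ?edist_ge0 ?sqr_ge0 //.
have -> : (Num.sqrt kappa * edist y' v * edist v O) ^+ 2 =
    kappa * (2 * (1 - ct) * edist v O ^+ 2) * edist v O ^+ 2.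
  by rewrite -eE 2!exprMn sqr_sqrtr.
suff : 0 <= ((1 - ct) * (C - ct)) * (edist v O ^+ 2 * edist v O ^+ 2) by lra.
by apply: mulr_ge0; apply: mulr_ge0 => //; rewrite ?sqr_ge0 ?subr_ge0.
Qed.

(** Both edges of the small cone lie in the corner of [P] at [v], which has the same aperture.
    Adding the two resulting inequalities leaves the equality case of the Cauchy-Schwarz inequality
    for [u] and [O - v]. *)
Lemma cone_axis_unique v Q u : V v -> Q `<=` P -> cone_at Q v u ->
  edist v O *: u = O - v.
Proof.
move=> Vv QP [u1 [e e0 h]].
pose k := Num.sqrt kappa; pose k' := Num.sqrt (1 - kappa).
have k0 : 0 < kappa by rewrite divr_gt0 // subr_gt0.
have k1 : 0 <= 1 - kappa by have -> : 1 - kappa = (1 + C) / 2 by [field]; rewrite divr_ge0 //; have := C_gtN1; lra.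
have kk : k ^+ 2 = kappa by rewrite sqr_sqrtr // ltW.
have kk' : k' ^+ 2 = 1 - kappa by rewrite sqr_sqrtr.
have k_gt0 : 0 < k by rewrite sqrtr_gt0.
pose u' := pt (- u 0 1) (u 0 0).
have u1' : u 0 0 * u 0 0 + u 0 1 * u 0 1 = 1 by exact: u1.
pose t := Num.sqrt e; have t0 : 0 < t by rewrite sqrtr_gt0.
have t2 : t ^+ 2 = e by rewrite sqr_sqrtr // ltW.
have edge (s : R) : s ^+ 2 = 1 - kappa -> t * k * edist v O <= dot (t *: (k *: u + s *: u')) (O - v).
  move=> s2; set w := t *: _.
  have ww : dot w w = e.
    have -> : dot w w = t ^+ 2 * ((k ^+ 2 + s ^+ 2) * (u 0 0 * u 0 0 + u 0 1 * u 0 1)).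
      by rewrite /w /u' /dot !mxE /=; ring.
    by rewrite t2 kk s2 u1'; ring.
  have wu : dot w u = t * k.
    have -> : dot w u = t * k * (u 0 0 * u 0 0 + u 0 1 * u 0 1).
      by rewrite /w /u' /dot !mxE /=; ring.
    by rewrite u1' mulr1.
  have Pw : P (v + w).
    apply/QP/h; rewrite ?ww ?wu //; first by rewrite mulr_ge0 // ltW.
    by rewrite exprMn t2 kk mulrC.
  have := polygon_in_cone Vv Pw; rewrite addrAC subrr add0r -/k.
  have -> : edist (v + w) v = t.
    by rewrite edistE addrAC subrr add0r ww.
  by rewrite [k * t]mulrC.
have E1 := edge k' kk'.
have E2 : t * k * edist v O <= dot (t *: (k *: u + (- k') *: u')) (O - v).
  by apply: edge; rewrite sqrrN.
have E : edist v O <= dot u (O - v).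
  have : 2 * (t * k) * edist v O <= 2 * (t * k) * dot u (O - v).
    have <- : dot (t *: (k *: u + k' *: u')) (O - v) + dot (t *: (k *: u + - k' *: u')) (O - v) =
        2 * (t * k) * dot u (O - v) by rewrite /dot !mxE; ring.
    by lra.
  by rewrite ler_pM2l // !mulr_gt0.
apply/eqP; rewrite -subr_eq0; apply/eqP/dot_eq0/eqP; rewrite eq_le dot_ge0 andbT.
have -> : dot (edist v O *: u - (O - v)) (edist v O *: u - (O - v)) =
  edist v O ^+ 2 * dot u u - 2 * edist v O * dot u (O - v) + dot (v - O) (v - O).
  by rewrite /dot !mxE; ring.
rewrite -edist_sq u1; have := edist_ge0 v O; nra.
Qed.

(** Both cones would have the axis pointing to [O], against [cones_far]. *)
Lemma vertex_one_piece v Q Q' u u' : V v -> Q `<=` P -> Q' `<=` P ->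
  cone_at Q v u -> cone_at Q' v u' -> (forall y, Q y -> Q' y -> y = v) -> False.
Proof.
move=> Vv QP QP' cu cu' QQ; have := cones_far cu cu' QQ.
have d0 : edist v O != 0 by rewrite gt_eqF // edist_gt0 //; exact: (vertex_neq_center AO VE).
have -> : u' = u.
  apply: (scalerI d0).
  by rewrite (cone_axis_unique Vv QP cu) (cone_axis_unique Vv QP' cu').
by rewrite cu.1 => ?; have := C_gtN1; lra.
Qed.

(** The bound [- C] on the dot products of the axes is [1 / 2] for [n = 3], at most [0] for
    [n = 4, 5], and at most [- (1 / 2)] from [n = 6] on. *)
Lemma card_common_vertex (I : finType) (J : {set I}) (Q : I -> set (plane R)) x :
  (forall i, i \in J -> exists u, cone_at (Q i) x u) ->
  (forall i j, i \in J -> j \in J -> i != j -> forall y, Q i y -> Q j y -> y = x) ->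
  [/\ n = 3%N -> (#|J| <= 5)%N, (n = 4%N \/ n = 5%N) -> (#|J| <= 3)%N &
      (6 <= n)%N -> (#|J| <= 2)%N].
Proof.
move=> cJ far.
have /choice[u uP] : forall i, exists u, i \in J -> cone_at (Q i) x u.
  by move=> i; have [iJ|_] := boolP (i \in J); [have [u] := cJ i iJ|]; [exists u|exists 0].
have u1 i : i \in J -> dot (u i) (u i) = 1 by move=> /uP[].
have uf i j : i \in J -> j \in J -> i != j -> dot (u i) (u j) < - C.
  by move=> iJ jJ ij; apply: cones_far (uP i iJ) (uP j jJ) (far i j iJ jJ ij).
have n0 : 0 < n%:R :> R by rewrite ltr0n; case: n n_ge3.
split.
- move=> n3.
  have C3 : C = - (1 / 2).
    have e : alpha = pi - pi / 3 by rewrite n3; field.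
    by rewrite e cosB cospi sinpi cos_pithird; field.
  rewrite -ltnS cardE; apply: (@six_unit_vectors _ _ _ u); first exact: enum_uniq.
    by move=> i; rewrite mem_enum; exact: u1.
  move=> i j; rewrite !mem_enum => iJ jJ ij.
  by have := uf i j iJ jJ ij; rewrite C3 opprK.
- move=> n45; rewrite leqNgt; apply/negP => /card_geqP[s [us s4 sJ]].
  have C0 : 0 <= C.
    apply: cos_ge0_pihalf; have := pi_gt0 R => p0.
    have a0 : 0 <= alpha by rewrite divr_ge0 // ltW // mulr_gt0.
    have a1 : alpha <= pi / 2.
      rewrite ler_pdivrMr //.
      have : (4%:R : R) <= n%:R by rewrite ler_nat; case: n45 => ->.
      by nra.
    by apply/andP; split; lra.
  case: s us s4 sJ => [|a [|b [|c [|d [|]]]]] //= us _ sJ.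
  have [aJ bJ cJ' dJ] : [/\ a \in J, b \in J, c \in J & d \in J].
    by split; apply: sJ; rewrite !inE eqxx ?orbT.
  move: us; rewrite !inE !negb_or -!andbA => /and5P[ab ac ad bc /and3P[bd cd _]].
  have uf' i j : i \in J -> j \in J -> i != j -> dot (u i) (u j) < 0.
    by move=> iJ jJ ij; apply: lt_le_trans (uf i j iJ jJ ij) _; rewrite oppr_le0.
  by apply: (@four_unit_vectors R (u a) (u b) (u c) (u d)); [exact: u1|exact: uf'..].
- move=> n6; rewrite leqNgt; apply/negP => /card_geqP[s [us s4 sJ]].
  have C0 : 1 / 2 <= C.
    rewrite -cos_pithird; have := pi_gt0 R => p0.
    apply: le_cos; first by rewrite divr_ge0 // ltW // mulr_gt0.
      rewrite ler_pdivrMr //.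
      have : (6%:R : R) <= n%:R by rewrite ler_nat.
      by nra.
    by lra.
  case: s us s4 sJ => [|a [|b [|c [|]]]] //= us _ sJ.
  have [aJ bJ cJ'] : [/\ a \in J, b \in J & c \in J].
    by split; apply: sJ; rewrite !inE eqxx ?orbT.
  move: us; rewrite !inE !negb_or -!andbA => /and4P[ab ac bc _].
  have uf' i j : i \in J -> j \in J -> i != j -> dot (u i) (u j) < - (1 / 2).
    by move=> iJ jJ ij; apply: lt_le_trans (uf i j iJ jJ ij) _; rewrite lerN2.
  by apply: (@three_unit_vectors R (u a) (u b) (u c)); [exact: u1..|exact: uf'|exact: uf'|exact: uf'].
Qed.

End Corners.

(** * The projections onto the pieces of a polygonal system *)

(** Close to [x] only sets of the family that contain [x] are met, and on them the value is
    [f x]. *)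
Lemma locally_constant_bigcup {T : topologicalType} (Y : Type) (I : finType)
    (A : I -> set T) (f : T -> Y) :
  (forall i, closed (A i)) -> (forall i x y, A i x -> A i y -> f x = f y) ->
  locally_constant_on (\bigcup_i A i) f.
Proof.
move=> clA fA x _; apply: filterS (near_closed_family x clA) => y h [i _ Aiy].
by apply: (fA i) => //; exact: h.
Qed.

Lemma cos_nat {R : realType} (l : nat) : cos (2 * pi * l%:R) = 1 :> R.
Proof.
have -> : 2 * pi * l%:R = 0 + (pi *+ 2) *+ l :> R by rewrite -[_ *+ l]mulr_natr; ring.
by rewrite (periodicn (@cosD2pi R)) cos0.
Qed.

Lemma sin_nat {R : realType} (l : nat) : sin (2 * pi * l%:R) = 0 :> R.
Proof.
have -> : 2 * pi * l%:R = 0 + (pi *+ 2) *+ l :> R by rewrite -[_ *+ l]mulr_natr; ring.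
by rewrite (periodicn (@sinD2pi R)) sin0.
Qed.

Lemma cos_eq1_small {R : realType} (d : R) : `|d| < pi -> cos d = 1 -> d = 0.
Proof.
rewrite -cos_norm => dpi c1; apply: normr0_eq0.
by apply: cos_inj; rewrite ?in_itv /= ?normr_ge0 ?lexx ?pi_ge0 ?ltW // c1 cos0.
Qed.

(** The values lie in the discrete set of multiples of [2 * pi]. *)
Lemma cos_eq1_constant {R : realType} {T : topologicalType} (A : set T) (g : T -> R) :
  connected A -> {within A, continuous g} -> (forall x, A x -> cos (g x) = 1) ->
  forall x y, A x -> A y -> g x = g y.
Proof.
move=> cA cg g1; apply: (locally_constant_connected cA) => x Ax.
have := iffLR (within_real_continuousP _ _) cg x Ax _ (pi_gt0 R).
apply: filterS => y h Ay; apply/esym/eqP; rewrite -subr_eq0; apply/eqP.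
apply: cos_eq1_small; first exact: h.
have s0 z : A z -> sin (g z) = 0.
  by move=> Az; apply: cos1sin0; rewrite g1 // normr1.
by rewrite cosB !g1 // !s0 // mulr0 addr0 mulr1.
Qed.

Lemma contractible_connected {R : realType} (X : set (plane R)) :
  contractible X -> connected X.
Proof.
move=> [a [H [Xa cH XH H01]]].
have I0 : (0 : R) \in `[0, 1] by rewrite in_itv /= lexx ler01.
have I1 : (1 : R) \in `[0, 1] by rewrite in_itv /= lexx ler01.
have path x : X x -> joined X x a.
  move=> Xx; have [e0 e1] := H01 x Xx.
  rewrite -{1}e0 -e1; pose f (t : R) : plane R := H (t, x).
  have := @joined_image R (plane R) `[0, 1]%classic X f 0 1; apply => /=.
  - pose h (t : R) : R * plane R := (t, x).
    have ch : {within `[0, 1]%classic, continuous h}.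
      apply: continuous_subspaceT => t N [[U W] /= [Ut Wx] UW].
      by apply: filterS Ut => y Uy; apply: UW; split => //=; exact: nbhs_singleton.
    by apply: within_comp ch cH _.
  - by move=> t t01; apply: XH => //; move: t01; rewrite in_itv.
  - have := @joined_intro R `[0, 1]%classic `[0, 1]%classic 0 1.
    by apply => //=; exact: segment_connected.
apply: connected_joined => x y Xx Xy.
by apply: connected_component_trans (path x Xx) _; exact/connected_component_sym/path.
Qed.

Section SystemRetraction.
Context {R : realType}.
Variables (n : nat) (O A : plane R) (P V : set (plane R)).
Hypotheses (n_ge3 : (3 <= n)%N) (AO : A <> O).
Hypothesis VE : V = [set rotation O (k%:R * (2 * pi) / n%:R) A | k in `I_n].
Hypothesis PE : P = convex_hull V.
Variables (m : nat) (S : 'I_m -> plane R -> plane R).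
Hypothesis S_system : polygonal_system P V S.

Lemma system_sim i : exists2 r, 0 < r < 1 & similarity r (S i).
Proof.
have [r r01 Sr] := system_similarity S_system i.
by exists r => //; split => //; case/andP: r01.
Qed.

Lemma system_inj i : injective (S i).
Proof. by have [r _ /similarity_inj] := system_sim i. Qed.

Lemma system_continuous i : continuous (S i).
Proof. by have [r _ /similarity_continuous] := system_sim i. Qed.

Local Notation Q i := (S i @` P).
Local Notation Pt := (\bigcup_i Q i).

Lemma piece_compact i : compact (Q i).
Proof.
apply: continuous_compact; last exact: (polygon_compact n_ge3 VE PE).
by apply: continuous_subspaceT; exact: system_continuous.
Qed.

Lemma piece_closed i : closed (Q i).
Proof. exact: (compact_closed (@norm_hausdorff _ _) (piece_compact (i := i))). Qed.

Lemma piece_connected i : connected (Q i).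
Proof.
apply: connected_continuous_connected; first exact: (polygon_connected PE).
by apply: continuous_subspaceT; exact: system_continuous.
Qed.

Lemma union_compact : compact Pt.
Proof.
have -> : Pt = \big[setU/set0]_(i in 'I_m) Q i.
  by rewrite -bigcup_pred; apply: eq_bigcupl; split.
by apply: bigsetU_compact => i _; exact: piece_compact.
Qed.

Lemma meet_vertex i j x : i <> j -> Q i x -> Q j x -> (S i @` V) x /\ (S j @` V) x.
Proof.
move=> ij Qi Qj; have Qx : (Q i `&` Q j) x by [].
have [e|[a [e Vi Vj]]] := system_meet S_system ij; first by rewrite e in Qx.
by move: Qx; rewrite e => ->.
Qed.

Lemma meet_unique i j x y : i <> j -> Q i x -> Q j x -> Q i y -> Q j y -> x = y.
Proof.
move=> ij Qi Qj Qi' Qj'; have Qx : (Q i `&` Q j) x by [].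
have Qy : (Q i `&` Q j) y by [].
have [e|[a [e _ _]]] := system_meet S_system ij; first by rewrite e in Qx.
by move: Qx Qy; rewrite e => -> ->.
Qed.

Lemma vertex_piece i : S i @` V `<=` Q i.
Proof. by apply: image_subset; exact: (vertex_in_polygon PE). Qed.

Lemma union_connected : connected Pt.
Proof. exact/contractible_connected/(system_contractible S_system). Qed.

Local Notation vtx k := (turn n O k A).

(* Lagrange interpolation with distances in place of linear factors. *)
Lemma vertex_interpolation i : exists2 phi : plane R -> R, continuous phi &
  forall l, (l < n)%N -> phi (S i (vtx l)) = l%:R.
Proof.
pose a (k : 'I_n) := S i (vtx k).
have a_inj : injective a.
  by move=> k l /system_inj/(turn_inj n_ge3 AO (ltn_ord k) (ltn_ord l))/val_inj.
exists (fun x => \sum_(l < n) (l%:R * \prod_(k < n | k != l) (edist (a k) x / edist (a k) (a l)))).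
  have cq (k l : 'I_n) : continuous (fun x => edist (a k) x / edist (a k) (a l)).
    by move=> x; have h := @continuous_edist R (a k) x; exact: (cvgM h (cvg_cst _)).
  have cl (l : 'I_n) : continuous (fun x => l%:R *
      \prod_(k < n | k != l) (edist (a k) x / edist (a k) (a l))).
    have cp := @continuous_big R 'I_n _ 1 (fun k => k != l) (@mul_continuous R) _
      (index_enum 'I_n) (fun k x => edist (a k) x / edist (a k) (a l)) (fun k _ => cq k l).
    by move=> x; exact: (cvgM (cvg_cst _) (cp x)).
  exact: (@continuous_sum R _ R^o n _ cl).
move=> l ln; rewrite -/(a (Ordinal ln)) (bigD1 (Ordinal ln)) //=.
rewrite [X in _ * X + _]big1 ?mulr1; last first.
  move=> k kl; rewrite divff // gt_eqF // edist_gt0 //.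
  by move=> /a_inj/eqP; rewrite (negbTE kl).
rewrite [X in _ + X]big1 ?addr0 // => k kl.
rewrite (bigD1 (Ordinal ln)) 1?eq_sym //=.
by rewrite edistxx mul0r mul0r mulr0.
Qed.

(* Wind [Q i] around the circle so that its vertices go to [1], and map the other
   pieces to [1]. On each of these, a lift is a constant multiple of [2 pi], which
   tells through which vertex of [Q i] the piece is attached. *)
Lemma system_retraction i : exists r : plane R -> plane R,
  [/\ {within Pt, continuous r},
      forall x, Q i x -> r x = x &
      forall j, j <> i -> exists2 a, (S i @` V) a & forall x, Q j x -> r x = a].
Proof.
have [phi cphi phiE] := vertex_interpolation i.
pose inQ x := `[< Q i x >].
pose c x : R := if inQ x then cos (2 * pi * phi x) else 1.
pose s x : R := if inQ x then sin (2 * pi * phi x) else 0.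
have cf : continuous (fun x => 2 * pi * phi x).
  by move=> x; exact: (cvgM (cvg_cst _) (cphi x)).
have out j x : j <> i -> Q j x -> c x = 1 /\ s x = 0.
  move=> ji Qj; rewrite /c /s /inQ; case: asboolP => // Qi.
  have [_ [v Vv <-]] := meet_vertex ji Qj Qi.
  have [l ln ->] := vertexP VE Vv.
  by rewrite phiE // cos_nat sin_nat.
have inE x : Q i x -> c x = cos (2 * pi * phi x) /\ s x = sin (2 * pi * phi x).
  by move=> Qi; rewrite /c /s /inQ asboolT.
have piecewise (f g : plane R -> R) (k : R) : continuous g -> (forall x, Q i x -> f x = g x) ->
    (forall j x, j <> i -> Q j x -> f x = k) -> {within Pt, continuous f}.
  move=> cg fg fk; apply: within_bigcup_continuous; first exact: piece_closed.
  move=> j; have [->|/eqP ji] := eqVneq j i.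
    apply: (@subspace_eq_continuous _ _ _ g); last exact: continuous_subspaceT.
    by move=> x /set_mem Qx; exact/esym/fg.
  apply: (@subspace_eq_continuous _ _ _ (fun=> k)).
    by move=> x /set_mem Qx; exact/esym/(fk j).
  by apply: continuous_subspaceT; exact: cst_continuous.
have cc : {within Pt, continuous c}.
  apply: (piecewise c (fun x => cos (2 * pi * phi x)) 1).
  - by move=> x; apply: (continuous_comp (cf x)); exact: continuous_cos.
  - by move=> x /inE[].
  - by move=> j x ji Qj; have [] := out j x ji Qj.
have cs : {within Pt, continuous s}.
  apply: (piecewise s (fun x => sin (2 * pi * phi x)) 0).
  - by move=> x; apply: (continuous_comp (cf x)); exact: continuous_sin.
  - by move=> x /inE[].
  - by move=> j x ji Qj; have [] := out j x ji Qj.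
have c2s2 x : Pt x -> c x ^+ 2 + s x ^+ 2 = 1.
  move=> _; rewrite /c /s; case: ifP => _; first exact: cos2Dsin2.
  by rewrite expr1n expr0n addr0.
have [a [H [Pa cH PH H01]]] := system_contractible S_system.
have [F cF FE] := contractible_lifting union_compact Pa cH PH H01 cc cs c2s2.
have QPt j : Q j `<=` Pt by move=> x Qj; exists j.
have Fj j x y : j <> i -> Q j x -> Q j y -> F x = F y.
  move=> ji; apply: cos_eq1_constant; first exact: piece_connected.
    exact: continuous_subspaceW (QPt j) cF.
  by move=> z Qz; have [<- _] := FE z (QPt j z Qz); have [] := out j z ji Qz.
have Fi x y : Q i x -> Q i y -> F x - 2 * pi * phi x = F y - 2 * pi * phi y.
  apply: (@cos_eq1_constant _ _ (Q i) (fun z => F z - 2 * pi * phi z)).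
  - exact: piece_connected.
  - move=> z; apply: within_continuousB; first exact: continuous_subspaceW (QPt i) cF.
    exact: continuous_subspaceT.
  move=> z Qz; have [e1 e2] := FE z (QPt i z Qz); have [e3 e4] := inE z Qz.
  by rewrite cosB -e1 -e2 -e3 -e4 -!expr2; exact: c2s2 (QPt i z Qz).
have V0 : V (vtx 0) by exact: (vertex_turn n_ge3 VE).
have Q0 : Q i (S i (vtx 0)) by apply: vertex_piece; exists (vtx 0).
(* On [Q i] both [F] and [2 * pi * phi] are angles of the same map to the circle, so they differ by
   a constant. *)
pose k := F (S i (vtx 0)) - 2 * pi * phi (S i (vtx 0)).
have FQ x : Q i x -> F x = k + 2 * pi * phi x.
  by move=> Qx; rewrite /k -(Fi x _ Qx Q0) subrK.
have Fv l : (l < n)%N -> F (S i (vtx l)) = k + 2 * pi * l%:R.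
  move=> ln; rewrite FQ ?phiE //; apply: vertex_piece; exists (vtx l) => //.
  exact: (vertex_turn n_ge3 VE).
have gate_uniq l l' : k + 2 * pi * l%:R = k + 2 * pi * l'%:R -> l = l'.
  move=> /addrI/mulfI e; apply/eqP; rewrite -(eqr_nat R); apply/eqP/e.
  by rewrite gt_eqF // mulr_gt0 // pi_gt0.
(* A piece touching [Q i] has as its lift the value at the common vertex, and adjacent pieces
   outside [Q i] share their value; connectedness of the union then spreads [B] everywhere. *)
pose B x := Q i x \/ exists2 l, (l < n)%N & F x = k + 2 * pi * l%:R.
have Bmono j x y : Q j x -> Q j y -> B x -> B y.
  have [->|/eqP ji] := eqVneq j i; first by left.
  move=> Qx Qy Bx; right; rewrite (Fj j y x) //.
  case: Bx => // Qix.
  have [_ [v Vv <-]] := meet_vertex ji Qx Qix.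
  by have [l ln ->] := vertexP VE Vv; exists l; rewrite ?Fv.
have Ball x : Pt x -> B x.
  move=> Px; have lB : locally_constant_on Pt B.
    apply: locally_constant_bigcup; first exact: piece_closed.
    by move=> j y z Qy Qz; apply/propext; split; [exact: (Bmono j)|exact: (Bmono j)].
  have := locally_constant_connected union_connected lB Px (QPt i _ Q0).
  by move=> ->; left.
have gate j : j <> i -> exists2 l, (l < n)%N & forall x, Q j x -> F x = k + 2 * pi * l%:R.
  move=> ji; pose y := S j (vtx 0).
  have Qy : Q j y by apply: vertex_piece; exists (vtx 0).
  suff [l ln e] : exists2 l, (l < n)%N & F y = k + 2 * pi * l%:R.
    by exists l => // x Qx; rewrite (Fj j x y).
  have [Qiy|//] := Ball y (QPt j y Qy).
  have [_ [v Vv e]] := meet_vertex ji Qy Qiy.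
  by have [l ln ve] := vertexP VE Vv; exists l => //; rewrite -e ve Fv.
(* On [Pt] outside [Q i] the index exists by [gate] and is unique by [gate_uniq]; the default [0] is
   reached only off [Pt]. *)
pose r x := if inQ x then x
  else S i (vtx (xget 0%N [set l | (l < n)%N /\ F x = k + 2 * pi * l%:R])).
have rin x : Q i x -> r x = x by move=> Qx; rewrite /r /inQ asboolT.
have rout j : j <> i -> exists2 a, (S i @` V) a & forall x, Q j x -> r x = a.
  move=> ji; have [l ln Fl] := gate j ji; exists (S i (vtx l)).
    by exists (vtx l) => //; exact: (vertex_turn n_ge3 VE).
  move=> x Qx; rewrite /r /inQ; case: asboolP => Qix.
    have [_ [v Vv e]] := meet_vertex ji Qx Qix.
    have [l' ln' ve] := vertexP VE Vv.
    by rewrite -e ve; congr (S i (vtx _)); apply: gate_uniq; rewrite -Fv // -ve e Fl.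
  congr (S i (vtx _)); case: xgetP => [l' -> [ln' e]|/(_ l) []//].
    by apply: gate_uniq; rewrite -e Fl.
  by split => //; exact: Fl.
exists r; split => //.
apply: within_bigcup_continuous; first exact: piece_closed.
move=> j; have [->|/eqP ji] := eqVneq j i.
  apply: (@subspace_eq_continuous (plane R) (Q i) (plane R) id).
    by move=> x /set_mem Qx; exact/esym/rin.
  by apply: continuous_subspaceT => x; exact: cvg_id.
have [b _ rb] := rout j ji.
apply: (@subspace_eq_continuous (plane R) (Q j) (plane R) (fun=> b)).
  by move=> x /set_mem Qx; exact/esym/rb.
by apply: continuous_subspaceT; exact: cst_continuous.
Qed.

(* Otherwise the direction from [O] would lift to an angle function on [Pt], which
   the rotation of [P] shifts by a constant [2 pi / n] modulo [2 pi], contradicting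
   that its [n]-th power is the identity. *)
Lemma center_in_union : (forall x, Pt x -> Pt (turn n O 1 x)) -> Pt O.
Proof.
move=> Prot; apply: contrapT => nO.
have pos x : Pt x -> 0 < edist x O by move=> Px; apply: edist_gt0 => e; apply: nO; rewrite -e.
pose c (x : plane R) : R := (x 0 0 - O 0 0) / edist x O.
pose s (x : plane R) : R := (x 0 1 - O 0 1) / edist x O.
have cd : continuous (fun x : plane R => edist x O).
  have -> : (fun x : plane R => edist x O) = edist O by apply/funext => x; exact: edistC.
  exact: continuous_edist.
have cont (j : 'I_2) : {within Pt, continuous (fun x : plane R => (x 0 j - O 0 j) / edist x O)}.
  apply/within_cvg => x Px; apply: cvgM.
    apply: cvgB; last exact: cvg_cst.
    by apply: cvg_within_filter; exact: (@coord_continuous R 1 2 0 j x).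
  apply: cvgV; first by rewrite gt_eqF // pos.
  by apply: cvg_within_filter; exact: cd.
have [a [H [Pa cH PH H01]]] := system_contractible S_system.
have c2s2 x : Pt x -> c x ^+ 2 + s x ^+ 2 = 1.
  move=> Px; have := pos x Px => p.
  rewrite /c /s !exprMn !exprVn -mulrDl.
  have -> : (x 0 0 - O 0 0) ^+ 2 + (x 0 1 - O 0 1) ^+ 2 = edist x O ^+ 2.
    by rewrite edist_sq /dot !mxE -!expr2.
  by rewrite divff // expf_neq0 // gt_eqF.
have [F cF FE] := contractible_lifting union_compact Pa cH PH H01 (cont 0) (cont 1) c2s2.
set al : R := 2 * pi / n%:R.
have n0 : n%:R != 0 :> R by rewrite pnatr_eq0; case: n n_ge3.
have cr x : c (turn n O 1 x) = cos al * c x - sin al * s x.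
  rewrite /c /s; have -> : edist (turn n O 1 x) O = edist x O.
    by have := edist_turn n O 1 x O; rewrite turn_center.
  by rewrite /turn mul1r !mxE /=; ring.
have sr x : s (turn n O 1 x) = sin al * c x + cos al * s x.
  rewrite /c /s; have -> : edist (turn n O 1 x) O = edist x O.
    by have := edist_turn n O 1 x O; rewrite turn_center.
  by rewrite /turn mul1r !mxE /=; ring.
pose g x := F (turn n O 1 x) - F x - al.
have g1 x : Pt x -> cos (g x) = 1.
  move=> Px; have [e1 e2] := FE x Px; have [e3 e4] := FE _ (Prot x Px).
  rewrite /g cosB [cos (_ - F x)]cosB [sin (_ - F x)]sinB -e1 -e2 -e3 -e4 -/(c x) -/(s x).
  rewrite -/(c (turn n O 1 x)) -/(s (turn n O 1 x)) cr sr.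
  have := c2s2 x Px; have := cos2Dsin2 al.
  move: (c x) (s x) (cos al) (sin al) => p q C D h1 h2.
  transitivity ((C ^+ 2 + D ^+ 2) * (p ^+ 2 + q ^+ 2)); last by rewrite h1 h2 mulr1.
  by ring.
have cg : {within Pt, continuous g}.
  apply: within_continuousB; last by apply: continuous_subspaceT; exact: cst_continuous.
  apply: within_continuousB => //.
  apply: (@within_comp _ _ _ Pt Pt (turn n O 1) F) => //.
  by apply: continuous_subspaceT; exact: similarity_continuous (similarity_turn n O 1).
have gc := cos_eq1_constant union_connected cg g1.
have Pk k : Pt (turn n O k a).
  elim: k => [|k IH]; first by rewrite turn0.
  by rewrite -(add1n k) -turnD; exact: Prot.
(* Over [n] turns the constant increment adds up to [0], so [g a = - al], which is not a multiple of
   [2 * pi]. *)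
have Fk k : F (turn n O k a) = F a + k%:R * (g a + al).
  elim: k => [|k IH]; first by rewrite turn0 mul0r addr0.
  rewrite -(add1n k) -turnD; have := gc _ _ (Pk k) Pa; rewrite {1}/g => e.
  have -> : F (turn n O 1 (turn n O k a)) = g a + al + F (turn n O k a) by rewrite -e; ring.
  by rewrite IH natrD; ring.
have := Fk n; rewrite turn_full // => /eqP; rewrite -subr_eq0 opprD addrA subrr add0r oppr_eq0.
rewrite mulf_eq0 (negbTE n0) /= => /eqP e.
have ga : g a = - al by rewrite -[g a](addrK al) e add0r.
have := g1 a Pa; rewrite ga cosN => /eqP; apply/negP.
by rewrite lt_eqF // cos_alpha_lt1.
Qed.

End SystemRetraction.

(** * The attractor *)

Lemma small_power {R : realType} (q D e : R) : 0 <= q < 1 -> 0 < e ->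
  \forall k \near \oo, q ^+ k * D < e.
Proof.
move=> /andP[q0 q1] e0.
have D1 : 0 < `|D| + 1 by rewrite ltr_wpDl.
have q1' : `|q| < 1 by rewrite ger0_norm.
have := cvg_expr q1' => /cvgrPdist_lt /(_ (e / (`|D| + 1))).
move=> /(_ (divr_gt0 e0 D1)); apply: filterS => k.
rewrite sub0r normrN ger0_norm ?exprn_ge0 // ltr_pdivlMr // => h.
apply: le_lt_trans h; rewrite ler_wpM2l ?exprn_ge0 //.
by rewrite (le_trans (ler_norm D)) // lerDl.
Qed.

Section Attractor.
Context {R : realType}.
Variables (n : nat) (O A : plane R) (P V : set (plane R)).
Hypotheses (n_ge3 : (3 <= n)%N) (AO : A <> O).
Hypothesis VE : V = [set rotation O (k%:R * (2 * pi) / n%:R) A | k in `I_n].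
Hypothesis PE : P = convex_hull V.
Variables (m : nat) (S : 'I_m -> plane R -> plane R).
Hypothesis S_system : polygonal_system P V S.
Variable (G : set (plane R -> plane R)).
Hypotheses (G_group : symmetry_group P G) (S_symmetric : symmetric_system G S).
Variable (K : set (plane R)).
Hypothesis K_attractor : attractor S K.
Variables (T r : 'I_m -> plane R -> plane R).
Hypotheses (ST : forall i, cancel (S i) (T i)) (T_continuous : forall i, continuous (T i)).

Local Notation Q i := (S i @` P).
Local Notation Pt := (\bigcup_i Q i).
Local Notation Sw := (word_map S).

Hypothesis r_retraction : forall i, [/\ {within Pt, continuous (r i)},
  forall x, Q i x -> r i x = x &
  forall j, j <> i -> exists2 a, (S i @` V) a & forall x, Q j x -> r i x = a].

Let V0 : V A.
Proof. by have := vertex_turn n_ge3 VE 0; rewrite turn0. Qed.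

Let VP : V `<=` P.
Proof. exact: (vertex_in_polygon PE). Qed.

(** * Words, addresses and the location of the attractor *)

Lemma system_contraction : exists2 q : R, 0 <= q < 1 &
  forall i x y, edist (S i x) (S i y) <= q * edist x y.
Proof.
have /choice[rho rhoP] : forall i, exists rho, 0 < rho < 1 /\ similarity rho (S i).
  by move=> i; have [rho h1 h2] := system_sim S_system i; exists rho.
exists (\big[Num.max/0]_i rho i).
  apply/andP; split; first by elim/big_ind: _ => // [x y x0 y0|i _];
    [rewrite le_max x0|have [/andP[/ltW]] := rhoP i].
  by elim/big_ind: _ => // [x y x0 y0|i _]; [rewrite gt_max x0|have [/andP[]] := rhoP i].
move=> i x y; have [_ [_ ->]] := rhoP i.
by rewrite ler_wpM2r ?edist_ge0 // le_bigmax_cond.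
Qed.

Lemma word_sim w : exists r, similarity r (Sw w).
Proof.
elim: w => [|i w [s sw]]; first by exists 1; exact: similarity_id.
by have [t _ st] := system_sim S_system i; exists (t * s); exact: similarity_comp.
Qed.

Lemma word_inj w : injective (Sw w).
Proof. by have [s /similarity_inj] := word_sim w. Qed.

Lemma word_cat w w' x : Sw (w ++ w') x = Sw w (Sw w' x).
Proof. by elim: w => //= i w ->. Qed.

Lemma word_stable (X : set (plane R)) w x : (forall i y, X y -> X (S i y)) -> X x -> X (Sw w x).
Proof. by move=> SX Xx; elim: w => //= i w IH; exact: SX. Qed.

Lemma word_polygon w x : P x -> P (Sw w x).
Proof.
apply: word_stable => i y Py; apply: (system_sub S_system (i := i)); by exists y.
Qed.

Lemma attractor_stable i x : K x -> K (S i x).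
Proof. by have [_ _ KE] := K_attractor; rewrite {2}KE => Kx; exists i => //; exists x. Qed.

Lemma word_attractor w x : K x -> K (Sw w x).
Proof. by apply: word_stable; exact: attractor_stable. Qed.

Lemma attractor_piece x : K x -> exists i y, K y /\ x = S i y.
Proof. by have [_ _ KE] := K_attractor; rewrite {1}KE => -[i _ [y Ky <-]]; exists i, y. Qed.

Lemma attractor_word k x : K x -> exists w y, [/\ size w = k, K y & x = Sw w y].
Proof.
elim: k x => [|k IH] x Kx; first by exists [::], x.
have [i [y [Ky ->]]] := attractor_piece Kx.
by have [w [z [wk Kz ->]]] := IH y Ky; exists (i :: w), z; split => //=; rewrite wk.
Qed.

Lemma attractor_closed : closed K.
Proof. by have [_ cK _] := K_attractor; apply: compact_closed cK; exact: norm_hausdorff. Qed.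

Lemma attractor_bounded : exists2 D : R, 0 < D & forall x, K x -> edist x O <= D.
Proof.
have [_ /compact_bounded[M [_ hM]] _] := K_attractor.
have M1 : M < `|M| + 1 by apply: le_lt_trans (ler_norm M) _; rewrite ltrDl.
exists (2 * (`|M| + 1 + `|O|)); first by rewrite mulr_gt0 // ltr_wpDr // ltr_wpDl.
move=> x Kx; apply: le_trans (edist_le_sup_norm _ _) _; rewrite ler_pM2l //.
by apply: le_trans (ler_normB _ _) _; rewrite lerD2r; exact: (hM _ M1 x Kx).
Qed.

Lemma word_contraction (q : R) w x y : 0 <= q ->
  (forall i x y, edist (S i x) (S i y) <= q * edist x y) ->
  edist (Sw w x) (Sw w y) <= q ^+ size w * edist x y.
Proof.
move=> q0 hq; elim: w => [|i w IH] /=; first by rewrite expr0 mul1r.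
by apply: le_trans (hq i _ _) _; rewrite exprS -mulrA ler_wpM2l.
Qed.

(** Moving the end of a deep address of [x] to [z] changes the point very little. Applied to the
    polygon this encloses [K]; applied to [K] itself it puts points with bounded addresses of every
    length into [K]. *)
Lemma approximation (X : set (plane R)) (z : plane R) (D : R) x :
  closed X -> X z -> (forall i y, X y -> X (S i y)) ->
  (forall k, exists w y, [/\ size w = k, edist y O <= D & x = Sw w y]) -> X x.
Proof.
move=> cX Xz SX h; have [q q01 hq] := system_contraction.
rewrite (closure_id X).1 // => N /near_edist[e e0 eN].
have [k hk] := filter_ex (small_power (D + edist O z) q01 e0).
have [w [y [wk yD xE]]] := h k.
exists (Sw w z); split; first exact: word_stable.
apply: eN; rewrite xE; apply: le_lt_trans hk; rewrite -wk.
have /andP[q0 _] := q01.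
apply: le_trans (word_contraction w y z q0 hq) _.
rewrite ler_wpM2l ?exprn_ge0 //; apply: le_trans (edist_triangle O _ _) _.
by rewrite lerD2r.
Qed.

Lemma attractor_minimal (X : set (plane R)) (z : plane R) :
  closed X -> X z -> (forall i y, X y -> X (S i y)) -> K `<=` X.
Proof.
move=> cX Xz SX x Kx; have [D _ hD] := attractor_bounded.
apply: (approximation (D := D) cX Xz SX) => k.
by have [w [y [wk Ky ->]]] := attractor_word k Kx; exists w, y; split => //; exact: hD.
Qed.

Lemma attractor_sub_polygon : K `<=` P.
Proof.
apply: (attractor_minimal (z := A)) => [||i y Py].
- exact: (polygon_closed n_ge3 VE PE).
- exact: VP.
- by apply: (system_sub S_system (i := i)); exists y.
Qed.

Lemma in_attractor (D : R) x :
  (forall k, exists w y, [/\ size w = k, edist y O <= D & x = Sw w y]) -> K x.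
Proof.
have [[z Kz] _ _] := K_attractor.
exact: (approximation attractor_closed Kz attractor_stable).
Qed.

Lemma vertex_word k v : V v -> exists w v', [/\ size w = k, V v' & v = Sw w v'].
Proof.
elim: k v => [|k IH] v Vv; first by exists [::], v.
have [i [u Vu <-]] := system_vertex S_system Vv.
by have [w [v' [wk Vv' ->]]] := IH u Vu; exists (i :: w), v'; split => //=; rewrite wk.
Qed.

Lemma vertex_in_attractor : V `<=` K.
Proof.
move=> v Vv; apply: (@in_attractor (edist A O)) => k.
have [w [v' [wk Vv' ->]]] := vertex_word k Vv; exists w, v'; split => //.
by rewrite (edist_vertex VE).
Qed.

(** If the address of [x] starts with another piece, then [x] is a common vertex, and the vertices
    of [P] belong to [K]. *)
Lemma attractor_in_piece i x : K x -> Q i x -> (S i @` K) x.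
Proof.
move=> Kx Qx; have [j [y [Ky xE]]] := attractor_piece Kx.
have [ij|/eqP ij] := eqVneq i j; first by exists y; rewrite // ij.
have Qj : Q j x by exists y => //; exact: attractor_sub_polygon.
have [[v Vv <-] _] := meet_vertex S_system ij Qx Qj.
by exists v => //; exact: vertex_in_attractor.
Qed.

Lemma attractor_sub_piece i : S i @` K `<=` Q i.
Proof. by apply: image_subset; exact: attractor_sub_polygon. Qed.

Lemma attractor_sub_union : K `<=` Pt.
Proof.
move=> x /attractor_piece[i [y [Ky ->]]]; exists i => //; exists y => //.
exact: attractor_sub_polygon.
Qed.

Lemma polygon_vertex w v : V v -> (Sw w @` P) v -> (Sw w @` V) v.
Proof.
move=> Vv [y Py e]; exists y => //; have [s sw] := word_sim w.
apply: (similarity_vertex AO VE PE sw) => //; last by rewrite e.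
by move=> x Px; exact: word_polygon.
Qed.

(** * The symmetry group acts on the attractor *)

Lemma group_sim g : G g -> similarity 1 g.
Proof.
by move=> Gg; split => // x y; rewrite mul1r; exact: (group_isometry G_group).
Qed.

Lemma group_polygon g x : G g -> P x -> P (g x).
Proof. by move=> Gg Px; rewrite -(group_stable G_group Gg); exists x. Qed.

Lemma group_vertex g v : G g -> V v -> V (g v).
Proof.
move=> Gg Vv; have [h Gh [gh hg]] := group_inv G_group Gg.
apply: (similarity_vertex AO VE PE (group_sim Gh)); last by rewrite gh.
- by move=> x; exact: group_polygon.
- by apply: group_polygon => //; exact: VP.
Qed.

Lemma group_center g : G g -> g O = O.
Proof.
move=> Gg; apply: (isometry_center n_ge3 VE PE (group_sim Gg)) => y Py.
by move: Py; rewrite -{1}(group_stable G_group Gg) => -[x Px <-]; exists x.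
Qed.

Lemma group_word g w : G g -> exists w' g', [/\ size w' = size w, G g' &
  forall y, g (Sw w y) = Sw w' (g' y)].
Proof.
elim: w g => [|i w IH] g Gg; first by exists [::], g.
have [g1 Gg1 [j e]] := S_symmetric i Gg.
have [w' [g' [sw Gg' h]]] := IH g1 Gg1.
exists (j :: w'), g'; split => //=; first by rewrite sw.
by move=> y; rewrite -h; exact: (congr1 (fun f => f (Sw w y)) e).
Qed.

Lemma group_attractor g x : G g -> K x -> K (g x).
Proof.
move=> Gg Kx; have [D _ hD] := attractor_bounded.
apply: (@in_attractor D) => k; have [w [y [wk Ky ->]]] := attractor_word k Kx.
have [w' [g' [sw Gg' h]]] := group_word w Gg.
exists w', (g' y); split; [by rewrite sw|by rewrite -(group_center Gg') (group_isometry G_group Gg') hD|exact: h].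
Qed.

(* By compactness a locally constant [B] is constant on all pieces of some level,
   and constancy climbs from one level to the previous one because the pieces
   of [Pt] hang together at vertices, which belong to [K]. *)
Lemma attractor_connected : connected K.
Proof.
apply/connectedP_pred => B lB x0 y0 Kx0 Ky0.
have [q q01 hq] := system_contraction; have /andP[q0 _] := q01.
have [D D0 hD] := attractor_bounded.
(* A Lebesgue number argument: [q ^+ k * (2 * D)] bounds the diameter of the pieces of level [k] and
   tends to zero. *)
have [k hk] : exists k, forall w, size w = k -> forall x y, K x -> K y ->
    B (Sw w x) -> B (Sw w y).
  have [_ cK _] := K_attractor.
  have /near_covering_withinP cov := iffLR (compact_near_coveringP K) cK.
  have := cov nat \oo (fun k x => forall z, K z -> edist x z <= q ^+ k * (2 * D) -> B z = B x) _.
  have h0 : forall x, K x -> \forall x' \near x & k \near \oo, K x' ->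
      forall z, K z -> edist x' z <= q ^+ k * (2 * D) -> B z = B x'.
    move=> x Kx; have /near_edist[e e0 eB] := lB x Kx.
    have e2 : 0 < e / 2 by rewrite divr_gt0.
    exists ([set x' | edist x x' < e / 2], [set k | q ^+ k * (2 * D) < e / 2]).
      by split; [exact: edist_near|exact: small_power].
    move=> [x' k] /= [xx' ke] Kx' z Kz x'z.
    rewrite (eB x') //; last by apply: lt_trans xx' _; lra.
    apply: eB => //; apply: le_lt_trans (edist_triangle x' _ _) _.
    by have := le_lt_trans x'z ke; lra.
  move=> /(_ _ h0) h; have [k hk] := filter_ex h; exists k => w wk x y Kx Ky Bx.
  rewrite (hk _ (word_attractor w Kx)) //; first exact: word_attractor.
  apply: le_trans (word_contraction w _ _ q0 hq) _; rewrite wk.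
  rewrite ler_wpM2l ?exprn_ge0 //; apply: le_trans (edist_triangle O _ _) _.
  by have := hD x Kx; have := hD y Ky; rewrite (edistC y); lra.
have step w x y : (forall i, forall x y, K x -> K y -> B (Sw w (S i x)) -> B (Sw w (S i y))) ->
    K x -> K y -> B (Sw w x) -> B (Sw w y).
  move=> hw Kx Ky.
  (* This carries [B] from [K] to the union of the pieces, already known to be connected; each piece
     is represented by the image of the vertex [A]. *)
  pose C z := exists2 i, Q i z & B (Sw w (S i A)).
  have KA : K A by exact: vertex_in_attractor.
  have Cj j z : Q j z -> C z -> B (Sw w (S j A)).
    move=> Qj [i Qi Bi]; have [<-//|/eqP ij] := eqVneq i j.
    have [[v Vv e] [v' Vv' e']] := meet_vertex S_system ij Qi Qj.
    apply: (hw j v') => //; first exact: vertex_in_attractor.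
    by rewrite e' -e; apply: hw Bi => //; exact: vertex_in_attractor.
  have lC : locally_constant_on Pt C.
    apply: locally_constant_bigcup; first exact: (piece_closed n_ge3 VE PE S_system).
    by move=> j z t Qz Qt; apply/propext; split => /Cj h; exists j => //; exact: h.
  have [i [x' [Kx' ->]]] := attractor_piece Kx; have [j [y' [Ky' ->]]] := attractor_piece Ky.
  move=> Bx; have Qi : Q i (S i A) by exists A => //; exact: VP.
  have Qj : Q j (S j A) by exists A => //; exact: VP.
  have Ci : C (S i A) by exists i => //; exact: hw Bx.
  have := locally_constant_connected (union_connected S_system) lC.
  move=> /(_ (S i A) (S j A)) e; apply: (hw j A) => //.
  by apply: (Cj j (S j A) Qj); rewrite -e //; [exists i|exists j].
suff all_levels : forall l w, (size w + l)%N = k -> forall x y, K x -> K y ->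
    B (Sw w x) -> B (Sw w y).
  exact: (all_levels k [::]).
elim=> [|l IH] w wk; first by apply: hk; rewrite -wk addn0.
move=> x y; apply: step => i x' y' Kx' Ky'.
have := IH (rcons w i) _ x' y' Kx' Ky'.
by rewrite -cats1 !word_cat size_cat addn1 addSnnS; exact.
Qed.

(** * Projections of the attractor onto the pieces of all levels *)

Lemma piece_tree_retraction i : tree_retraction K (S i @` K) (S i @` V) (r i).
Proof.
have [cr r_id r_out] := r_retraction i.
have SVK : S i @` V `<=` S i @` K by apply: image_subset; exact: vertex_in_attractor.
have out x : K x -> ~ (S i @` K) x -> (S i @` V) (r i x).
  move=> Kx nx; have [j [y [Ky xE]]] := attractor_piece Kx.
  have ji : j <> i by move=> ji; apply: nx; exists y; rewrite // xE ji.
  have [a Va ra] := r_out j ji.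
  by rewrite ra // xE; exists y => //; exact: attractor_sub_polygon.
split => //.
- exact: continuous_subspaceW attractor_sub_union cr.
- by move=> _ [y Ky <-]; exact: attractor_stable.
- have [_ cK _] := K_attractor.
  apply: (compact_closed (@norm_hausdorff _ _)); apply: continuous_compact cK.
  by apply: continuous_subspaceT; exact: (system_continuous S_system).
- by apply: finite_image; exact: (vertex_finite VE).
- move=> x Kx; have [Qx|nQx] := pselect (Q i x).
    by rewrite r_id //; exact: attractor_in_piece.
  by apply/SVK/out => // /attractor_sub_piece.
- by move=> x /attractor_sub_piece; exact: r_id.
Qed.

Definition word_retraction (w : seq 'I_m) : plane R -> plane R :=
  foldr (fun i f => S i \o f \o T i \o r i) id w.

Lemma word_tree_retraction w :
  tree_retraction K (Sw w @` K) (Sw w @` V) (word_retraction w).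
Proof.
elim: w => [|i w IH].
  rewrite /= !image_id; split => //.
  - by apply: continuous_subspaceT => x; exact: cvg_id.
  - exact: attractor_closed.
  - exact: (vertex_finite VE).
have tr := piece_tree_retraction i.
have TK x : (S i @` K) x -> K (T i x) by move=> [y Ky <-]; rewrite ST.
have TKr x : K x -> K (T i (r i x)) by move=> /(retraction_to tr)/TK.
have E : Sw (i :: w) = S i \o Sw w by [].
rewrite E; split.
- have c1 : {within K, continuous (T i \o r i)}.
    apply: (@within_comp _ _ _ K setT (r i) (T i)) => //.
      exact: retraction_continuous tr.
    exact: continuous_subspaceT.
  have c2 := within_comp c1 (retraction_continuous IH) TKr.
  apply: (@within_comp _ _ _ K setT (word_retraction w \o (T i \o r i)) (S i)) => //.
  by apply: continuous_subspaceT; exact: (system_continuous S_system).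
- by move=> _ [y Ky <-]; apply: (word_attractor (i :: w)).
- have [_ cK _] := K_attractor.
  apply: (compact_closed (@norm_hausdorff _ _)); apply: continuous_compact cK.
  apply: continuous_subspaceT; have [s sw] := word_sim (i :: w).
  exact: similarity_continuous sw.
- by apply: finite_image; exact: (vertex_finite VE).
- move=> x Kx /=; have [y Ky e] := retraction_to IH (TKr x Kx).
  by exists y => //=; rewrite e.
- move=> _ [y Ky <-] /=.
  have L : (S i @` K) (S i (Sw w y)) by exists (Sw w y) => //; exact: word_attractor.
  by rewrite (retraction_id tr L) ST (retraction_id IH) //; exists y.
- move=> x Kx nx /=; set y := T i (r i x).
  (* If the pulled-back point [y] already lies in the smaller piece, then [x] lies outside the first
     piece and was sent to one of its vertices. So [y] is a vertex of [P] inside a smaller piece,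
     hence a vertex of that piece. *)
  have [Ly|nLy] := pselect ((Sw w @` K) y); last first.
    by have [v Vv e] := retraction_out IH (TKr x Kx) nLy; exists v => //=; rewrite e.
  have [Lx|nLx] := pselect ((S i @` K) x).
    exfalso; apply: nx; move: Ly; rewrite /y (retraction_id tr Lx) => -[z Kz e].
    by case: Lx => x' Kx' xE; exists z => //=; rewrite e -xE ST.
  have [v Vv e] := retraction_out tr Kx nLx.
  have yv : y = v by rewrite /y -e ST.
  rewrite (retraction_id IH) // yv.
  have [u Vu <-] : (Sw w @` V) v.
    apply: polygon_vertex => //; move: Ly; rewrite yv => -[z Kz <-].
    by exists z => //; exact: attractor_sub_polygon.
  by exists u.
Qed.

(** Conjugating the projection onto the piece [i] by [g] gives a projection onto the piece [j], and
    there is only one. *)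
Lemma retraction_equivariant g g' i j : G g -> G g' -> g \o S i = S j \o g' ->
  forall x, K x -> r j (g x) = g (r i x).
Proof.
move=> Gg Gg' e x Kx; have [h Gh [gh hg]] := group_inv G_group Gg.
have [h' Gh' [gh' hg']] := group_inv G_group Gg'.
have ee y : g (S i y) = S j (g' y) by exact: (congr1 (fun f => f y) e).
have ee' y : h (S j y) = S i (h' y) by rewrite -{1}(hg' y) -ee gh.
have tri := piece_tree_retraction i; have trj := piece_tree_retraction j.
have tr' : tree_retraction K (S j @` K) (S j @` V) (g \o r i \o h).
  split.
  - have hK y : K y -> K (h y) by exact: group_attractor.
    have ch : {within K, continuous h}.
      by apply: continuous_subspaceT; exact: similarity_continuous (group_sim Gh).
    have c1 := within_comp ch (retraction_continuous tri) hK.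
    apply: (@within_comp _ _ _ K setT (r i \o h) g) => //.
    by apply: continuous_subspaceT; exact: similarity_continuous (group_sim Gg).
  - exact: retraction_sub trj.
  - exact: retraction_closed trj.
  - exact: retraction_finite trj.
  - move=> y Ky /=; have [z Kz <-] := retraction_to tri (group_attractor Gh Ky).
    by exists (g' z); [exact: group_attractor|rewrite -ee].
  - move=> _ [y Ky <-] /=; rewrite (retraction_id tri); first by rewrite hg.
    by rewrite ee'; exists (h' y) => //; exact: group_attractor.
  - move=> y Ky ny /=.
    have nhy : ~ (S i @` K) (h y).
      by move=> [z Kz e']; apply: ny; exists (g' z); [exact: group_attractor|rewrite -ee e' hg].
    have [v Vv <-] := retraction_out tri (group_attractor Gh Ky) nhy.
    by exists (g' v); [exact: group_vertex|rewrite -ee].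
rewrite (retraction_unique (@norm_hausdorff _ _) attractor_connected trj tr').
- by rewrite /= gh.
- by exists (S j A), A => //; exact: vertex_in_attractor.
- exact: group_attractor.
Qed.


(** * Terminal points and central pieces *)

Hypothesis G_rotations : rotation_group P `<=` G.

Local Notation rot k := (turn n O k).
Local Notation hausT := (@norm_hausdorff _ _).

Lemma group_turn k : G (rot k).
Proof. by apply: G_rotations; exact: (turn_rotation_group n_ge3 VE PE). Qed.

Lemma vertices_transitive u v : V u -> V v -> u <> v ->
  exists2 k, (0 < k < n)%N & u = rot k v.
Proof.
move=> /(vertexP VE)[k kn uE] /(vertexP VE)[l ln vE] uv.
have e : u = rot ((k + (n - l)) %% n) v.
  rewrite -(turn_mod O n_ge3) vE turnD -addnA subnK ?(ltnW ln) // -turnD.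
  by rewrite (turn_full O n_ge3).
exists ((k + (n - l)) %% n)%N => //.
rewrite ltn_mod (leq_trans _ n_ge3) // andbT lt0n; apply/eqP => k0.
by apply: uv; rewrite e k0 turn0.
Qed.

Lemma vertex_of_piece i v : V v -> Q i v -> (S i @` V) v.
Proof. by move=> Vv Qv; apply: (@polygon_vertex [:: i]). Qed.

Lemma vertex_piece_unique i j v : V v -> Q i v -> Q j v -> i = j.
Proof.
move=> Vv Qi Qj; apply: contrapT => ij.
have cone l : Q l v -> exists u, cone_at n (Q l) v u.
  move=> Ql; have [v' Vv' <-] := vertex_of_piece Vv Ql.
  have [s _ sl] := system_sim S_system l.
  exact: (similarity_cone n_ge3 AO VE PE sl).
have [u cu] := cone i Qi; have [u' cu'] := cone j Qj.
have sub l : Q l `<=` P by exact: (system_sub S_system).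
apply: (vertex_one_piece n_ge3 AO VE PE Vv (sub i) (sub j) cu cu') => y Qiy Qjy.
exact: (meet_unique S_system ij).
Qed.

(** Any point shared by two pieces is terminal. A point of [K] that is not terminal therefore lies
    in a single piece, away from its vertices. *)
Definition terminal q := forall i, Q i q -> (S i @` V) q.

Lemma vertex_terminal v : V v -> terminal v.
Proof. by move=> Vv i; exact: vertex_of_piece. Qed.

Lemma piece_vertex_terminal i v : V v -> terminal (S i v).
Proof.
move=> Vv j Qj; have [->|/eqP ji] := eqVneq j i; first by exists v.
have Qi : Q i (S i v) by exists v => //; exact: VP.
by have [] := meet_vertex S_system ji Qj Qi.
Qed.

(* At a point [q] where finitely many pieces meet as at a vertex of a tree, the
   projections onto these pieces single out the branch at [q] containing [x]. *)
Lemma terminal_branch q : K q -> terminal q -> forall x, K x -> x <> q ->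
  exists i, [/\ Q i q, r i x <> q & forall j, Q j q -> r j x <> q -> j = i].
Proof.
move=> Kq tq.
pose E x := exists i, [/\ Q i q, r i x <> q & forall j, Q j q -> r j x <> q -> j = i].
(* The points without such a branch form a clopen subset of [K] that misses [q]. *)
pose D x := x <> q /\ ~ E x.
suff lD : locally_constant_on K D.
  move=> x Kx xq; apply: contrapT => nE.
  have Dx : D x by [].
  by move: Dx; rewrite (locally_constant_connected attractor_connected lD Kx Kq) => -[].
move=> x Kx; have [->|xq] := pselect (x = q).
  have nD : ~ D q by case.
  have := near_closed_family q (piece_closed n_ge3 VE PE S_system).
  apply: filterS => y hy Ky; apply/propext; split => // -[yq nE]; exfalso; apply: nE.
  have [j [z [Kz yE]]] := attractor_piece Ky.
  have Qy : Q j y by exists z => //; exact: attractor_sub_polygon.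
  have Qq := hy j Qy; exists j; have [_ rid _] := r_retraction j.
  split => //; first by rewrite rid.
  move=> i Qi ri; apply: contrapT => ij; apply: ri.
  have [_ rid' /(_ j)] := r_retraction i; case; first by move=> ji; apply: ij.
  by move=> a _ ra; rewrite ra // -(ra q) // rid'.
have : \forall y \near x, forall j, K y -> (r j y <> q <-> r j x <> q).
  apply: near_forall => j; have tr := piece_tree_retraction j.
  have [rx|rx] := pselect (r j x = q).
    have nx : ~ (S j @` K) x by move=> /(retraction_id tr) e; apply: xq; rewrite -e.
    by have := retraction_locally_constant hausT tr Kx nx; apply: filterS => y h /h[_ ->].
  have := iffLR (within_continuousP _ _) (retraction_continuous tr) x Kx _ (near_neq hausT rx).
  by apply: filterS => y h /h.
apply: filterS2 (near_neq hausT xq) => y yq h Ky.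
have EE : E y <-> E x.
  split=> -[i [Qi ri hi]]; exists i; split => //.
  - exact/(h i Ky).
  - by move=> j Qj rj; apply: hi => //; apply/(h j Ky).
  - exact/(h i Ky).
  - by move=> j Qj rj; apply: hi => //; apply/(h j Ky).
by apply/propext; split => -[_ nE]; split => // /EE.
Qed.

(** Invariance under the rotation is what makes the projection onto the piece equivariant; that the
    piece is centered at [O] follows from it. *)
Definition central i := exists2 g, G g & rot 1 \o S i = S i \o g.

Lemma turn_power g k i : G g -> rot 1 \o S i = S i \o g ->
  exists2 g', G g' & rot k \o S i = S i \o g'.
Proof.
move=> Gg e; elim: k => [|k [g' Gg' IH]].
  by exists id; [exact: (group_id G_group)|apply/funext => x /=; rewrite turn0].
exists (g \o g'); first exact: (group_comp G_group).
apply/funext => x /=; rewrite -(add1n k) -turnD.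
have -> : rot k (S i x) = S i (g' x) by exact: (congr1 (fun f => f x) IH).
exact: (congr1 (fun f => f (g' x)) e).
Qed.

Lemma turn_piece_center k i j g : G g -> rot k \o S i = S j \o g ->
  rot k (S i O) = S j O.
Proof.
move=> Gg e; rewrite -[in RHS](group_center Gg).
exact: (congr1 (fun f => f O) e).
Qed.

Lemma central_center i : central i -> S i O = O.
Proof.
move=> [g Gg e]; have := turn_piece_center Gg e.
by apply: (turn_fixed n_ge3); rewrite /= (leq_trans _ n_ge3).
Qed.

Lemma center_not_vertex : ~ V O.
Proof. by move=> /(vertex_neq_center AO VE). Qed.

(** The piece is centered at [O] with a strictly smaller circumradius. *)
Lemma central_vertex i v : central i -> V v -> ~ Q i v.
Proof.
move=> ci Vv Qv; have [u Vu e] := vertex_of_piece Vv Qv.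
have [s /andP[s0 s1] si] := system_sim S_system i.
have := si.2 u O; rewrite e (central_center ci) !(edist_vertex VE) // => h.
have d0 : 0 < edist A O by exact: edist_gt0.
have : s * edist A O < edist A O by rewrite gtr_pMl.
by rewrite -h ltxx.
Qed.

Lemma central_gate i v : central i -> V v -> (S i @` V) (r i v).
Proof.
move=> ci Vv; apply: (retraction_out (piece_tree_retraction i)).
  exact: vertex_in_attractor.
by move=> /attractor_sub_piece; exact: central_vertex.
Qed.

(** The rotation taking [v] to [u] would fix their common gate, which would then be [O]; but gates
    are vertices of a piece centered at [O]. *)
Lemma central_gate_inj i u v : central i -> V u -> V v -> r i u = r i v -> u = v.
Proof.
move=> ci Vu Vv e; apply: contrapT => uv.
have [k kn uE] := vertices_transitive Vu Vv uv.
have [g Gg ge] := ci; have [g' Gg' e'] := turn_power k Gg ge.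
have := retraction_equivariant (group_turn k) Gg' e' (vertex_in_attractor Vv).
rewrite -uE e => /esym/(turn_fixed n_ge3 kn) b.
have [w Vw we] := central_gate ci Vv; apply: center_not_vertex.
by have <- : w = O by apply: (system_inj S_system (i := i)); rewrite we b central_center.
Qed.

(* [K] without the part hanging from the piece [i] at its vertex [b]. *)
Lemma pruned_connected i b : connected [set x | K x /\ (r i x = b -> x = b)].
Proof.
set N := [set x | _]; have tr := piece_tree_retraction i.
have SN : S i @` K `<=` N.
  by move=> x Sx; split; [exact: (retraction_sub tr)|rewrite (retraction_id tr)].
have cS : connected (S i @` K).
  apply: connected_continuous_connected; first exact: attractor_connected.
  by apply: continuous_subspaceT; exact: (system_continuous S_system).
have Nr x : N x -> joined N x (r i x).
  move=> [Kx xb]; have [e|ne] := pselect (r i x = b).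
    by rewrite e -(xb e); apply: connected_component_refl.
  apply: (retraction_joined hausT attractor_connected tr Kx) => y Ky e.
  by split => // e'; case: ne; rewrite -e.
apply: connected_joined => x y Nx Ny.
apply: connected_component_trans (Nr x Nx) _.
apply: connected_component_trans (connected_component_sym (Nr y Ny)).
by apply: (joined_intro cS SN); apply: (retraction_to tr); [case: Nx|case: Ny].
Qed.

Lemma center_union : Pt O.
Proof.
apply: (center_in_union n_ge3 VE PE S_system) => _ [i _ [y Py <-]].
have [g Gg [j e]] := S_symmetric i (group_turn 1).
exists j => //; exists (g y); first exact: group_polygon.
by have := congr1 (fun f => f y) e.
Qed.

(* Without a central piece, [O] is a common vertex of the pieces containing it,
   which are permuted by the rotations. *)
Lemma center_terminal : (forall i, ~ central i) -> terminal O.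
Proof.
move=> nc; have [i _ Qi] := center_union.
have [g Gg [j e]] := S_symmetric i (group_turn 1).
have ij : i <> j by move=> ij; apply: (nc i); exists g => //; rewrite {2}ij.
have Qj : Q j O.
  have [y Py yO] := Qi; exists (g y); first exact: group_polygon.
  by have := congr1 (fun f => f y) e; rewrite /= yO turn_center.
move=> l Ql; have [->|/eqP li] := eqVneq l i.
  by have [] := meet_vertex S_system ij Qi Qj.
by have [] := meet_vertex S_system li Ql Qi.
Qed.

Lemma center_attractor : K O.
Proof.
have [[i ci]|nc] := pselect (exists i, central i).
  apply: (@in_attractor 0) => k; exists (nseq k i), O; rewrite size_nseq edistxx.
  by split => //; elim: k => //= k <-; rewrite (central_center ci).
have tO : terminal O by apply: center_terminal => i ci; apply: nc; exists i.
have [i _ Qi] := center_union; have [v Vv <-] := tO i Qi.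
by apply: attractor_stable; exact: vertex_in_attractor.
Qed.

(** A piece kept by the rotation would be centered at [O], where it has a vertex. *)
Lemma turn_terminal_center i j k g : (0 < k < n)%N -> terminal O -> Q i O ->
  G g -> rot k \o S i = S j \o g -> i <> j.
Proof.
move=> kn tO Qi Gg e ij; have [u Vu uO] := tO i Qi.
have := turn_piece_center Gg e; rewrite -ij => /(turn_fixed n_ge3 kn) c.
by apply: center_not_vertex; rewrite -(system_inj S_system (i := i) (etrans uO (esym c))).
Qed.

Lemma piece_turn_center i j k g : Q i O -> G g -> rot k \o S i = S j \o g -> Q j O.
Proof.
move=> [y Py yO] Gg e; exists (g y); first exact: group_polygon.
by have := congr1 (fun f => f y) e; rewrite /= yO turn_center.
Qed.

(** With a central piece, cut off what hangs at the gate of [v]; the other vertices have other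
    gates. Without one, let [i] be the piece at [O] carrying the branch of [v]: another vertex lies
    in the branch of a rotated piece different from [i], so it belongs to the fiber over [O] of the
    projection onto [i]. *)
Lemma other_vertices_connected v : V v -> exists N : set (plane R),
  [/\ connected N, N `<=` K, (forall u, V u -> u <> v -> N u) & ~ N v].
Proof.
move=> Vv; have [[i ci]|nc] := pselect (exists i, central i).
  exists [set x | K x /\ (r i x = r i v -> x = r i v)]; split.
  - exact: pruned_connected.
  - by move=> x [].
  - move=> u Vu uv; split; first exact: vertex_in_attractor.
    by move=> /(central_gate_inj ci Vu Vv).
  - move=> [Kv /(_ erefl) vE]; apply: (central_vertex ci Vv).
    by rewrite vE; apply: (vertex_piece PE); exact: central_gate.
have tO : terminal O by apply: center_terminal => i ci; apply: nc; exists i.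
have Kv := vertex_in_attractor Vv.
have vO : v <> O by exact: (vertex_neq_center AO VE Vv).
have [i [Qi riv hi]] := terminal_branch center_attractor tO Kv vO.
have tr := piece_tree_retraction i.
exists (K `&` [set x | r i x = O]); split.
- apply: (retraction_fiber_connected hausT attractor_connected tr).
  exact: attractor_in_piece center_attractor Qi.
- by move=> x [].
- move=> u Vu uv; split; first exact: vertex_in_attractor.
  have [k kn uE] := vertices_transitive Vu Vv uv.
  have [g Gg [j e]] := S_symmetric i (group_turn k).
  have ij := turn_terminal_center kn tO Qi Gg e.
  have Qj := piece_turn_center Qi Gg e.
  have Ku := vertex_in_attractor Vu.
  have uO : u <> O by exact: (vertex_neq_center AO VE Vu).
  have rju : r j u <> O.
    rewrite uE (retraction_equivariant (group_turn k) Gg e Kv) => h; apply: riv.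
    by apply: (similarity_inj (similarity_turn n O k)); rewrite h turn_center.
  have [l [Ql rlu hl]] := terminal_branch center_attractor tO Ku uO.
  apply: contrapT => riu; apply: ij.
  by rewrite (hl i Qi riu) (hl j Qj rju).
- by move=> [_ /riv].
Qed.

(** * Vertices of the polygon are end points *)

Lemma vertex_gate_unique i v x : V v -> Q i v -> K x -> r i x = v -> x = v.
Proof.
move=> Vv Qv Kx e; apply: contrapT => xv.
have [j [Qj rj _]] := terminal_branch (vertex_in_attractor Vv) (vertex_terminal Vv) Kx xv.
by apply: rj; rewrite -(vertex_piece_unique Vv Qv Qj).
Qed.

(** At every level a single piece contains the vertex, so nothing else is attached to that piece
    there. *)
Lemma vertex_address k v : V v -> exists w v', [/\ size w = k, V v', v = Sw w v' &
  forall x, K x -> word_retraction w x = v -> x = v].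
Proof.
elim: k v => [|k IH] v Vv; first by exists [::], v.
have [i [u Vu uv]] := system_vertex S_system Vv.
have [w [v' [wk Vv' uE h]]] := IH u Vu.
exists (i :: w), v'; split => //=; [by rewrite wk|by rewrite -uv uE|].
move=> x Kx; rewrite -uv => /(system_inj S_system) e.
have tr := piece_tree_retraction i.
have [y Ky yE] := retraction_to tr Kx.
have yu : y = u by apply: h => //; move: e; rewrite /= -yE ST.
apply: (vertex_gate_unique (i := i)) => //; [by rewrite uv| |by rewrite -yE yu].
by rewrite uv -uv; exists u => //; exact: VP.
Qed.

Lemma far_from_piece p x : x <> p -> \forall k \near \oo,
  forall w, size w = k -> (Sw w @` K) p -> ~ (Sw w @` K) x.
Proof.
move=> xp; have [q q01 hq] := system_contraction; have /andP[q0 _] := q01.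
have [D _ hD] := attractor_bounded.
apply: filterS (small_power (2 * D) q01 (edist_gt0 xp)) => k kD w wk [y Ky yp] [z Kz zx].
move: kD; rewrite -yp -zx => /lt_geF/negP; apply; rewrite -wk.
apply: le_trans (word_contraction w z y q0 hq) _.
rewrite ler_wpM2l ?exprn_ge0 //; apply: le_trans (edist_triangle O _ _) _.
by have := hD y Ky; have := hD z Kz; rewrite (edistC O); lra.
Qed.

Lemma word_retraction_vertex w x : K x -> ~ (Sw w @` K) x ->
  exists2 v, V v & word_retraction w x = Sw w v.
Proof.
move=> Kx nx; have [v Vv e] := retraction_out (word_tree_retraction w) Kx nx.
by exists v.
Qed.

Lemma word_joined w (X Y : set (plane R)) x y : (forall z, X z -> Y (Sw w z)) ->
  joined X x y -> joined Y (Sw w x) (Sw w y).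
Proof.
move=> XY; apply: joined_image => //; apply: continuous_subspaceT.
by have [s sw] := word_sim w; exact: similarity_continuous sw.
Qed.

(** In a piece at [v] too small to contain [x] and [y], their gates are vertices other than [v], and
    [other_vertices_connected] joins these inside the piece. *)
Lemma vertex_endpoint v x y : V v -> K x -> x <> v -> K y -> y <> v ->
  joined (K `\ v) x y.
Proof.
move=> Vv Kx xv Ky yv.
have [k [hx hy]] := filter_ex (filterI (far_from_piece xv) (far_from_piece yv)).
have [w [v' [wk Vv' vE hw]]] := vertex_address k Vv.
have Sv : (Sw w @` K) v by exists v' => //; exact: vertex_in_attractor.
have tr := word_tree_retraction w.
have [N [cN NK hN nNv]] := other_vertices_connected Vv'.
have gate z : K z -> z <> v -> ~ (Sw w @` K) z ->
    exists2 u, N u & joined (K `\ v) z (Sw w u).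
  move=> Kz zv nz; have [u Vu e] := word_retraction_vertex Kz nz.
  exists u; first by apply: hN => // uv'; apply: zv; apply: hw; rewrite // e uv'.
  rewrite -e; apply: (retraction_joined hausT attractor_connected tr Kz) => t Kt te.
  split => // tv; apply: zv; apply: hw => //.
  by rewrite -te /= tv (retraction_id tr).
have [u Nu xu] := gate x Kx xv (hx w wk Sv).
have [u' Nu' yu'] := gate y Ky yv (hy w wk Sv).
apply: connected_component_trans xu _.
apply: connected_component_trans (connected_component_sym yu').
apply: (@word_joined w N); last exact: (joined_intro cN).
move=> z Nz; split; first by apply: word_attractor; exact: NK.
by rewrite /= vE => /(word_inj (w := w)) zv'; apply: nNv; rewrite -zv'.
Qed.

(** * The order of a terminal point *)

Definition pieces_at q : {set 'I_m} := [set i | `[< Q i q >]].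

Lemma pieces_atP q i : reflect (Q i q) (i \in pieces_at q).
Proof. by rewrite inE; exact: asboolP. Qed.

(** Points are labelled by the piece of [terminal_branch]. Two points with the same label project to
    points of one piece other than [q], and these are joined because [q] is the image of an end
    point. *)
Lemma terminal_order q : K q -> terminal q -> has_order K q #|pieces_at q|.
Proof.
move=> Kq tq; have [i0 _] := attractor_piece Kq.
pose E x i := [/\ Q i q, r i x <> q & forall j, Q j q -> r j x <> q -> j = i].
pose l x := if pselect (exists i, E x i) is left e then projT1 (cid e) else i0.
have lE x : (K `\ q) x -> E x (l x).
  move=> [Kx xq]; rewrite /l; case: pselect => [e|[]]; first by case: cid.
  exact: terminal_branch.
have SK i v : V v -> K (S i v) by move=> Vv; apply/attractor_stable/vertex_in_attractor.
apply: (@card_components_label _ _ _ _ l).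
- by move=> x /lE[Qi _ _]; apply/pieces_atP.
- move=> x Kqx; have [Kx xq] := Kqx; have [Qi ri hi] := lE x Kqx.
  have := iffLR (within_continuousP _ _)
    (retraction_continuous (piece_tree_retraction (l x))) x Kx _ (near_neq hausT ri).
  apply: filterS => y h Kqy; have [Qj rj hj] := lE y Kqy.
  by apply/esym/hj => //; apply: h; case: Kqy.
- move=> i /pieces_atP Qi.
  have [v Vv vq] : exists2 v, V v & S i v <> q.
    have [e|ne] := pselect (S i A = q); last by exists A.
    exists (rot 1 A); first exact: (turn_vertex n_ge3 VE).
    move=> e'; apply: AO; apply: (turn_fixed n_ge3 (k := 1)).
      by rewrite /= (leq_trans _ n_ge3).
    by apply: (system_inj S_system (i := i)); rewrite e' e.
  have Kqv : (K `\ q) (S i v) by split => //; exact: SK.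
  exists (S i v) => //; have [_ _ hj] := lE _ Kqv; apply/esym/hj => //.
  by have [_ -> //] := r_retraction i; apply: (vertex_piece PE); exists v.
move=> x y Kqx Kqy lxy; have [Kx xq] := Kqx; have [Ky yq] := Kqy.
have [Qi rx _] := lE x Kqx; have [_ ry _] := lE y Kqy; rewrite -lxy in ry.
set i := l x in Qi rx ry; have tr := piece_tree_retraction i.
have Sq : (S i @` K) q by exact: attractor_in_piece.
have gate z : K z -> r i z <> q -> joined (K `\ q) z (r i z).
  move=> Kz rz; apply: (retraction_joined hausT attractor_connected tr Kz) => t Kt e.
  by split => // tq'; apply: rz; rewrite -e tq' (retraction_id tr).
apply: connected_component_trans (gate x Kx rx) _.
apply: connected_component_trans (connected_component_sym (gate y Ky ry)).
have [x' Kx' ex] := retraction_to tr Kx; have [y' Ky' ey] := retraction_to tr Ky.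
have [v Vv vq] := tq i Qi; rewrite -ex -ey; rewrite -ex -vq in rx; rewrite -ey -vq in ry.
apply: (@word_joined [:: i] (K `\ v)).
  move=> z [Kz zv]; split; first exact: attractor_stable.
  by move=> e; apply: zv; apply: (system_inj S_system (i := i)); rewrite vq.
apply: vertex_endpoint => //; first by move=> e; apply: rx; rewrite e.
by move=> e; apply: ry; rewrite e.
Qed.

(** * Transport of branches along words *)

Lemma word_retraction_neq w q x : K q -> ~ V q -> K x -> x <> Sw w q ->
  word_retraction w x <> Sw w q.
Proof.
move=> Kq nVq Kx xp; have tr := word_tree_retraction w.
have [Sx|nSx] := pselect ((Sw w @` K) x); first by rewrite (retraction_id tr).
have [v Vv ->] := word_retraction_vertex Kx nSx.
by move=> /(word_inj (w := w)) vq; apply: nVq; rewrite -vq.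
Qed.

Lemma word_gate_joined w q x : K q -> ~ V q -> K x -> x <> Sw w q ->
  joined (K `\ Sw w q) x (word_retraction w x).
Proof.
move=> Kq nVq Kx xp; have tr := word_tree_retraction w.
apply: (retraction_joined hausT attractor_connected tr Kx) => t Kt e; split => // tp.
apply: (word_retraction_neq (w := w) Kq nVq Kx xp).
by rewrite -e tp (retraction_id tr) //; exists q.
Qed.

(** Everything outside the piece projects to its vertices, hence away from the image of [q]. So the
    map of the word and its inverse composed with the projection compare the components in both
    directions. *)
Lemma word_branches w q : K q -> ~ V q -> (branches K (Sw w q) #= branches K q)%card.
Proof.
move=> Kq nVq; have tr := word_tree_retraction w.
have [s sw] := word_sim w; have [t st [SwT TSw]] := similarity_bij sw.
have SX z : (K `\ q) z -> (K `\ Sw w q) (Sw w z).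
  move=> [Kz zq]; split; first exact: word_attractor.
  by move=> /(word_inj (w := w)).
have TX z : (K `\ Sw w q) z -> (K `\ q) (t (word_retraction w z)).
  move=> [Kz zq]; have [y Ky e] := retraction_to tr Kz.
  rewrite -e SwT; split => //= yq.
  by apply: (word_retraction_neq (w := w) Kq nVq Kz zq); rewrite -e yq.
have TSX z : K z -> t (word_retraction w (Sw w z)) = z.
  by move=> Kz; rewrite (retraction_id tr) ?SwT //; exists z.
rewrite card_eq_le; apply/andP; split.
- apply: (@card_le_components_map _ _ (K `\ Sw w q) (K `\ q) _ TX) => x y Xx Xy h.
  have [Kx xp] := Xx; have [Ky yp] := Xy.
  apply: connected_component_trans (word_gate_joined (w := w) Kq nVq Kx xp) _.
  apply: connected_component_trans (connected_component_sym (word_gate_joined (w := w) Kq nVq Ky yp)).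
  by have := word_joined SX h; rewrite !TSw.
- apply: (@card_le_components_map _ _ (K `\ q) (K `\ Sw w q) _ SX) => x y Xx Xy h.
  have [Kx _] := Xx; have [Ky _] := Xy; rewrite -(TSX x Kx) -(TSX y Ky).
  apply: (joined_image (A := K `\ Sw w q) (B := K `\ q) (f := t \o word_retraction w)) => //.
  apply: (@within_comp _ _ _ (K `\ Sw w q) setT (word_retraction w) t) => //.
    apply: continuous_subspaceW (retraction_continuous tr).
    by move=> z [].
  by apply: continuous_subspaceT; exact: similarity_continuous st.
Qed.

(** * The center of a central piece *)

Section CentralPiece.
Variable i : 'I_m.
Hypothesis ci : central i.

Local Notation iter_word k := (nseq k i).
Local Notation vtx l := (rot l A).

Lemma iter_center k : Sw (iter_word k) O = O.
Proof. by elim: k => //= k ->; exact: central_center. Qed.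

Lemma iter_retraction_mono k k' x y : (k <= k')%N ->
  word_retraction (iter_word k) x = word_retraction (iter_word k) y ->
  word_retraction (iter_word k') x = word_retraction (iter_word k') y.
Proof.
have step j : forall x y, word_retraction (iter_word j) x = word_retraction (iter_word j) y ->
    word_retraction (iter_word j.+1) x = word_retraction (iter_word j.+1) y.
  elim: j => [|j IH] z t /=; first by move=> ->.
  by move=> /(system_inj S_system)/IH e; congr (S i _).
by move=> /subnK <-; elim: (k' - k)%N => [|d IH] // /IH/step.
Qed.

Lemma iter_retraction_inj k u v : V u -> V v ->
  word_retraction (iter_word k) u = word_retraction (iter_word k) v -> u = v.
Proof.
elim: k u v => [|k IH] u v Vu Vv //= /(system_inj S_system) e.
have [u' Vu' eu] := central_gate ci Vu; have [v' Vv' ev] := central_gate ci Vv.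
apply: (central_gate_inj ci Vu Vv); rewrite -eu -ev; congr (S i _).
by apply: IH => //; move: e; rewrite -eu -ev !ST.
Qed.

Lemma iter_retraction_vertex k v : V v ->
  exists2 u, V u & word_retraction (iter_word k) v = Sw (iter_word k) u.
Proof.
move=> Vv; have Kv := vertex_in_attractor Vv.
have [Sv|] := pselect ((Sw (iter_word k) @` K) v); last exact: word_retraction_vertex.
rewrite (retraction_id (word_tree_retraction _) Sv).
have [u Vu <-] : (Sw (iter_word k) @` V) v; last by exists u.
apply: polygon_vertex => //; have [y Ky <-] := Sv.
by exists y => //; exact: attractor_sub_polygon.
Qed.

(** The [n] vertices of [P] have distinct gates on the iterated piece, so their gates exhaust its
    [n] vertices. *)
Lemma iter_retraction_surj k x : K x -> ~ (Sw (iter_word k) @` K) x ->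
  exists l : 'I_n, word_retraction (iter_word k) x = word_retraction (iter_word k) (vtx l).
Proof.
move=> Kx nx; have [v Vv ->] := word_retraction_vertex Kx nx.
have Vt l : V (vtx l) by exact: (vertex_turn n_ge3 VE).
have /choice[f fP] : forall l : 'I_n, exists j : 'I_n,
    word_retraction (iter_word k) (vtx l) = Sw (iter_word k) (vtx j).
  move=> l; have [u Vu ->] := iter_retraction_vertex k (Vt l).
  by have [j jn ->] := vertexP VE Vu; exists (Ordinal jn).
have f_inj : injective f.
  move=> l j e; apply/val_inj; apply: (turn_inj n_ge3 AO (ltn_ord l) (ltn_ord j)).
  by apply: (iter_retraction_inj (k := k)) => //; rewrite !fP e.
have [j jn ->] := vertexP VE Vv.
have /codomP[l lE] : Ordinal jn \in codom f by rewrite injF_onto.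
by exists l; rewrite fP -lE.
Qed.

(** A point other than [O] leaves the iterated central pieces at some level, and its label is the
    vertex of [P] with the same gate there. Equal gates stay equal at deeper levels while distinct
    vertices keep distinct gates, so the label is well defined. *)
Lemma center_order : has_order K O n.
Proof.
pose R' k := word_retraction (iter_word k).
pose E x (l : 'I_n) := exists k, R' k x = R' k (vtx l).
have Vt l : V (vtx l) by exact: (vertex_turn n_ge3 VE).
have n0 : (0 < n)%N by exact: leq_trans n_ge3.
have KO := center_attractor.
have out x : x <> O -> \forall k \near \oo, ~ (Sw (iter_word k) @` K) x.
  move=> /far_from_piece; apply: filterS => k; apply; first exact: size_nseq.
  by exists O => //; exact: iter_center.
have exE x : K x -> x <> O -> exists l, E x l.
  move=> Kx /out/filter_ex[k nx]; have [l e] := iter_retraction_surj Kx nx.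
  by exists l, k.
have unE x l l' : E x l -> E x l' -> l = l'.
  move=> [k e] [k' e']; apply/val_inj; apply: (turn_inj n_ge3 AO (ltn_ord l) (ltn_ord l')).
  apply: (iter_retraction_inj (k := maxn k k')) => //.
  transitivity (R' (maxn k k') x).
    by apply/esym; apply: iter_retraction_mono e; exact: leq_maxl.
  by apply: iter_retraction_mono e'; exact: leq_maxr.
have deep x l : x <> O -> E x l -> exists k, ~ (Sw (iter_word k) @` K) x /\ R' k x = R' k (vtx l).
  move=> xO [k e]; have [k' [nx kk']] := filter_ex (filterI (out x xO) (nbhs_infty_ge k)).
  by exists k'; split => //; exact: iter_retraction_mono e.
pose l x := if pselect (exists l, E x l) is left e then projT1 (cid e) else Ordinal n0.
have lE x : (K `\ O) x -> E x (l x).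
  move=> [Kx xO]; rewrite /l; case: pselect => [e|[]]; first by case: cid.
  exact: exE.
have KV : forall j, (K `\ O) (vtx j).
  by move=> j; split; [exact: vertex_in_attractor|exact: (vertex_neq_center AO VE)].
rewrite -[X in has_order _ _ X]card_ord -cardsT.
apply: (@card_components_label _ _ _ _ l).
- by move=> x _; rewrite inE.
- move=> x XX; have [Kx xO] := XX; have [k [nx e]] := deep x _ xO (lE x XX).
  have := retraction_locally_constant hausT (word_tree_retraction (iter_word k)) Kx nx.
  apply: filterS => y h YY; have [_ e'] := h YY.1.
  by apply: (unE y); [exact: lE|exists k; rewrite /R' e'].
- by move=> j _; exists (vtx j) => //; apply: (unE (vtx j)); [exact: lE|exists 0%N].
move=> x y XX YY lxy; have [Kx xO] := XX; have [Ky yO] := YY.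
have := lE x XX; have := lE y YY; rewrite -lxy => -[k1 e1] [k2 e2].
pose k0 := maxn k1 k2.
have [k [kk0 nx]] := filter_ex (filterI (nbhs_infty_ge k0) (out x xO)).
have f1 : R' k y = R' k (vtx (l x)).
  by apply: iter_retraction_mono e1; exact: leq_trans (leq_maxl _ _) kk0.
have f2 : R' k x = R' k (vtx (l x)).
  by apply: iter_retraction_mono e2; exact: leq_trans (leq_maxr _ _) kk0.
have gate z : K z -> z <> O -> joined (K `\ O) z (R' k z).
  move=> Kz zO; rewrite -(iter_center k).
  apply: (word_gate_joined KO center_not_vertex Kz).
  by rewrite iter_center.
apply: connected_component_trans (gate x Kx xO) _.
by rewrite f2 -f1; apply: connected_component_sym; exact: gate.
Qed.

End CentralPiece.

(** * Bounds at points that are never terminal *)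

Lemma pigeonhole (k : nat) (I : finType) (f : 'I_k.+1 -> I) : (#|I| <= k)%N ->
  exists i j, i <> j /\ f i = f j.
Proof.
move=> Ik; apply: contrapT => h.
have f_inj : injective f.
  by move=> i j e; apply: contrapT => ij; apply: h; exists i, j.
by have := leq_card f f_inj; rewrite card_ord leqNgt ltnS Ik.
Qed.

(** While [q] is a vertex of [P], the last letter of the word can be absorbed, since the image of a
    vertex is terminal. The process stops where [word_branches] applies or the word is empty. *)
Lemma terminal_or_not p : K p ->
  (exists w q, [/\ p = Sw w q, K q, terminal q & w = [::] \/ ~ V q]) \/
  (forall w q, p = Sw w q -> K q -> ~ terminal q).
Proof.
move=> Kp; have [h|nh] := pselect (forall w q, p = Sw w q -> K q -> ~ terminal q); first by right.
left; move: nh => /existsNP[w] /existsNP[q] /not_implyP[pE] /not_implyP[Kq] /contrapT tq.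
move: q pE Kq tq; elim/last_ind: w => [|w i IH] q pE Kq tq.
  by exists [::], q; split => //; left.
have [Vq|nVq] := pselect (V q); last by exists (rcons w i), q; split => //; right.
apply: (IH (S i q)); last exact: piece_vertex_terminal.
  by rewrite pE -cats1 word_cat.
exact: attractor_stable.
Qed.

Lemma word_avoiding p k (x : 'I_k -> plane R) : K p -> (forall a, x a <> p) ->
  exists w q, [/\ p = Sw w q, K q & forall a, ~ (Sw w @` K) (x a)].
Proof.
move=> Kp xp; have : \forall l \near \oo, forall a, forall w, size w = l ->
    (Sw w @` K) p -> ~ (Sw w @` K) (x a).
  by apply: filter_forall => a; exact: far_from_piece.
move=> /filter_ex[l hl]; have [w [q [wl Kq pE]]] := attractor_word l Kp.
by exists w, q; split => // a; apply: hl => //; exists q.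
Qed.

Lemma nonterminal_branches_le p : K p -> (forall w q, p = Sw w q -> K q -> ~ terminal q) ->
  (branches K p #<= `I_n)%card.
Proof.
move=> Kp np; apply: card_components_le => x Xx.
have [w [q [pE Kq nx]]] := word_avoiding Kp (fun a => (Xx a).2).
have nVq : ~ V q by move=> /vertex_terminal; exact: (np w).
have /choice[l lP] : forall a, exists l : 'I_n, word_retraction w (x a) = Sw w (rot l A).
  move=> a; have [v Vv ->] := word_retraction_vertex (Xx a).1 (nx a).
  by have [j jn ->] := vertexP VE Vv; exists (Ordinal jn).
have [a [b [ab e]]] : exists a b, a <> b /\ l a = l b by apply: pigeonhole; rewrite card_ord.
exists a, b; split => //.
have gate c : joined (K `\ p) (x c) (word_retraction w (x c)).
  rewrite pE; apply: word_gate_joined => //; first by case: (Xx c).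
  by rewrite -pE; case: (Xx c).
apply: connected_component_trans (gate a) _.
by rewrite lP e -lP; apply: connected_component_sym; exact: gate.
Qed.

Lemma central_escape i q : central i -> K q -> q <> O ->
  exists k q', [/\ q = Sw (nseq k i) q', K q' & ~ (S i @` K) q'].
Proof.
move=> ci Kq qO; apply: contrapT => nex.
have all_k k : exists2 q', K q' & q = Sw (nseq k i) q'.
  elim: k => [|k [q' Kq' qE]]; first by exists q.
  have [[q'' Kq'' e]|nS] := pselect ((S i @` K) q'); last by case: nex; exists k, q'.
  by exists q'' => //; rewrite qE -e -(addn1 k) nseqD word_cat.
have [k hk] := filter_ex (far_from_piece qO).
have [q' Kq' qE] := all_k k.
apply: (hk (nseq k i)); first exact: size_nseq.
  by exists O; [exact: center_attractor|exact: iter_center].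
by exists q'.
Qed.

(** The word is prolonged by central letters until its end [q] lies outside the central piece. Then
    removing [q] can separate from the rest only what hangs at its gate [r i q]. *)
Lemma central_nonterminal_branches_le i p : central i -> K p ->
  (forall w q, p = Sw w q -> K q -> ~ terminal q) -> (forall w, p <> Sw w O) ->
  (branches K p #<= `I_2)%card.
Proof.
move=> ci Kp np pO; apply: card_components_le => x Xx.
have [w0 [q0 [pE0 Kq0 nx0]]] := word_avoiding Kp (fun a => (Xx a).2).
have q0O : q0 <> O by move=> e; apply: (pO w0); rewrite pE0 e.
have [k' [q [q0E Kq nSq]]] := central_escape ci Kq0 q0O.
pose w := w0 ++ nseq k' i.
have pE : p = Sw w q by rewrite /w word_cat -q0E.
have nVq : ~ V q by move=> /vertex_terminal; exact: (np w).
have nx a : ~ (Sw w @` K) (x a).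
  move=> [y Ky e]; apply: (nx0 a).
  by exists (Sw (nseq k' i) y); [exact: word_attractor|rewrite -word_cat].
have /choice[u uP] : forall a, exists v, V v /\ word_retraction w (x a) = Sw w v.
  by move=> a; have [v Vv e] := word_retraction_vertex (Xx a).1 (nx a); exists v.
have gate c : joined (K `\ p) (x c) (Sw w (u c)).
  rewrite -(uP c).2 pE; apply: word_gate_joined => //; first by case: (Xx c).
  by rewrite -pE; case: (Xx c).
(* Two classes: at most one vertex shares the gate of [q], and all others lie in the pruned set,
   which is connected and avoids [q]. *)
have [a [b [ab e]]] : exists a b, a <> b /\
    `[< r i (u a) = r i q >] = `[< r i (u b) = r i q >].
  by apply: (@pigeonhole 2 bool (fun a => `[< r i (u a) = r i q >])); rewrite card_bool.
exists a, b; split => //.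
apply: connected_component_trans (gate a) _.
apply: connected_component_trans (connected_component_sym (gate b)).
have [ra|ra] := pselect (r i (u a) = r i q).
  have rb : r i (u b) = r i q by move: e; rewrite asboolT // => /esym/asboolP.
  rewrite (central_gate_inj ci (uP a).1 (uP b).1) ?ra ?rb //.
  apply: connected_component_refl; apply: connected_component_sub (gate b).
have rb : r i (u b) <> r i q by move: e; rewrite asboolF // => /esym/asboolPn.
rewrite pE; apply: (@word_joined w [set y | K y /\ (r i y = r i q -> y = r i q)]).
  move=> z [Kz zb]; split; first exact: word_attractor.
  move=> /(word_inj (w := w)) zq; apply: nSq; rewrite zq in zb.
  rewrite {1}zb //; exact: (retraction_to (piece_tree_retraction i)).
have Ku c := vertex_in_attractor (uP c).1.
by apply: (joined_intro (@pruned_connected i (r i q))).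
Qed.

(** * Pieces meeting at a point and at the center *)

Lemma pieces_bound q : terminal q ->
  [/\ n = 3%N -> (#|pieces_at q| <= 5)%N, (n = 4%N \/ n = 5%N) -> (#|pieces_at q| <= 3)%N &
      (6 <= n)%N -> (#|pieces_at q| <= 2)%N].
Proof.
move=> tq; apply: (@card_common_vertex R n n_ge3 _ _ (fun i => Q i) q).
  move=> i /pieces_atP/tq[v Vv <-]; have [s _ si] := system_sim S_system i.
  exact: (similarity_cone n_ge3 AO VE PE si).
move=> i j /pieces_atP Qi /pieces_atP Qj /eqP ij y Qiy Qjy.
exact: (meet_unique S_system ij).
Qed.

(** [O] is the mean of the vertices; the mean of the first [k + 2] vertices is a convex combination
    of the next vertex and the previous mean. *)
Lemma center_in_polygon : P O.
Proof.
have avg k : P (A + (k.+1)%:R^-1 *: \sum_(l < k.+1) (rot l A - A)).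
  elim: k => [|k IH].
    by rewrite big_ord_recl big_ord0 turn0 subrr !addr0 scaler0 addr0; exact: VP.
  have Pk : P (rot k.+1 A) by apply/VP/(vertex_turn n_ge3 VE).
  have := polygon_convex PE Pk IH (t := (k.+2)%:R^-1).
  have -> : (k.+2)%:R^-1 *: rot k.+1 A + (1 - (k.+2)%:R^-1) *:
      (A + (k.+1)%:R^-1 *: \sum_(l < k.+1) (rot l A - A)) =
      A + (k.+2)%:R^-1 *: \sum_(l < k.+2) (rot l A - A).
    rewrite [in RHS]big_ord_recr /= -natr1.
    have c0 : k.+1%:R != 0 :> R by rewrite pnatr_eq0.
    have c1 : k.+1%:R + 1 != 0 :> R by rewrite natr1 pnatr_eq0.
    move: (\sum_(l < k.+1) _) (rot k.+1 A) (k.+1%:R) c0 c1 => s z c c0 c1.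
    by apply/rowP => l; rewrite !mxE; field; rewrite c0 c1.
  apply; rewrite invr_ge0 ler0n /= invf_le1 ?ltr0n // ler1n //.
have [k nk] : exists k, n = k.+1 by case: n n_ge3 => // k _; exists k.
have := avg k; rewrite -nk.
have -> : \sum_(l < n) (rot l A - A) = \sum_(l < n) (rot l A - O) + \sum_(l < n) (O - A).
  by rewrite -big_split /=; apply: eq_bigr => l _; rewrite addrA subrK.
rewrite (sum_vertices_eq0 O A n_ge3) add0r sumr_const card_ord -(scaler_nat n (O - A)) scalerA mulVf.
  by rewrite scale1r addrC subrK.
by rewrite pnatr_eq0; case: n n_ge3.
Qed.

Lemma turn_index k i : exists j, exists2 g, G g & rot k \o S i = S j \o g.
Proof. by have [g Gg [j e]] := S_symmetric i (group_turn k); exists j, g. Qed.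

Lemma turn_index_inj i j k l g g' h : terminal O -> Q i O -> (k < n)%N -> (l < n)%N ->
  G g -> G g' -> rot k \o S i = S j \o g -> rot l \o S i = S h \o g' -> j = h -> k = l.
Proof.
move=> tO Qi kn ln Gg Gg' e e' jh; have [u Vu uO] := tO i Qi.
have c : S i O <> O.
  move=> c; apply: center_not_vertex.
  by rewrite -(system_inj S_system (i := i) (etrans uO (esym c))).
apply: (turn_inj n_ge3 c kn ln).
by rewrite (turn_piece_center Gg e) (turn_piece_center Gg' e') jh.
Qed.

(** Distinct pieces at [O] meet only there, so a common center would be [O], which is a vertex of
    both. *)
Lemma piece_center_inj i j : terminal O -> Q i O -> Q j O -> S i O = S j O -> i = j.
Proof.
move=> tO Qi Qj e; apply: contrapT => ij; have [u Vu uO] := tO i Qi.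
have PO := center_in_polygon.
have c : S i O = O by apply: (meet_unique S_system ij) => //; exists O.
by apply: center_not_vertex; rewrite -(system_inj S_system (i := i) (etrans uO (esym c))).
Qed.

Lemma noncentral_orbit i : terminal O -> Q i O ->
  exists f : 'I_n -> 'I_m, [/\ injective f, forall k, f k \in pieces_at O &
    forall k : 'I_n, rot k (S i O) = S (f k) O].
Proof.
move=> tO Qi; have /choice[f fP] : forall k : 'I_n, exists j, exists2 g, G g & rot k \o S i = S j \o g.
  by move=> k; exact: turn_index.
exists f; split.
- move=> k l e; have [g Gg ge] := fP k; have [g' Gg' ge'] := fP l.
  exact/val_inj/(turn_index_inj tO Qi (ltn_ord k) (ltn_ord l) Gg Gg' ge ge' e).
- by move=> k; have [g Gg e] := fP k; apply/pieces_atP; exact: piece_turn_center Gg e.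
- by move=> k; have [g Gg e] := fP k; exact: turn_piece_center e.
Qed.

(** Otherwise the rotations turn one piece at [O] into [n] pieces meeting there, more than the
    corners allow. *)
Lemma central_exists : (4 <= n)%N -> exists i, central i.
Proof.
move=> n4; apply: contrapT => nc.
have tO : terminal O by apply: center_terminal => i ci; apply: nc; exists i.
have [i _ Qi] := center_union; have [f [f_inj fJ _]] := noncentral_orbit tO Qi.
have nJ : (n <= #|pieces_at O|)%N.
  rewrite -[X in (X <= _)%N]card_ord -(card_imset _ f_inj).
  by apply: subset_leq_card; apply/fintype.subsetP => _ /imsetP[k _ ->].
have [_ h45 h6] := pieces_bound tO.
have [n6|n6] := leqP 6 n.
  by have := leq_trans nJ (h6 n6); rewrite leqNgt n_ge3.
have n45 : n = 4%N \/ n = 5%N.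
  by move: n4 n6; case: n => [|[|[|[|[|[|k]]]]]] // _ _; [left|right].
by have := leq_trans nJ (h45 n45); rewrite leqNgt n4.
Qed.

(* Without a central triangle, at most five triangles meet at [O], and the rotation
   of order three permutes them without fixed points. *)
Lemma triangle_center_order : n = 3%N -> has_order K O 3.
Proof.
move=> n3; have [[i ci]|nc] := pselect (exists i, central i).
  by have := center_order ci; rewrite n3.
have tO : terminal O by apply: center_terminal => i ci; apply: nc; exists i.
have [h3 _ _] := pieces_bound tO.
suff e : #|pieces_at O| = 3%N by rewrite -e; exact: terminal_order center_attractor tO.
have [i _ Qi] := center_union; have [f [f_inj fJ fO]] := noncentral_orbit tO Qi.
have fE : #|f @: 'I_n| = n by rewrite card_imset // card_ord.
have fsub : f @: 'I_n \subset pieces_at O by apply/fintype.subsetP => _ /imsetP[k _ ->].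
apply/eqP; rewrite eqn_leq; apply/andP; split; last by rewrite -[X in (X <= _)%N]n3 -[X in (X <= _)%N]fE subset_leq_card.
rewrite leqNgt; apply/negP => J4.
have /subsetPn[j jJ jf] : ~~ (pieces_at O \subset f @: 'I_n).
  by apply/negP => /subset_leq_card; rewrite fE n3 leqNgt J4.
have Qj : Q j O by apply/pieces_atP.
have [f' [f'_inj f'J f'O]] := noncentral_orbit tO Qj.
(* A piece in both orbits, turned back, would have the same center as [j], and pieces at [O] are
   determined by their centers. *)
have disj : f @: 'I_n :&: f' @: 'I_n = finset.set0.
  apply/setP => h; rewrite !inE; apply/negP => /andP[].
  move=> /imsetP[k _ hk] /imsetP[l _ hl]; move/negP: jf; apply.
  have lt : ((k + (n - l)) %% n < n)%N by rewrite ltn_mod (leq_trans _ n_ge3).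
  apply/imsetP; exists (Ordinal lt) => //; apply: piece_center_inj => //.
    exact/pieces_atP.
  rewrite -fO /= -(turn_mod O n_ge3) addnC -turnD fO -hk hl -f'O turnD.
  by rewrite subnK ?(turn_full O n_ge3) // ltnW.
have UE : (#|f @: 'I_n :|: f' @: 'I_n| <= 5)%N.
  apply: leq_trans (h3 n3); apply: subset_leq_card; apply/fintype.subsetP => h; rewrite inE.
  by move=> /orP[] /imsetP[k _ ->].
move: UE; rewrite cardsU disj cards0 subn0.
by rewrite !card_imset // card_ord n3.
Qed.

(** Equal maps would send two vertices to two common points of distinct pieces. *)
Lemma distinct_pieces i j : i <> j -> S i <> S j.
Proof.
move=> ij e; apply: AO; apply: (turn_fixed n_ge3 (k := 1)).
  by rewrite /= (leq_trans _ n_ge3).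
have VA1 : V (rot 1 A) by exact: (turn_vertex n_ge3 VE).
apply: (system_inj S_system (i := i)); apply: (meet_unique S_system ij).
- by exists (rot 1 A) => //; exact: VP.
- by rewrite e; exists (rot 1 A) => //; exact: VP.
- by exists A => //; exact: VP.
- by rewrite e; exists A => //; exact: VP.
Qed.

(** * Ramification points according to the number of vertices *)

Lemma word_order w q k : w = [::] \/ ~ V q -> K q -> has_order K q k -> has_order K (Sw w q) k.
Proof.
move=> [->//|nVq] Kq; apply: card_eq_trans; exact: word_branches.
Qed.

Lemma ramification_order p k : ramification_point K p -> has_order K p k -> (3 <= k)%N.
Proof. by move=> [_ h] o; rewrite -card_le_II -(card_le_eqr o). Qed.

Lemma ramification_cases p : (4 <= n)%N -> ramification_point K p ->
  ((exists w, p = Sw w O) /\ has_order K p n) \/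
  exists w q, [/\ p = Sw w q, K q, terminal q, has_order K p #|pieces_at q| &
    (3 <= #|pieces_at q|)%N].
Proof.
move=> n4 ram; have [Kp p3] := ram.
have [[w [q [pE Kq tq wq]]]|np] := terminal_or_not Kp.
  right; exists w, q.
  have o : has_order K p #|pieces_at q|.
    by rewrite pE; apply: word_order => //; exact: terminal_order.
  by split => //; exact: ramification_order ram o.
have [i ci] := central_exists n4; left.
have [[w pE]|pO] := pselect (exists w, p = Sw w O).
  split; first by exists w.
  rewrite pE; apply: word_order; [by right; exact: center_not_vertex|exact: center_attractor|].
  exact: (center_order ci).
have le2 := central_nonterminal_branches_le ci Kp np (fun w e => pO (ex_intro _ w e)).
by have := card_le_trans p3 le2; rewrite card_le_II.
Qed.

Definition triple_points : set (plane R) := [set x | exists i1 i2 i3 : 'I_m,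
  [/\ S i1 <> S i2, S i1 <> S i3 & S i2 <> S i3] /\
  [/\ (S i1 @` V) x, (S i2 @` V) x & (S i3 @` V) x]].

Lemma triple_points_finite : finite_set triple_points.
Proof.
apply: (@sub_finite_set _ _ (\bigcup_i (S i @` V))).
  by move=> x [i1 [_ [_ [_ [x1 _ _]]]]]; exists i1.
by apply: bigcup_finite => // i _; apply: finite_image; exact: (vertex_finite VE).
Qed.

Lemma triple_point_order x : n = 4%N \/ n = 5%N -> triple_points x ->
  ramification_point K x /\ has_order K x 3.
Proof.
move=> n45 [i1 [i2 [i3 [[d12 d13 d23] [x1 x2 x3]]]]].
have SVQ := @vertex_piece _ _ _ PE _ S.
have tx : terminal x.
  move=> j Qj; have [->//|/eqP ji] := eqVneq j i1.
  by have [] := meet_vertex S_system ji Qj (SVQ i1 x x1).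
have Kx : K x by case: x1 => v Vv <-; apply/attractor_stable/vertex_in_attractor.
have [_ /(_ n45) J3 _] := pieces_bound tx.
have e : #|pieces_at x| = 3%N.
  apply/eqP; rewrite eqn_leq J3 /=.
  apply/card_geqP; exists [:: i1; i2; i3]; split => //=.
    by rewrite !inE negb_or !andbT; apply/andP; split; [apply/andP; split|];
      apply/eqP => h; [apply: d12|apply: d13|apply: d23]; rewrite h.
  move=> j js; apply/pieces_atP; move: js; rewrite !inE => /or3P[] /eqP ->.
  - exact: SVQ x1.
  - exact: SVQ x2.
  - exact: SVQ x3.
have o : has_order K x 3 by rewrite -e; exact: terminal_order.
by split => //; split => //; rewrite (card_le_eqr o).
Qed.

Lemma terminal_triple_point q : terminal q -> (3 <= #|pieces_at q|)%N -> triple_points q.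
Proof.
move=> tq /card_geqP[s [us s3 sJ]].
case: s us s3 sJ => [|a [|b [|c [|]]]] //= us _ sJ.
move: us; rewrite !inE negb_or !andbT => /andP[/andP[/eqP ab /eqP ac] /eqP bc].
exists a, b, c; split; first by split; exact: distinct_pieces.
by split; apply: tq; apply/pieces_atP; apply: sJ; rewrite !inE eqxx ?orbT.
Qed.

Lemma attractor_ramification :
  [/\ (6 <= n)%N ->
        forall p, ramification_point K p ->
          (exists j, p = word_map S j O) /\ has_order K p n,
      (n = 4%N \/ n = 5%N) ->
        exists X : set (plane R),
          [/\ finite_set X,
              forall x, X x ->
                [/\ ramification_point K x,
                    has_order K x 3 &
                    exists i1 i2 i3 : 'I_m,
                      [/\ S i1 <> S i2, S i1 <> S i3 & S i2 <> S i3] /\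
                      [/\ (S i1 @` V) x, (S i2 @` V) x & (S i3 @` V) x]] &
              forall p, ramification_point K p ->
                ((exists j, p = word_map S j O) /\ has_order K p n) \/
                ((exists j, exists2 x, X x & p = word_map S j x) /\
                 has_order K p 3)] &
      n = 3%N ->
        (ramification_point K O /\ has_order K O 3) /\
        (forall p, ramification_point K p ->
           (forall j, p <> word_map S j O) ->
           (branches K p #<= `I_5)%card)].
Proof.
split.
- move=> n6 p ram; have n4 : (4 <= n)%N by exact: leq_trans n6.
  have [//|[w [q [_ _ tq _ q3]]]] := ramification_cases n4 ram.
  have [_ _ /(_ n6) q2] := pieces_bound tq.
  by have := leq_trans q3 q2.
- move=> n45; have n4 : (4 <= n)%N by case: n45 => ->.
  exists triple_points; split; first exact: triple_points_finite.
    by move=> x Xx; have [] := triple_point_order n45 Xx.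
  move=> p ram; have [?|[w [q [pE Kq tq o q3]]]] := ramification_cases n4 ram; first by left.
  have [_ /(_ n45) q3' _] := pieces_bound tq.
  right; split; last by have <- : #|pieces_at q| = 3%N by [apply/eqP; rewrite eqn_leq q3 q3'].
  by exists w, q => //; exact: terminal_triple_point.
- move=> n3; have o := triangle_center_order n3; split.
    by split => //; split; [exact: center_attractor|rewrite (card_le_eqr o)].
  move=> p [Kp _] _; have [[w [q [pE Kq tq wq]]]|np] := terminal_or_not Kp.
    have oq : has_order K p #|pieces_at q|.
      by rewrite pE; apply: word_order => //; exact: terminal_order.
    by rewrite (card_le_eql oq) card_le_II; have [/(_ n3)] := pieces_bound tq.
  apply: card_le_trans (nonterminal_branches_le Kp np) _.
  by rewrite card_le_II n3.
Qed.

End Attractor.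

Theorem mainTheorem3 (R : realType) (n : nat) (O : plane R)
    (P V : set (plane R)) (G : set (plane R -> plane R))
    (m : nat) (S : 'I_m -> plane R -> plane R) (K : set (plane R))
    (n_ge3 : (3 <= n)%N)
    (P_regular : regular_polygon n O P V)
    (G_group : symmetry_group P G)
    (G_rotations : rotation_group P `<=` G)
    (S_system : polygonal_system P V S)
    (S_symmetric : symmetric_system G S)
    (K_attractor : attractor S K) :
  [/\ (6 <= n)%N ->
        forall p, ramification_point K p ->
          (exists j, p = word_map S j O) /\ has_order K p n,
      (n = 4%N \/ n = 5%N) ->
        exists X : set (plane R),
          [/\ finite_set X,
              forall x, X x ->
                [/\ ramification_point K x,
                    has_order K x 3 &
                    exists i1 i2 i3 : 'I_m,
                      [/\ S i1 <> S i2, S i1 <> S i3 & S i2 <> S i3] /\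
                      [/\ (S i1 @` V) x, (S i2 @` V) x & (S i3 @` V) x]] &
              forall p, ramification_point K p ->
                ((exists j, p = word_map S j O) /\ has_order K p n) \/
                ((exists j, exists2 x, X x & p = word_map S j x) /\
                 has_order K p 3)] &
      n = 3%N ->
        (ramification_point K O /\ has_order K O 3) /\
        (forall p, ramification_point K p ->
           (forall j, p <> word_map S j O) ->
           (branches K p #<= `I_5)%card)].
Proof.
have [A [AO VE PE]] := P_regular.
have /choice[T TP] : forall i, exists g : plane R -> plane R, cancel (S i) g /\ continuous g.
  move=> i; have [s _ /similarity_bij[g sg [Sg _]]] := system_sim S_system i.
  by exists g; split => //; exact: similarity_continuous sg.
have /choice[r rP] := system_retraction n_ge3 AO VE PE S_system.
exact: (attractor_ramification n_ge3 AO VE PE S_system G_group S_symmetric K_attractor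
  (fun i => (TP i).1) (fun i => (TP i).2) rP G_rotations).
Qed.
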